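(* Let $d\in\mathbb N$, $1<q\le2$, $a>1/q$ and $b\in\mathbb R$. Then $$\varepsilon_k(\mathbf W^{a,b}_q,L_\infty)\ll k^{-a}(\log k)^{(d-1)(a+b)+1/2},\qquad k\ge2.$$
   Context: Functions are complex-valued and $2\pi$-periodic in each of $d$ variables; $L_p=L_p(\mathbb T^d)$ with respect to the normalized measure $(2\pi)^{-d}d\mathbf x$; $\hat f(\mathbf k)=(2\pi)^{-d}\int_{\mathbb T^d}f(\mathbf x)e^{-i(\mathbf k,\mathbf x)}d\mathbf x$. For $\mathbf s\in\mathbb Z_+^d$ (nonnegative integer coordinates) let $\rho(\mathbf s)=\{\mathbf k\in\mathbb Z^d:[2^{s_j-1}]\le|k_j|<2^{s_j},\ j=1,\dots,d\}$, where $[\cdot]$ is the integer part, and $\|\mathbf s\|_1=s_1+\dots+s_d$. For $f\in L_1$ let $\delta_{\mathbf s}(f)=\sum_{\mathbf k\in\rho(\mathbf s)}\hat f(\mathbf k)e^{i(\mathbf k,\mathbf x)}$ and $f_l=\sum_{\|\mathbf s\|_1=l}\delta_{\mathbf s}(f)$, $l=0,1,2,\dots$. Class: $\mathbf W^{a,b}_q=\{f\in L_1:\|f_l\|_q\le 2^{-al}(\bar l)^{(d-1)b}\text{ for all } l\ge0\}$, $\bar l=\max(l,1)$. Entropy numbers: for a subset $A$ of a Banach space $X$, $\varepsilon_k(A,X)=\inf\{\varepsilon:\exists y^1,\dots,y^{2^k}\in X,\ A\subseteq\bigcup_{j=1}^{2^k}B_X(y^j,\varepsilon)\}$, where $B_X(y,r)=\{x\in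 X:\|x-y\|\le r\}$. $A_k\ll B_k$ means $A_k\le CB_k$ for all $k$ with $C$ independent of $k$ (it may depend on the other parameters). *)

(* Defs.v *)
From HB Require Import structures.
From mathcomp Require Import all_boot all_order all_algebra.
From mathcomp Require Import complex.
From mathcomp Require Import all_classical all_reals all_analysis.

Set Implicit Arguments.
Unset Strict Implicit.
Unset Printing Implicit Defensive.

Import Order.TTheory GRing.Theory Num.Theory.
Import numFieldNormedType.Exports.

Local Open Scope classical_set_scope.
Local Open Scope ring_scope.

Notation Rn R d := (d.-tuple (measurableTypeR R)).

(* Points of R^d are d-tuples of reals. Functions on the torus are functions
   on R^d that are 2pi-periodic in each variable; they are integrated against
   the normalized Lebesgue measure of the cube [0, 2pi]^d. *)
Section torus_measure.
Context (R : realType).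

Lemma two_pi_gt0 : (0 : R) < 2 * pi.
Proof. by rewrite mulr_gt0// pi_gt0. Qed.

Definition cons_pair n (u : measurableTypeR R * Rn R n) : Rn R n.+1 :=
  [tuple of u.1 :: u.2].

Lemma measurable_cons_pair n : measurable_fun
    [set: measurableTypeR R * Rn R n] (@cons_pair n).
Proof. exact: measurable_cons measurable_fst measurable_snd. Qed.

HB.instance Definition _ n :=
  isMeasurableFun.Build _ _ _ _ (@cons_pair n) (@measurable_cons_pair n).

Definition circle_measure : probability (measurableTypeR R) R :=
  uniform_prob two_pi_gt0.

(* d-fold product of circle_measure: the measure (2pi)^-d dx on [0, 2pi]^d *)
Fixpoint torus_measure d : probability (Rn R d) R :=
  match d with
  | 0 => dirac [tuple]
  | n.+1 => distribution (circle_measure \x torus_measure n)%E (@cons_pair n)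
  end.

End torus_measure.
Arguments torus_measure : clear implicits.

Section function_spaces.
Context (R : realType) (d : nat).
Implicit Types (f : Rn R d -> R[i]) (p : \bar R).

Definition shift_coord (x : Rn R d) (j : 'I_d) (t : R) : Rn R d :=
  [tuple tnth x i + (if i == j then t else 0) | i < d].

Definition periodic_2pi f :=
  forall x j, f (shift_coord x j (2 * pi)) = f x.

Definition Lp_norm p f : \bar R :=
  Lnorm (torus_measure R d) p (fun x => (Normc.normc (f x))%:E).

(* Almost everywhere equal functions are not identified: Lp consists of all
   the representatives, and Lp_norm is a seminorm on it. *)
Definition Lp p : set (Rn R d -> R[i]) :=
  [set f | [/\ periodic_2pi f,
    measurable_fun setT (fun x => complex.Re (f x)),
    measurable_fun setT (fun x => complex.Im (f x)) &
    (Lp_norm p f < +oo)%E]].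

End function_spaces.

Section fourier.
Context (R : realType) (d : nat).
Implicit Types (f : Rn R d -> R[i]) (k : d.-tuple int) (s : d.-tuple nat).

Local Open Scope complex_scope.

Definition dotp k (x : Rn R d) : R :=
  \sum_(j < d) (tnth k j)%:~R * tnth x j.

Definition expi (t : R) : R[i] := cos t +i* sin t.

Definition torus_integral f : R[i] :=
  Rintegral (torus_measure R d) setT (fun x => complex.Re (f x)) +i*
  Rintegral (torus_measure R d) setT (fun x => complex.Im (f x)).

Definition fourier_coef f k : R[i] :=
  torus_integral (fun x => f x * expi (- dotp k x)).

(* 2 ^ s %/ 2 is the integer part of 2^(s-1), which is 0 for s = 0 *)
Definition rho s : set (d.-tuple int) :=
  [set k | forall j : 'I_d,
    (2 ^ tnth s j %/ 2 <= `|tnth k j| < 2 ^ tnth s j)%N].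

Definition norm1 s : nat := (\sum_(j < d) tnth s j)%N.

(* The index sets of the two sums below are finite: finite_rho and
   finite_norm1. *)
Definition delta s f : Rn R d -> R[i] :=
  fun x => \sum_(k \in rho s) fourier_coef f k * expi (dotp k x).

Definition layer l f : Rn R d -> R[i] :=
  fun x => \sum_(s \in [set s | norm1 s = l]) delta s f x.

Definition W (q a b : R) : set (Rn R d -> R[i]) :=
  [set f | Lp 1%:E f /\
    forall l : nat, (Lp_norm q%:E (layer l f) <=
      (2 `^ (- a * l%:R) * (maxn l 1)%:R `^ ((d%:R - 1) * b))%:E)%E].

End fourier.

Lemma finite_norm1 d l : finite_set [set s : d.-tuple nat | norm1 s = l].
Proof.
apply: (@sub_finite_set _ _
  (range (fun u : d.-tuple 'I_l.+1 => [tuple val (tnth u i) | i < d]))).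
  move=> s /= sl; have ltl i : (tnth s i < l.+1)%N.
    by rewrite ltnS -sl /norm1 (bigD1 i)//= leq_addr.
  exists [tuple Ordinal (ltl i) | i < d] => //.
  by apply: eq_from_tnth => i; rewrite !tnth_mktuple.
exact: finite_image.
Qed.

Lemma finite_rho d (s : d.-tuple nat) : finite_set (rho s).
Proof.
pose N := (\max_(j < d) 2 ^ tnth s j)%N.
apply: (@sub_finite_set _ _ (range (fun u : d.-tuple (bool * 'I_N.+1) =>
  [tuple (-1) ^+ (tnth u i).1 * (val (tnth u i).2)%:Z | i < d]))).
  move=> k /= sk; have ltN i : (`|tnth k i| < N.+1)%N.
    have /andP[_ /ltnW h] := sk i.
    by rewrite ltnS (leq_trans h)// /N (bigD1 i)//= leq_maxl.
  exists [tuple (tnth k i < 0, Ordinal (ltN i)) | i < d] => //.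
  by apply: eq_from_tnth => i; rewrite !tnth_mktuple/= -intEsign.
exact: finite_image.
Qed.

Section entropy.
Context (R : realType) (V : zmodType).

(* The normed space is given by its carrier X and its norm N, a function on
   the ambient group V. *)
Definition normed_ball (X : set V) (N : V -> \bar R) (y : V) (r : R) : set V :=
  [set x | X x /\ (N (x - y)%R <= r%:E)%E].

Definition entropy_number (X : set V) (N : V -> \bar R) (A : set V) (k : nat)
    : \bar R :=
  ereal_inf [set e%:E | e in [set e : R | 0 <= e /\
    exists y : 'I_(2 ^ k) -> V, (forall j, X (y j)) /\
      A `<=` \bigcup_j normed_ball X N (y j) e]].

End entropy.

Definition entropy_Linfty (R : realType) (d : nat)
    (A : set (Rn R d -> R[i])) (k : nat) : \bar R :=
  entropy_number (Lp +oo%E) (Lp_norm +oo%E) A k.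

(* Main.v *)
(* An element of the L_2 ball of trigonometric polynomials with N given
   frequencies is the mean of independent random signs; a change-of-measure form
   of dual Sudakov minoration turns this into entropy bounds of the L_2 ball in
   L_{2r}, with constant sqrt(r). Halving the number of bits and interpolating
   between L_q and a large L_p gives entropy numbers C sqrt(r) (N / k)^b of the
   L_q ball in L_{2r}, with b as close to 1/q as desired, and iterating the
   halving replaces b by any of its multiples. The level f_l has about
   N_l = 2^l (l+1)^(d-1) frequencies in a cube of side 2^l, so for r = l + 1 the
   norm of L_{2r} dominates that of L_infinity; the factor sqrt(l + 1) is the
   extra (log k)^(1/2) of the theorem. Let N_n be about k, and spend about
   k 2^(-delta |l - n|) bits on the level l: as a > 1/q, the errors decrease
   geometrically away from l = n. Finally, a difference of two functions of the
   class is almost everywhere the sum of its levels, because an integrable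
   function with zero Fourier coefficients vanishes almost everywhere. *)

Require Import Defs.
From mathcomp Require Import all_boot all_order all_algebra.
From mathcomp Require Import complex.
From mathcomp Require Import all_classical all_reals all_analysis.
From mathcomp Require Import measurable_realfun ring lra zify.

Set Implicit Arguments.
Unset Strict Implicit.
Unset Printing Implicit Defensive.

Import Order.TTheory GRing.Theory Num.Theory.
Import numFieldNormedType.Exports.

Local Open Scope classical_set_scope.
Local Open Scope ring_scope.

(** * Trigonometric polynomials on the torus *)

Section bounded_measurable.
Context d (T : measurableType d) (R : realType) (P : probability T R).
Implicit Types f g : T -> R.

(** The power of the logarithm dictates the order of the steps. The passage from L_2 to L_2r costs
    sqrt(r); if the recursion of [Ent_bootstrap] were run with r = l + 1, its constant would be of
    order r^(1/(2t)), which exceeds sqrt(r) when q < 2. So the recursion uses a fixed exponent p = 2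
    r0, and the exponent that depends on the level enters once, in the last passage from L_2. With
    1/2 = t/q + (1 - t)/p, the exponent b = 1/(2t) solves b (1 - t) + 1/2 = b, so the recursion
    closes; b tends to 1/q as p grows, and the strict inequality a > 1/q leaves room for a finite p
    with b < a. Far below n the bits outnumber the frequencies of a level. No exponential decay is
    proved there: a sufficiently high power of N / k is enough, hence the multiples of b. Entropy is
    expressed by partitions into mutually close elements. Without centres, partitions of different
    levels can be intersected, rescaled and refined freely; centres are chosen only at the very
    end. *)

Definition bmeas f := measurable_fun setT f /\ exists M : R, forall x, `|f x| <= M.

Lemma bmeas_cst (c : R) : bmeas (fun=> c).
Proof. by split=> //; exists `|c|. Qed.

Lemma bmeasD f g : bmeas f -> bmeas g -> bmeas (fun x => f x + g x).
Proof.
move=> [mf [M fM]] [mg [N gN]]; split; first exact: measurable_funD.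
by exists (M + N) => x; rewrite (le_trans (ler_normD _ _))// lerD.
Qed.

Lemma bmeasM f g : bmeas f -> bmeas g -> bmeas (fun x => f x * g x).
Proof.
move=> [mf [M fM]] [mg [N gN]]; split; first exact: measurable_funM.
by exists (M * N) => x; rewrite normrM ler_pM.
Qed.

Lemma bmeasZ (c : R) f : bmeas f -> bmeas (fun x => c * f x).
Proof. by move=> bf; apply: bmeasM => //; exact: bmeas_cst. Qed.

Lemma bmeasN f : bmeas f -> bmeas (fun x => - f x).
Proof. by move=> [mf [M fM]]; split; [exact: measurableT_comp|exists M => x; rewrite normrN]. Qed.

Lemma bmeasB f g : bmeas f -> bmeas g -> bmeas (fun x => f x - g x).
Proof. by move=> bf bg; apply: bmeasD => //; exact: bmeasN. Qed.

Lemma bmeas_sum (I : Type) (s : seq I) (f : I -> T -> R) :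
  (forall i, bmeas (f i)) -> bmeas (fun x => \sum_(i <- s) f i x).
Proof.
move=> bf; elim: s => [|i s IHs].
  by rewrite (_ : (fun _ => _) = fun=> 0) ?funeqE// => [|x]; [exact: bmeas_cst|rewrite big_nil].
rewrite (_ : (fun _ => _) = fun x => f i x + \sum_(j <- s) f j x).
  exact: bmeasD.
by apply/funext => x; rewrite big_cons.
Qed.

Lemma bmeas_exp f n : bmeas f -> bmeas (fun x => f x ^+ n).
Proof.
move=> bf; elim: n => [|n IHn].
  by rewrite (_ : (fun _ => _) = fun=> 1)//; exact: bmeas_cst.
by under eq_fun do rewrite exprS; exact: bmeasM.
Qed.

Lemma bmeas_integrable f : bmeas f -> P.-integrable setT (EFin \o f).
Proof.
move=> [mf [M fM]]; apply: measurable_bounded_integrable => //.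
  by rewrite (_ : _ [set: T] = 1%E) ?ltry//; exact: probability_setT.
by exists (M : R); split; [exact: num_real|move=> y My x _; exact: (le_trans (fM x) (ltW My))].
Qed.

Lemma Rintegral_prob_cst (c : R) : \int[P]_x c = c.
Proof.
by rewrite Rintegral_cst//= probability_setT/= mulr1.
Qed.

Lemma Rintegral_bsum (I : Type) (s : seq I) (f : I -> T -> R) :
  (forall i, bmeas (f i)) ->
  \int[P]_x (\sum_(i <- s) f i x) = \sum_(i <- s) \int[P]_x f i x.
Proof.
move=> bf; elim: s => [|i s IHs].
  under eq_Rintegral do rewrite big_nil.
  by rewrite Rintegral_prob_cst big_nil.
rewrite big_cons -IHs -RintegralD//; last 2 first.
- exact/bmeas_integrable.
- exact/bmeas_integrable/bmeas_sum.
by apply: eq_Rintegral => x _; rewrite big_cons.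
Qed.

End bounded_measurable.

Section expi.
Context {R : realType}.
Implicit Types t : R.

Lemma expi0 : expi (0 : R) = 1.
Proof. by rewrite /expi cos0 sin0. Qed.

Lemma expiD (s t : R) : expi (s + t) = expi s * expi t.
Proof. by rewrite /expi cosD sinD; apply/eqP; rewrite eq_complex/= eqxx/= addrC. Qed.

Lemma normc_expi t : Normc.normc (expi t) = 1.
Proof. by rewrite /expi /= cos2Dsin2 sqrtr1. Qed.

Lemma sqr_normcE (z : R[i]) :
  Normc.normc z ^+ 2 = complex.Re z ^+ 2 + complex.Im z ^+ 2.
Proof. by case: z => x y /=; rewrite sqr_sqrtr// addr_ge0 ?sqr_ge0. Qed.

Lemma normc_ge0 (z : R[i]) : 0 <= Normc.normc z.
Proof. by case: z => x y; exact: sqrtr_ge0. Qed.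

End expi.

(** * Orthogonality of the characters *)

Section circle.
Context {R : realType}.

Lemma cos_nat_2pi n : cos (n%:R * (2 * pi)) = 1 :> R.
Proof.
rewrite -[RHS](@cos0 R) -[RHS](periodicn (@cosD2pi R) n) add0r.
by congr cos; rewrite -[RHS]mulr_natl mulr2n; ring.
Qed.

Lemma sin_nat_2pi n : sin (n%:R * (2 * pi)) = 0 :> R.
Proof.
rewrite -[RHS](@sin0 R) -[RHS](periodicn (@sinD2pi R) n) add0r.
by congr sin; rewrite -[RHS]mulr_natl mulr2n; ring.
Qed.

Lemma bmeas_circle_continuous (f : R -> R) (M : R) : continuous f ->
  (forall x, `|f x| <= M) -> @bmeas _ (measurableTypeR R) R f.
Proof. by move=> cf fM; split; [exact: continuous_measurable_fun|exists M]. Qed.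

(** The antiderivative is that of [1 + f] because the integral against the uniform law is computed
    for nonnegative integrands; the bound on [f] provides the sign. *)
Lemma circle_integral_FTC (f F : R -> R) : continuous f ->
  (forall x : R, `|f x| <= 1) ->
  (forall x : R, is_derive x 1 F (1 + f x)) -> F (2 * pi) - F 0 = 2 * pi ->
  \int[circle_measure R]_x f x = 0.
Proof.
move=> cf f1 dF Fpi.
have bf : @bmeas _ (measurableTypeR R) R f by exact: bmeas_circle_continuous f1.
have b1 : @bmeas _ (measurableTypeR R) R (fun=> 1) by exact: bmeas_cst.
have cF (x : R) : {for x, continuous F}.
  by apply: differentiable_continuous; apply/derivable1_diffP; have [] := dF x.
have : \int[circle_measure R]_x (1 + f x) = 1.
  rewrite /Rintegral integral_uniform; last 2 first.
  - by apply/measurable_EFinP; have [] := bmeasD b1 bf.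
  - by move=> x; rewrite lee_fin; have := f1 x; rewrite ler_norml; lra.
  rewrite (@continuous_FTC2 _ _ F)//.
  - by rewrite -EFinD -EFinM/= subr0 Fpi mulVf// gt_eqF// two_pi_gt0.
  - exact: two_pi_gt0.
  - apply: continuous_subspaceT => x; apply: cvgD; first exact: cvg_cst.
    exact: cf.
  - split; first by move=> x _; have [] := dF x.
    + exact: cvg_at_right_filter (cF 0).
    + exact: cvg_at_left_filter (cF _).
  - by move=> x _; rewrite derive1E; apply: derive_val.
rewrite RintegralD//; last 2 first.
- exact: bmeas_integrable.
- exact: bmeas_integrable.
rewrite Rintegral_cst//= probability_setT/= mul1r; lra.
Qed.

Lemma is_derive_mul_cst (c x df : R) (f : R -> R) :
  is_derive x 1 f df -> is_derive x 1 (fun y => c * f y) (c * df).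
Proof. by move=> fx; exact: is_deriveZ. Qed.

Lemma is_derive_comp_mul (c x df : R) (f : R -> R) :
  is_derive (c * x) 1 f df -> is_derive x 1 (fun y => f (c * y)) (df * c).
Proof.
move=> fx; apply: (@is_derive1_comp _ f (fun y => c * y)) => //.
by rewrite -[X in is_derive _ _ _ X](mulr1 c); exact: is_derive_mul_cst.
Qed.

Lemma circle_integral_cos (k : int) :
  \int[circle_measure R]_x cos (k%:~R * x) = (k == 0)%:R.
Proof.
have [->|k0] := eqVneq k 0.
  under eq_Rintegral do rewrite mul0r cos0.
  by rewrite Rintegral_cst//= probability_setT/= mul1r.
pose n := `|k|%N; have n0 : (n%:R : R) != 0 by rewrite pnatr_eq0 absz_eq0.
under eq_Rintegral => x _.
  rewrite (_ : cos _ = cos (n%:R * x)); first over.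
  have [kE|kE] : k = n%:Z \/ k = - n%:Z by rewrite /n; case: (k); lia.
    by rewrite kE pmulrn.
  by rewrite kE mulrNz mulNr cosN pmulrn.
apply: (circle_integral_FTC (F := fun x => x + n%:R^-1 * sin (n%:R * x))).
- move=> x; apply: continuous_comp; last exact: continuous_cos.
  by apply: cvgM; [exact: cvg_cst|exact: cvg_id].
- by move=> x; rewrite ler_norml cos_le1 cos_geN1.
- move=> x; apply: is_deriveD.
  rewrite -[cos _](mulfK n0) [X in is_derive _ _ _ X]mulrC.
  exact/is_derive_mul_cst/is_derive_comp_mul.
- by rewrite mulr0 sin0 sin_nat_2pi; ring.
Qed.

Lemma circle_integral_sin (k : int) :
  \int[circle_measure R]_x sin (k%:~R * x) = 0.
Proof.
have pos (n : nat) : \int[circle_measure R]_x sin (n%:R * x) = 0.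
  have [->|n0'] := eqVneq n 0%N.
    under eq_Rintegral do rewrite mul0r sin0.
    by rewrite Rintegral_cst//= mul0r.
  have n0 : (n%:R : R) != 0 by rewrite pnatr_eq0.
  apply: (circle_integral_FTC (F := fun x => x - n%:R^-1 * cos (n%:R * x))).
  - move=> x; apply: continuous_comp; last exact: continuous_sin.
    by apply: cvgM; [exact: cvg_cst|exact: cvg_id].
  - by move=> x; rewrite ler_norml sin_le1 sin_geN1.
  - move=> x; apply: is_deriveD.
    rewrite (_ : sin _ = - (n%:R^-1 * (- sin (n%:R * x) * n%:R))); last by field.
    exact/is_deriveN/is_derive_mul_cst/is_derive_comp_mul.
  - by rewrite mulr0 cos0 cos_nat_2pi; ring.
have [kE|kE] : k = `|k|%:Z \/ k = - `|k|%:Z by case: (k); lia.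
  by rewrite kE -pmulrn pos.
rewrite kE; under eq_Rintegral do rewrite mulrNz mulNr sinN -mulN1r -pmulrn.
rewrite RintegralZl// ?pos ?mulr0//.
apply: (@bmeas_integrable _ (measurableTypeR R)).
apply: (@bmeas_circle_continuous _ 1); last first.
  by move=> x; rewrite ler_norml sin_le1 sin_geN1.
move=> x; apply: continuous_comp; last exact: continuous_sin.
by apply: cvgM; [exact: cvg_cst|exact: cvg_id].
Qed.

End circle.

Section torus.
Context {R : realType}.

Lemma measurable_dotp d (k : d.-tuple int) :
  measurable_fun setT (fun x : Rn R d => dotp k x).
Proof.
apply: measurable_sum => j; apply: measurable_funM => //.
exact: measurable_tnth.
Qed.

Lemma bmeas_cos_dotp d (k : d.-tuple int) : bmeas (fun x : Rn R d => cos (dotp k x)).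
Proof.
split; last by exists 1 => x; rewrite ler_norml cos_le1 cos_geN1.
apply: (@measurableT_comp _ _ _ _ _ _ (@cos R)); last exact: measurable_dotp.
by apply: continuous_measurable_fun; exact: continuous_cos.
Qed.

Lemma bmeas_sin_dotp d (k : d.-tuple int) : bmeas (fun x : Rn R d => sin (dotp k x)).
Proof.
split; last by exists 1 => x; rewrite ler_norml sin_le1 sin_geN1.
apply: (@measurableT_comp _ _ _ _ _ _ (@sin R)); last exact: measurable_dotp.
by apply: continuous_measurable_fun; exact: continuous_sin.
Qed.

Lemma torus_integral_prod n (f : Rn R n.+1 -> R) (F : measurableTypeR R -> R)
    (G : Rn R n -> R) :
  bmeas f -> bmeas F -> bmeas G ->
  (forall z, f (cons_pair z) = F z.1 * G z.2) ->
  \int[torus_measure R n.+1]_x f x =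
  \int[circle_measure R]_u F u * \int[torus_measure R n]_x G x.
Proof.
move=> bf bF bG fFG; rewrite /Rintegral/=.
have bfc : bmeas (f \o @cons_pair R n).
  have [mf [M fM]] := bf; split; last by exists M => x; exact: fM.
  by apply: measurableT_comp => //; exact: measurable_cons_pair.
rewrite integral_distribution; last 2 first.
- by apply/measurable_EFinP; have [] := bf.
- exact: (bmeas_integrable _ bfc).
rewrite -integral12_prod_meas1; last exact: (bmeas_integrable _ bfc).
have iG := bmeas_integrable (torus_measure R n) bG.
have iF := bmeas_integrable (circle_measure R) bF.
under eq_integral => u _.
  rewrite /fubini_F; under eq_integral => y _.
    rewrite /= fFG/= EFinM; over.
  rewrite integralZl// -[(\int[_]_x (G x)%:E)%E]fineK; last first.
    exact: integrable_fin_num.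
  rewrite -EFinM; over.
under eq_integral do rewrite EFinM.
by rewrite integralZr// fineM// integrable_fin_num.
Qed.

Lemma dotp_cons_pair n (k : n.+1.-tuple int) (z : measurableTypeR R * Rn R n) :
  dotp k (cons_pair z) = (thead k)%:~R * z.1 + dotp [tuple of behead k] z.2.
Proof.
rewrite /dotp big_ord_recl; congr (_ * _ + _).
apply: eq_bigr => j _; congr (_%:~R * _).
  by rewrite tnth_behead; congr (tnth k _); apply: val_inj => /=; rewrite inordK ?ltnS.
by rewrite (tnth_nth 0) [RHS](tnth_nth 0).
Qed.

(** The addition formulas mix cosine and sine, so the induction on [d] carries both integrals at
    once. *)
Lemma torus_integral_cos_sin d (k : d.-tuple int) :
  \int[torus_measure R d]_x cos (dotp k x) = \prod_j (tnth k j == 0)%:R /\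
  \int[torus_measure R d]_x sin (dotp k x) = 0.
Proof.
elim: d k => [|d IHd] k.
  have dot0 (x : Rn R 0) : dotp k x = 0 by rewrite /dotp big_ord0.
  split.
    under eq_Rintegral do rewrite dot0 cos0.
    by rewrite big_ord0; exact: (Rintegral_prob_cst (torus_measure R 0)).
  under eq_Rintegral do rewrite dot0 sin0.
  by rewrite Rintegral_cst//= mul0r.
have [IHc IHs] := IHd [tuple of behead k].
have bc := bmeas_cos_dotp [tuple of behead k].
have bs := bmeas_sin_dotp [tuple of behead k].
have cc (c : R) : continuous (fun x : R => cos (c * x)).
  move=> x; apply: continuous_comp; last exact: continuous_cos.
  by apply: cvgM; [exact: cvg_cst|exact: cvg_id].
have cs (c : R) : continuous (fun x : R => sin (c * x)).
  move=> x; apply: continuous_comp; last exact: continuous_sin.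
  by apply: cvgM; [exact: cvg_cst|exact: cvg_id].
have bc0 : bmeas (fun u : measurableTypeR R => cos ((thead k)%:~R * u)).
  apply: (@bmeas_circle_continuous R _ 1); first exact: cc.
  by move=> x; rewrite ler_norml cos_le1 cos_geN1.
have bs0 : bmeas (fun u : measurableTypeR R => sin ((thead k)%:~R * u)).
  apply: (@bmeas_circle_continuous R _ 1); first exact: cs.
  by move=> x; rewrite ler_norml sin_le1 sin_geN1.
have mt : measurable_fun setT (fun x : Rn R d.+1 => thead x).
  exact: measurable_tnth.
have mb : measurable_fun setT (fun x : Rn R d.+1 => [tuple of behead x] : Rn R d).
  apply/measurable_fun_tnthP => j /=.
  rewrite (_ : _ \o _ = (fun x => tnth x (inord j.+1))); first exact: measurable_tnth.
  by apply/funext => x /=; rewrite tnth_behead.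
have bT (F : measurableTypeR R -> R) : bmeas F -> bmeas (fun x : Rn R d.+1 => F (thead x)).
  by move=> [mF [M FM]]; split; [exact: measurableT_comp|exists M].
have bB (F : Rn R d -> R) : bmeas F -> bmeas (fun x : Rn R d.+1 => F [tuple of behead x]).
  by move=> [mF [M FM]]; split; [exact: measurableT_comp|exists M].
have split_x (x : Rn R d.+1) : x = cons_pair (thead x, [tuple of behead x]).
  by rewrite [LHS]tuple_eta; apply: val_inj.
have thK (z : measurableTypeR R * Rn R d) : thead (cons_pair z) = z.1.
  by rewrite /thead (tnth_nth 0).
have beK (z : measurableTypeR R * Rn R d) : [tuple of behead (cons_pair z)] = z.2.
  exact: val_inj.
have prod_int F G : bmeas F -> bmeas G ->
    \int[torus_measure R d.+1]_x (F (thead x) * G [tuple of behead x]) =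
    \int[circle_measure R]_u F u * \int[torus_measure R d]_x G x.
  move=> bF bG; apply: torus_integral_prod => //.
    by apply: bmeasM; [exact: bT|exact: bB].
  by move=> z; rewrite thK beK.
have iTB F G : bmeas F -> bmeas G -> (torus_measure R d.+1).-integrable setT
    (EFin \o (fun x : Rn R d.+1 => F (thead x) * G [tuple of behead x])).
  by move=> bF bG; apply: bmeas_integrable; apply: bmeasM; [exact: bT|exact: bB].
split.
  under eq_Rintegral => x _ do rewrite [x]split_x dotp_cons_pair cosD/= -split_x.
  rewrite RintegralB//; [|exact: (iTB _ _ bc0 bc)|exact: (iTB _ _ bs0 bs)].
  rewrite (prod_int _ _ bc0 bc) (prod_int _ _ bs0 bs) circle_integral_cos.
  rewrite circle_integral_sin IHc mul0r subr0.
  rewrite big_ord_recl; congr (_ * _); apply: eq_bigr => j _.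
  by rewrite tnth_behead; congr ((tnth k _ == 0)%:R); apply: val_inj => /=; rewrite inordK ?ltnS.
under eq_Rintegral => x _ do rewrite [x]split_x dotp_cons_pair sinD/= -split_x.
rewrite RintegralD//; [|exact: (iTB _ _ bs0 bc)|exact: (iTB _ _ bc0 bs)].
rewrite (prod_int _ _ bs0 bc) (prod_int _ _ bc0 bs).
by rewrite circle_integral_sin IHs mul0r mulr0 addr0.
Qed.

Definition tsub d (k l : d.-tuple int) : d.-tuple int :=
  [tuple tnth k j - tnth l j | j < d].

Lemma dotp_tsub d (k l : d.-tuple int) (x : Rn R d) :
  dotp (tsub k l) x = dotp k x - dotp l x.
Proof.
rewrite /dotp -sumrB; apply: eq_bigr => j _.
by rewrite tnth_mktuple intrB mulrBl.
Qed.

Definition tadd d (k l : d.-tuple int) : d.-tuple int :=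
  [tuple tnth k j + tnth l j | j < d].

Lemma dotp_tadd d (k l : d.-tuple int) (x : Rn R d) :
  dotp (tadd k l) x = dotp k x + dotp l x.
Proof.
rewrite /dotp -big_split/=; apply: eq_bigr => j _.
by rewrite tnth_mktuple intrD mulrDl.
Qed.

Lemma torus_integral_cos_tsub d (k l : d.-tuple int) :
  \int[torus_measure R d]_x cos (dotp (tsub k l) x) = (k == l)%:R.
Proof.
have [-> _] := torus_integral_cos_sin (tsub k l).
have [->|kl] := eqVneq k l.
  by rewrite big1// => j _; rewrite tnth_mktuple subrr eqxx.
have [j kj] : exists j, tnth k j != tnth l j.
  apply/existsP; rewrite -negb_forall; apply: contra kl => /forallP kl.
  by apply/eqP/eq_from_tnth => j; exact/eqP/kl.
by rewrite (bigD1 j)//= tnth_mktuple subr_eq0 (negbTE kj) mul0r.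
Qed.

End torus.

(** * Weighted means and log-convexity of L_p norms *)

Section weighted_means.
Context {R : realType}.
Implicit Types a b u : R.

Lemma expR_convex (u a b : R) : 0 <= u <= 1 ->
  expR (u * a + (1 - u) * b) <= u * expR a + (1 - u) * expR b.
Proof.
move=> /andP[u0 u1]; set m := u * a + (1 - u) * b.
have tangent (c : R) : expR m * (1 + (c - m)) <= expR c.
  rewrite -[in leRHS](subrK m c) [leRHS]expRD mulrC.
  by rewrite ler_wpM2r ?expR_ge0 ?expR_ge1Dx.
have := ler_wpM2l u0 (tangent a); have : 0 <= 1 - u by lra.
move=> /ler_wpM2l /(_ _ _ (tangent b)) hb ha.
apply: le_trans (lerD ha hb); rewrite le_eqVlt; apply/orP; left; apply/eqP.
by rewrite /m; ring.
Qed.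

(** The weighted arithmetic-geometric mean inequality for (y / A)^q and (y / B)^p. It is normalized
    so that the last factor integrates to at most u + (1 - u) = 1 for a function with L_q norm at
    most A and L_p norm at most B; log-convexity follows by integration. *)
Lemma powR_young (q p s u A B y : R) : 0 <= u <= 1 ->
  s = u * q + (1 - u) * p -> 0 < s -> 0 < q -> 0 < p ->
  0 < A -> 0 < B -> 0 <= y ->
  y `^ s <= (A `^ q) `^ u * (B `^ p) `^ (1 - u) *
    (u / A `^ q * y `^ q + (1 - u) / B `^ p * y `^ p).
Proof.
move=> u01 sE s0 q0 p0 A0 B0; rewrite le_eqVlt => /predU1P[<-|y0].
  by rewrite !powR0 ?gt_eqF// !mulr0 addr0 mulr0.
rewrite -!powRrM /powR !gt_eqF//=.
set D := expR _ * expR _.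
have -> : expR (s * ln y) = D *
    expR (u * (q * (ln y - ln A)) + (1 - u) * (p * (ln y - ln B))).
  by rewrite /D -!expRD; congr expR; rewrite sE; ring.
rewrite ler_pM2l ?mulr_gt0 ?expR_gt0//; apply: (le_trans (expR_convex _ _ u01)).
have ex (r w : R) : expR (r * (ln y - ln w)) = (expR (r * ln w))^-1 * expR (r * ln y).
  by rewrite -expRN -expRD; congr expR; ring.
by rewrite !ex !mulrA.
Qed.

(** The same mean with the powers p and 0: on a probability space the last factor again integrates
    to at most 1, which gives the monotonicity of L_p norms in p. *)
Lemma powR_young_le (q p B y : R) : 0 < q -> q <= p -> 0 < B -> 0 <= y ->
  y `^ q <= B `^ q * (q / p / B `^ p * y `^ p + (1 - q / p)).
Proof.
move=> q0 qp B0; have p0 : 0 < p by exact: lt_le_trans qp.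
have u01 : 0 <= q / p <= 1.
  by rewrite divr_ge0 ?(ltW q0) ?(ltW p0)//= ler_pdivrMr// mul1r.
rewrite le_eqVlt => /predU1P[<-|y0].
  rewrite !powR0 ?gt_eqF// mulr0 add0r mulr_ge0 ?powR_ge0//.
  by have /andP[_ ?] := u01; rewrite subr_ge0.
rewrite /powR !gt_eqF//=.
have -> : expR (q * ln y) = expR (q * ln B) *
    expR (q / p * (p * (ln y - ln B)) + (1 - q / p) * 0).
  by rewrite -!expRD; congr expR; field; rewrite gt_eqF.
rewrite ler_pM2l ?expR_gt0//; apply: (le_trans (expR_convex _ _ u01)).
rewrite expR0 mulr1 lerD2r -!mulrA ler_pM2l// ler_pM2l ?invr_gt0//.
rewrite le_eqVlt; apply/orP; left; apply/eqP.
by rewrite -expRN -expRD; congr expR; ring.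
Qed.

End weighted_means.

Section Lp_bounds.
Context {R : realType} (d : nat).
Implicit Types (f g : Rn R d -> R[i]) (p q A B : R).
Local Notation mu := (torus_measure R d).

Definition cbmeas f := bmeas (fun x => complex.Re (f x)) /\ bmeas (fun x => complex.Im (f x)).

Lemma cbmeasB f g : cbmeas f -> cbmeas g -> cbmeas (fun x => f x - g x).
Proof.
move=> [fr fi] [gr gi]; split.
  by under eq_fun do rewrite raddfB/=; exact: bmeasB.
by under eq_fun do rewrite raddfB/=; exact: bmeasB.
Qed.

Lemma cbmeasM f g : cbmeas f -> cbmeas g -> cbmeas (fun x => f x * g x).
Proof.
move=> [fr fi] [gr gi]; split.
  rewrite (_ : (fun _ => _) = fun x => complex.Re (f x) * complex.Re (g x) -
      complex.Im (f x) * complex.Im (g x)); first by apply: bmeasB; exact: bmeasM.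
  by apply/funext => x; case: (f x) (g x) => [? ?] [? ?].
rewrite (_ : (fun _ => _) = fun x => complex.Re (f x) * complex.Im (g x) +
    complex.Im (f x) * complex.Re (g x)); first by apply: bmeasD; exact: bmeasM.
by apply/funext => x; case: (f x) (g x) => [? ?] [? ?].
Qed.

Lemma cbmeas_cst (c : R[i]) : cbmeas (fun=> c).
Proof. by split; exact: bmeas_cst. Qed.

Lemma cbmeas_sum (I : Type) (s : seq I) (f : I -> Rn R d -> R[i]) :
  (forall i, cbmeas (f i)) -> cbmeas (fun x => \sum_(i <- s) f i x).
Proof.
move=> cf; split; under eq_fun do rewrite raddf_sum/=.
  by apply: bmeas_sum => i; have [] := cf i.
by apply: bmeas_sum => i; have [] := cf i.
Qed.

Lemma cbmeas_expi (k : d.-tuple int) : cbmeas (fun x => expi (dotp k x)).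
Proof. by split; [exact: bmeas_cos_dotp|exact: bmeas_sin_dotp]. Qed.

Lemma bmeas_powR (h : Rn R d -> R) p : 0 <= p -> (forall x, 0 <= h x) ->
  bmeas h -> bmeas (fun x => h x `^ p).
Proof.
move=> p0 h0 [mh [M hM]]; split.
  by apply: (measurableT_comp (measurable_powR _)).
exists (M `^ p) => x; rewrite ger0_norm ?powR_ge0//.
have hxM : h x <= M by have := hM x; rewrite ger0_norm.
by rewrite ge0_ler_powR ?nnegrE// (le_trans _ hxM).
Qed.

Lemma cbmeas_normc f : cbmeas f -> bmeas (fun x => Normc.normc (f x)).
Proof.
move=> [fr fi].
rewrite (_ : (fun _ => _) = fun x =>
    (complex.Re (f x) ^+ 2 + complex.Im (f x) ^+ 2) `^ 2^-1).
  apply: bmeas_powR; first by rewrite invr_ge0.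
    by move=> x; rewrite addr_ge0 ?sqr_ge0.
  by apply: bmeasD; exact: bmeas_exp.
apply/funext => x; rewrite powR12_sqrt; first by case: (f x).
by rewrite addr_ge0 ?sqr_ge0.
Qed.

Lemma bmeas_normc_powR f p : 0 <= p -> cbmeas f ->
  bmeas (fun x => Normc.normc (f x) `^ p).
Proof.
move=> p0 cf; apply: bmeas_powR => //; last exact: cbmeas_normc.
by move=> x; exact: normc_ge0.
Qed.

(* The p-th power form of [||f||_p <= B]. *)
Definition bnd p B f := \int[mu]_x (Normc.normc (f x) `^ p) <= B `^ p.

Lemma integral_normc_powR_ge0 f p : 0 <= \int[mu]_x (Normc.normc (f x) `^ p).
Proof. by apply: Rintegral_ge0 => x _; exact: powR_ge0. Qed.

Lemma bnd_le p A B f : 0 <= p -> 0 <= A <= B -> bnd p A f -> bnd p B f.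
Proof.
move=> p0 /andP[A0 AB] /le_trans; apply; rewrite ge0_ler_powR ?nnegrE//.
exact: le_trans AB.
Qed.

Lemma bnd_pointwise p B f : 0 <= p -> cbmeas f -> 0 <= B ->
  (forall x, Normc.normc (f x) <= B) -> bnd p B f.
Proof.
move=> p0 cf B0 fB.
rewrite /bnd -[leRHS](Rintegral_prob_cst mu); apply: le_Rintegral => //.
- by apply: bmeas_integrable; exact: bmeas_normc_powR.
- by apply: bmeas_integrable; exact: bmeas_cst.
- by move=> x _; rewrite ge0_ler_powR ?nnegrE ?normc_ge0.
Qed.

Lemma bnd_scale p B (s : R) f : 0 <= p -> cbmeas f -> 0 <= s -> 0 <= B ->
  bnd p B f -> bnd p (s * B) (fun x => (s%:C)%C * f x).
Proof.
move=> p0 cf s0 B0 fB; rewrite /bnd powRM//.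
under eq_Rintegral => x _.
  rewrite Normc.normcM powRM ?normc_ge0// [X in X `^ p](_ : _ = s); last first.
    by rewrite /= expr0n addr0 sqrtr_sqr ger0_norm.
  over.
rewrite RintegralZl//; first by rewrite ler_wpM2l ?powR_ge0.
exact/bmeas_integrable/bmeas_normc_powR.
Qed.

(** A substitute for Minkowski's inequality with 4 in place of 2: the p-th power of a sum is at most
    2^p times the sum of the powers, and adding the two terms costs 2 <= 2^p. *)
Lemma bnd_sub p B f g : 1 <= p -> cbmeas f -> cbmeas g -> 0 <= B ->
  bnd p B f -> bnd p B g -> bnd p (4 * B) (fun x => f x - g x).
Proof.
move=> p1 cf cg B0 fB gB; have p0 : 0 <= p by lra.
have bf := bmeas_normc_powR p0 cf; have bg := bmeas_normc_powR p0 cg.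
have pw x : Normc.normc (f x - g x) `^ p <=
    2 `^ p * (Normc.normc (f x) `^ p + Normc.normc (g x) `^ p).
  have h : Normc.normc (f x - g x) <=
      2 * Num.max (Normc.normc (f x)) (Normc.normc (g x)).
    apply: (le_trans (le_normcD _ _)); rewrite normcN mulr_natl mulr2n.
    by rewrite lerD// le_max lexx ?orbT.
  have m0 : 0 <= Num.max (Normc.normc (f x)) (Normc.normc (g x)).
    by rewrite le_max normc_ge0.
  apply: (@le_trans _ _ ((2 * Num.max (Normc.normc (f x)) (Normc.normc (g x))) `^ p)).
    by rewrite ge0_ler_powR ?nnegrE ?normc_ge0// mulr_ge0.
  rewrite powRM// ler_pM2l ?powR_gt0// maxEle; case: ifP => _.
    by rewrite lerDr powR_ge0.
  by rewrite lerDl powR_ge0.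
apply: (@le_trans _ _ (\int[mu]_x (2 `^ p *
    (Normc.normc (f x) `^ p + Normc.normc (g x) `^ p)))).
  apply: le_Rintegral => //.
  - by apply/bmeas_integrable/bmeas_normc_powR => //; exact: cbmeasB.
  - exact/bmeas_integrable/bmeasZ/bmeasD.
rewrite RintegralZl//; last exact/bmeas_integrable/bmeasD.
rewrite RintegralD//; [|exact: bmeas_integrable..].
apply: (@le_trans _ _ (2 `^ p * (B `^ p + B `^ p))).
  by rewrite ler_wpM2l ?powR_ge0// lerD.
rewrite powRM// (_ : 4 = 2 * 2); last by ring.
rewrite powRM// -mulrA ler_wpM2l ?powR_ge0// -[_ + _]mulr2n -[leLHS]mulr_natl.
by rewrite ler_wpM2r ?powR_ge0// le1r_powR// ler1n.
Qed.

Lemma bnd_interpolation q p (s u : R) A B f : 0 < q -> 0 < p -> 0 <= u <= 1 ->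
  s = u * q + (1 - u) * p -> cbmeas f -> 0 < A -> 0 < B ->
  bnd q A f -> bnd p B f ->
  \int[mu]_x (Normc.normc (f x) `^ s) <= (A `^ q) `^ u * (B `^ p) `^ (1 - u).
Proof.
move=> q0 p0 u01 sE cf A0 B0 fA fB.
have /andP[u0 u1] := u01.
have s0 : 0 < s.
  rewrite sE; have [->|un] := eqVneq u 0; first by rewrite mul0r add0r subr0 mul1r.
  have {un}u0' : 0 < u by rewrite lt0r un.
  by rewrite ltr_pwDl// ?mulr_ge0 ?mulr_gt0 ?(ltW p0) ?subr_ge0.
have a0 : 0 < A `^ q by rewrite powR_gt0.
have b0 : 0 < B `^ p by rewrite powR_gt0.
set D := (A `^ q) `^ u * (B `^ p) `^ (1 - u).
have D0 : 0 < D by rewrite mulr_gt0 ?powR_gt0.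
have bq := bmeas_normc_powR (ltW q0) cf; have bp := bmeas_normc_powR (ltW p0) cf.
have pw x : Normc.normc (f x) `^ s <= D * (u / A `^ q * Normc.normc (f x) `^ q +
    (1 - u) / B `^ p * Normc.normc (f x) `^ p).
  by apply: powR_young => //; exact: normc_ge0.
apply: (@le_trans _ _ (\int[mu]_x (D * (u / A `^ q * Normc.normc (f x) `^ q +
    (1 - u) / B `^ p * Normc.normc (f x) `^ p)))).
  apply: le_Rintegral => //.
  - exact/bmeas_integrable/(bmeas_normc_powR (ltW s0) cf).
  - by apply/bmeas_integrable/bmeasZ/bmeasD; exact: bmeasZ.
rewrite RintegralZl//; last by apply/bmeas_integrable/bmeasD; exact: bmeasZ.
rewrite RintegralD//; [|exact/bmeas_integrable/bmeasZ..].
rewrite !RintegralZl//; [|exact: bmeas_integrable..].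
rewrite -[leRHS]mulr1 ler_pM2l//.
apply: (@le_trans _ _ (u / A `^ q * A `^ q + (1 - u) / B `^ p * B `^ p)).
  by rewrite lerD// ler_wpM2l// divr_ge0 ?powR_ge0 ?subr_ge0.
by rewrite !divfK ?gt_eqF// addrC subrK.
Qed.

Lemma bnd_mono q p B f : 0 < q -> q <= p -> cbmeas f -> 0 < B ->
  bnd p B f -> bnd q B f.
Proof.
move=> q0 qp cf B0 fB; have p0 : 0 < p by exact: lt_le_trans qp.

have bp := bmeas_normc_powR (ltW p0) cf.
have b0 : 0 < B `^ p by rewrite powR_gt0.
have u01 : 0 <= q / p <= 1.
  by rewrite divr_ge0 ?(ltW q0) ?(ltW p0)//= ler_pdivrMr// mul1r.
have pw x : Normc.normc (f x) `^ q <= B `^ q * (q / p / B `^ p * Normc.normc (f x) `^ p +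
    (1 - q / p)).
  exact: powR_young_le (normc_ge0 _).
apply: (@le_trans _ _ (\int[mu]_x (B `^ q * (q / p / B `^ p * Normc.normc (f x) `^ p +
    (1 - q / p))))).
  apply: le_Rintegral => //.
  - exact/bmeas_integrable/(bmeas_normc_powR (ltW q0) cf).
  - by apply/bmeas_integrable/bmeasZ/bmeasD; [exact: bmeasZ|exact: bmeas_cst].
rewrite RintegralZl//; last first.
  by apply/bmeas_integrable/bmeasD; [exact: bmeasZ|exact: bmeas_cst].
rewrite RintegralD//; last 2 first.
- exact/bmeas_integrable/bmeasZ.
- exact/bmeas_integrable/bmeas_cst.
rewrite RintegralZl//; last exact: bmeas_integrable.
rewrite Rintegral_prob_cst -[leRHS]mulr1 ler_wpM2l ?powR_ge0//.
apply: (@le_trans _ _ (q / p / B `^ p * B `^ p + (1 - q / p))).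
  by rewrite lerD2r ler_wpM2l// !divr_ge0 ?powR_ge0 ?(ltW q0) ?(ltW p0).
by rewrite divfK ?gt_eqF// addrC subrK.
Qed.

End Lp_bounds.

Section trigonometric_polynomials.
Context {R : realType} (d : nat) (I : finType) (kappa : I -> d.-tuple int).
Implicit Types c : I -> R[i].
Local Notation mu := (torus_measure R d).

(** Frequencies are indexed by an arbitrary finite type, since the entropy bounds depend on their
    number and not on their position. *)
Definition tpoly c : Rn R d -> R[i] :=
  fun x => \sum_i c i * expi (dotp (kappa i) x).

Lemma cbmeas_tpoly c : cbmeas (tpoly c).
Proof.
by apply: cbmeas_sum => i; apply: cbmeasM; [exact: cbmeas_cst|exact: cbmeas_expi].
Qed.

Lemma tpolyB c c' : tpoly (fun i => c i - c' i) = fun x => tpoly c x - tpoly c' x.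
Proof.
by apply/funext => x; rewrite /tpoly -sumrB; apply: eq_bigr => i _; rewrite mulrBl.
Qed.

Lemma tpolyZ (s : R[i]) c : tpoly (fun i => s * c i) = fun x => s * tpoly c x.
Proof.
by apply/funext => x; rewrite /tpoly mulr_sumr; apply: eq_bigr => i _; rewrite mulrA.
Qed.

Definition l2norm2 c : R := \sum_i Normc.normc (c i) ^+ 2.

Lemma sqr_normc_tpoly c x : Normc.normc (tpoly c x) ^+ 2 = \sum_i \sum_j
  ((complex.Re (c i) * complex.Re (c j) + complex.Im (c i) * complex.Im (c j)) *
     cos (dotp (tsub (kappa i) (kappa j)) x) +
   (complex.Re (c i) * complex.Im (c j) - complex.Im (c i) * complex.Re (c j)) *
     sin (dotp (tsub (kappa i) (kappa j)) x)).
Proof.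
rewrite sqr_normcE /tpoly !raddf_sum/= !expr2 !mulr_suml -big_split/=.
apply: eq_bigr => i _; rewrite !mulr_sumr -big_split/=; apply: eq_bigr => j _.
rewrite dotp_tsub cosB sinB /expi; case: (c i) (c j) => [a b] [a' b'] /=; ring.
Qed.

Lemma parseval c : injective kappa ->
  \int[mu]_x (Normc.normc (tpoly c x) ^+ 2) = l2norm2 c.
Proof.
move=> kI.
have bc i j (s : R) : bmeas (fun x : Rn R d => s * cos (dotp (tsub (kappa i) (kappa j)) x)).
  exact/bmeasZ/bmeas_cos_dotp.
have bs i j (s : R) : bmeas (fun x : Rn R d => s * sin (dotp (tsub (kappa i) (kappa j)) x)).
  exact/bmeasZ/bmeas_sin_dotp.
under eq_Rintegral do rewrite sqr_normc_tpoly.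
rewrite Rintegral_bsum; last by move=> i; apply: bmeas_sum => j; exact: bmeasD.
apply: eq_bigr => i _.
rewrite Rintegral_bsum; last by move=> j; exact: bmeasD.
rewrite (bigD1 i)//= big1 ?addr0 => [|j ji]; last first.
  rewrite RintegralD//; [|exact/bmeas_integrable..].
  rewrite !RintegralZl//; last 2 first.
  - exact/bmeas_integrable/bmeas_sin_dotp.
  - exact/bmeas_integrable/bmeas_cos_dotp.
  rewrite torus_integral_cos_tsub (proj2 (torus_integral_cos_sin _)).
  by rewrite (inj_eq kI) eq_sym (negbTE ji) !mulr0 addr0.
rewrite RintegralD//; [|exact/bmeas_integrable..].
rewrite !RintegralZl//; last 2 first.
- exact/bmeas_integrable/bmeas_sin_dotp.
- exact/bmeas_integrable/bmeas_cos_dotp.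
rewrite torus_integral_cos_tsub (proj2 (torus_integral_cos_sin _)).
by rewrite eqxx mulr1 mulr0 addr0 sqr_normcE !expr2.
Qed.

Lemma bnd2E (B : R) c : injective kappa -> 0 <= B ->
  bnd 2 B (tpoly c) <-> l2norm2 c <= B ^+ 2.
Proof.
move=> kI B0; rewrite /bnd -(parseval c kI) (powR_mulrn 2 B0).
by under eq_Rintegral do rewrite (powR_mulrn 2 (normc_ge0 _)).
Qed.

Lemma normc_sum_le (s : seq I) (z : I -> R[i]) :
  Normc.normc (\sum_(i <- s) z i) <= \sum_(i <- s) Normc.normc (z i).
Proof.
elim: s => [|i s IHs]; first by rewrite !big_nil Normc.normc0.
by rewrite !big_cons (le_trans (le_normcD _ _))// lerD2l.
Qed.

Lemma tpoly_sup c (N B : R) x : 0 <= B -> #|I|%:R <= N -> l2norm2 c <= B ^+ 2 ->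
  Normc.normc (tpoly c x) <= Num.sqrt N * B.
Proof.
move=> B0 IN cB; have N0 : 0 <= N by exact: le_trans IN.
apply: (@le_trans _ _ (\sum_i Normc.normc (c i))).
  apply: (le_trans (normc_sum_le _ _)); apply: ler_sum => i _.
  by rewrite Normc.normcM normc_expi mulr1.
have [N00|Nn0] := eqVneq N 0.
  rewrite big1 ?mulr_ge0 ?sqrtr_ge0// => i _; exfalso.
  have : #|I|%:R <= 0 :> R by rewrite -N00.
  by rewrite lern0 => /eqP I0; have := max_card (pred1 i); rewrite card1 I0.
have {Nn0}N0 : 0 < N by rewrite lt0r Nn0.
have [B00|Bn0] := eqVneq B 0.
  rewrite big1 ?mulr_ge0 ?sqrtr_ge0// => i _.
  apply/eqP; rewrite -sqrf_eq0 eq_le sqr_ge0 andbT.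
  move: cB; rewrite B00 expr0n/= => /(le_trans _); apply.
  rewrite /l2norm2 (bigD1 i)//= lerDl.
  by apply: sumr_ge0 => j _; rewrite sqr_ge0.
have {Bn0}B0 : 0 < B by rewrite lt0r Bn0.
have sN0 : 0 < Num.sqrt N by rewrite sqrtr_gt0.
(* Cauchy-Schwarz term by term: |c i| <= |c i|^2 / (2 t) + t / 2. This [t] balances the two sums; it
   has to be positive, hence the degenerate cases above. *)
pose t := B / Num.sqrt N; have t0 : 0 < t by rewrite divr_gt0.
apply: (@le_trans _ _ (\sum_i (Normc.normc (c i) ^+ 2 / (2 * t) + t / 2))).
  apply: ler_sum => i _; rewrite -subr_ge0.
  have -> : Normc.normc (c i) ^+ 2 / (2 * t) + t / 2 - Normc.normc (c i) =
      (Normc.normc (c i) - t) ^+ 2 / (2 * t) by field; rewrite gt_eqF.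
  by rewrite divr_ge0 ?sqr_ge0// mulr_ge0// ltW.
rewrite big_split/= -mulr_suml sumr_const -[_ *+ #|I|]mulr_natl.
apply: (@le_trans _ _ (B ^+ 2 / (2 * t) + N * (t / 2))).
  apply: lerD; first by rewrite ler_pM2r// invr_gt0 mulr_gt0.
  by rewrite ler_pM2r// divr_gt0.
have -> : N * (t / 2) = Num.sqrt N ^+ 2 * (t / 2) by rewrite (sqr_sqrtr (ltW N0)).
rewrite /t le_eqVlt; apply/orP; left; apply/eqP.
by field; rewrite !gt_eqF.
Qed.

End trigonometric_polynomials.

(** * Biased random signs *)

Section exp_bounds.
Context {R : realType}.
Implicit Types x y : R.

(** For a centered variable the linear term averages to 0 and a sub-Gaussian bound remains. Up to
    1/2, exp x <= 1 / (1 - x) <= 1 + x + 2 x^2; beyond 1/2, x <= 2 x^2. *)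
Lemma expR_le_addr_expR_sqr x : expR x <= x + expR (2 * x ^+ 2).
Proof.
have [x2|x2] := leP x (1 / 2).
  have x1 : 0 < 1 - x by lra.
  have : expR x <= 1 + x + 2 * x ^+ 2.
    rewrite -[expR x]invrK -expRN.
    have h : 1 - x <= expR (- x) by have := expR_ge1Dx (- x); lra.
    apply: (@le_trans _ _ (1 - x)^-1); first by rewrite lef_pV2 ?posrE ?expR_gt0.
    rewrite -div1r ler_pdivrMr//.
    have -> : (1 + x + 2 * x ^+ 2) * (1 - x) = 1 + x ^+ 2 * (1 - 2 * x) by ring.
    by rewrite lerDl mulr_ge0// ?sqr_ge0//; lra.
  have := expR_ge1Dx (2 * x ^+ 2); lra.
have : expR x <= expR (2 * x ^+ 2).
  by rewrite ler_expR; nra.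
lra.
Qed.

Lemma exprn_le_fact_expR n y : 0 <= y -> y ^+ n <= n`!%:R * expR y.
Proof.
case: n => [|n] y0; first by rewrite expr0 fact0 mul1r -expR0 ler_expR.
have := expR_ge1Dxn n y0.
have f0 : (0 : R) < n.+1`!%:R by rewrite ltr0n fact_gt0.
move=> h; rewrite -ler_pdivrMl// mulrC; lra.
Qed.

Lemma fact_le_exp n : (n`! <= n ^ n)%N.
Proof.
rewrite fact_prod -[X in (_ <= _ ^ X)%N](subn1 n.+1) -prod_nat_const_nat.
rewrite big_nat_cond [X in (_ <= X)%N]big_nat_cond.
by apply: leq_prod => i; rewrite andbT => /andP[_].
Qed.

(** With 4 as the bound, exp m is at most 2^(2 m), which can be counted in bits. *)
Lemma expR1_le4 : expR 1 <= 4 :> R.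
Proof.
have h : expR (1 / 4) <= 4 / 3 :> R.
  have h1 : 3 / 4 <= expR (- (1 / 4)) :> R.
    by have := expR_ge1Dx (- (1 / 4) : R); lra.
  rewrite -[expR _]invrK -expRN.
  have -> : 4 / 3 = (3 / 4)^-1 :> R by field.
  by rewrite lef_pV2 ?posrE ?expR_gt0//; lra.
have -> : expR 1 = expR (1 / 4) ^+ 4 :> R by rewrite -expRM_natl; congr expR; field.
apply: (@le_trans _ _ ((4 / 3) ^+ 4)); last by lra.
by rewrite lerXn2r ?nnegrE ?expR_ge0//; lra.
Qed.

End exp_bounds.

Section biased_signs.
Context {R : realType} {J : finType}.
Implicit Types (tau a : J -> R) (w : {ffun J -> bool}).

Definition bsgn (b : bool) : R := (-1) ^+ b.

(* density at w of independent signs with expectations tau *)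
Definition bweight tau w : R := \prod_j ((1 + bsgn (w j) * tau j) / 2).

Lemma bsgnP (b : bool) (t : R) : `|t| <= 1 -> 0 <= (1 + bsgn b * t) / 2.
Proof. by rewrite ler_norml => /andP[]; case: b; rewrite /bsgn ?expr1 ?expr0; lra. Qed.

Lemma bweight_ge0 tau w : (forall j, `|tau j| <= 1) -> 0 <= bweight tau w.
Proof. by move=> t1; apply: prodr_ge0 => j _; exact: bsgnP. Qed.

Lemma sum_bweight_prod tau (F : J -> bool -> R) :
  \sum_w bweight tau w * \prod_j F j (w j) =
  \prod_j \sum_b ((1 + bsgn b * tau j) / 2 * F j b).
Proof.
rewrite bigA_distr_bigA/=; apply: eq_bigr => w _.
by rewrite /bweight -big_split.
Qed.

Lemma sum_bweight tau : \sum_w bweight tau w = 1.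
Proof.
transitivity (\sum_w bweight tau w * \prod_(j : J) 1).
  by apply: eq_bigr => w _; rewrite big1_eq mulr1.
rewrite (sum_bweight_prod tau (fun _ _ => 1)) big1// => j _.
by rewrite big_bool/= /bsgn; field.
Qed.

(** The left-hand side is 1 plus the chi-square distance to the uniform law; it factors into the
    numbers 1 + tau_j^2. *)
Lemma sum_bweight_sqr tau :
  (\sum_w bweight tau w ^+ 2) * 2 ^+ #|J| <= expR (\sum_j tau j ^+ 2).
Proof.
under eq_bigr do rewrite expr2.
rewrite (sum_bweight_prod tau (fun j b => (1 + bsgn b * tau j) / 2)).
rewrite -prodr_const -big_split/= expR_sum; apply: ler_prod => j _.
rewrite big_bool/= /bsgn expr1 expr0; apply/andP; split; first by nra.
have := expR_ge1Dx (tau j ^+ 2); nra.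
Qed.

(** A sign differs from its expectation by at most 2, so [expR_le_addr_expR_sqr] yields the exponent
    2 (2 a_j)^2 = 8 a_j^2. *)
Lemma bweight_mgf tau a : (forall j, `|tau j| <= 1) ->
  \sum_w bweight tau w * expR (\sum_j a j * (bsgn (w j) - tau j)) <=
  expR (8 * \sum_j a j ^+ 2).
Proof.
move=> t1; under eq_bigr do rewrite expR_sum.
rewrite (sum_bweight_prod tau (fun j b => expR (a j * (bsgn b - tau j)))).
rewrite mulr_sumr expR_sum; apply: ler_prod => j _; apply/andP; split.
  by apply: sumr_ge0 => b _; rewrite mulr_ge0 ?expR_ge0 ?bsgnP.
have hb b : expR (a j * (bsgn b - tau j)) <=
    a j * (bsgn b - tau j) + expR (8 * a j ^+ 2).
  apply: (le_trans (expR_le_addr_expR_sqr _)); rewrite lerD2l ler_expR.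
  have : (bsgn b - tau j) ^+ 2 <= 4.
    have := t1 j; rewrite ler_norml => /andP[? ?].
    by case: b; rewrite /bsgn ?expr1 ?expr0; nra.
  rewrite exprMn; have := sqr_ge0 (a j); nra.
apply: (@le_trans _ _ (\sum_b (1 + bsgn b * tau j) / 2 *
    (a j * (bsgn b - tau j) + expR (8 * a j ^+ 2)))).
  by apply: ler_sum => b _; rewrite ler_wpM2l// bsgnP.
by rewrite big_bool/= /bsgn expr1 expr0 le_eqVlt; apply/orP; left; apply/eqP; field.
Qed.

(** The moment is read off from the exponential moments at l and - l with l^2 = r / s, for which 8
    l^2 s = 8 r. In the constant, 8 = 4 * 2 comes from (2r)! <= (2r)^(2r) = (4 r^2)^r and from the
    two signs, 2 <= 2^r. *)
Lemma bweight_moment tau a (s : R) r : (forall j, `|tau j| <= 1) ->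
  (0 < r)%N -> 0 < s -> \sum_j a j ^+ 2 <= s ->
  \sum_w bweight tau w * (\sum_j a j * (bsgn (w j) - tau j)) ^+ (2 * r) <=
  (8 * expR 8 * r%:R * s) ^+ r.
Proof.
move=> t1 r0 s0 as_; have rR : (0 : R) < r%:R by rewrite ltr0n.
pose l := Num.sqrt (r%:R / s).
have l2 : l ^+ 2 = r%:R / s by rewrite sqr_sqrtr// divr_ge0// ltW.
have l0 : 0 < l by rewrite sqrtr_gt0 divr_gt0.
pose X w := \sum_j a j * (bsgn (w j) - tau j).
have bX (e : R) w : expR (e * l * X w) =
    expR (\sum_j (e * l * a j) * (bsgn (w j) - tau j)).
  by rewrite /X mulr_sumr; congr expR; apply: eq_bigr => j _; ring.
have mgf (e : R) : e ^+ 2 = 1 ->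
    \sum_w bweight tau w * expR (e * l * X w) <= expR 8 ^+ r.
  move=> e1; under eq_bigr do rewrite bX.
  apply: (le_trans (bweight_mgf _ t1)); rewrite -expRM_natl ler_expR.
  under eq_bigr do rewrite !exprMn e1 mul1r l2.
  rewrite -mulr_sumr mulrCA [leRHS]mulrC mulrAC -mulrA -[leRHS]mulr1 -[leRHS]mulrA.
  have as1 : (\sum_i a i ^+ 2) / s <= 1 by rewrite ler_pdivrMr// mul1r.
  by rewrite mulr1 -mulrA !(mulrCA _ 8) ler_pM2l// -[leRHS]mulr1 ler_pM2l.
have pw w : (X w) ^+ (2 * r) <= (s / r%:R) ^+ r * (2 * r)`!%:R *
    (expR (1 * l * X w) + expR (-1 * l * X w)).
  have -> : (s / r%:R) ^+ r = (l ^+ (2 * r))^-1.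
    by rewrite exprM l2 -exprVn invf_div.
  rewrite -mulrA -ler_pdivrMl ?invr_gt0 ?exprn_gt0// invrK.
  rewrite -exprMn exprM -real_normK ?num_real// -exprM.
  apply: (le_trans (exprn_le_fact_expR _ (normr_ge0 _))).
  rewrite ler_wpM2l// mul1r mulN1r mulNr.
  have [lX0|lX0] := leP 0 (l * X w).
    by rewrite ger0_norm// lerDl expR_ge0.
  by rewrite ltr0_norm// lerDr expR_ge0.
apply: (@le_trans _ _ (\sum_w bweight tau w * ((s / r%:R) ^+ r * (2 * r)`!%:R *
    (expR (1 * l * X w) + expR (-1 * l * X w))))).
  by apply: ler_sum => w _; rewrite ler_wpM2l ?bweight_ge0//; exact: pw.
under eq_bigr do rewrite mulrCA mulrDr.
rewrite -mulr_sumr big_split/=.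
apply: (@le_trans _ _ ((s / r%:R) ^+ r * (2 * r)`!%:R * (2 * expR 8 ^+ r))).
  rewrite ler_wpM2l ?mulr_ge0 ?exprn_ge0 ?divr_ge0 ?(ltW s0)//.
  rewrite [2 * _](_ : _ = expR 8 ^+ r + expR 8 ^+ r); last by ring.
  by apply: lerD; apply: mgf; rewrite ?sqrrN expr1n.
apply: (@le_trans _ _ ((s / r%:R) ^+ r * ((2 * r)%:R ^+ (2 * r)) * (2 ^+ r * expR 8 ^+ r))).
  rewrite ler_pM ?mulr_ge0 ?exprn_ge0 ?divr_ge0 ?(ltW s0) ?expR_ge0//.
    rewrite ler_wpM2l ?exprn_ge0 ?divr_ge0 ?(ltW s0)// -natrX ler_nat.
    exact: fact_le_exp.
  by rewrite ler_wpM2r ?exprn_ge0 ?expR_ge0// -[leLHS]expr1 ler_eXn2l// ltr1n.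
rewrite (exprM (2 * r)%:R) -!exprMn le_eqVlt; apply/orP; left; apply/eqP.
by congr (_ ^+ _); rewrite natrM; field; rewrite gt_eqF.
Qed.

(** The change of measure: Cauchy-Schwarz between the biased and the uniform law, in the additive
    form w <= t w^2 + 1 / (4 t). The choice of [t] leaves at most 1/4 to the quadratic part, so the
    number of elements of [S] accounts for the other 1/4. *)
Lemma bweight_half tau (S : {set {ffun J -> bool}}) :
  1 / 2 <= \sum_(w in S) bweight tau w ->
  2 ^+ #|J| <= 4 * expR (\sum_j tau j ^+ 2) * #|S|%:R.
Proof.
move=> hS; set e := expR _; have e0 : 0 < e := expR_gt0 _.
have n0 : 0 < 2 ^+ #|J| :> R by rewrite exprn_gt0.
pose t := 2 ^+ #|J| / (4 * e); have t0 : 0 < t by rewrite divr_gt0// mulr_gt0.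
have key : \sum_(w in S) bweight tau w <=
    t * (\sum_w bweight tau w ^+ 2) + #|S|%:R / (4 * t).
  apply: (@le_trans _ _ (\sum_(w in S) (t * bweight tau w ^+ 2 + 1 / (4 * t)))).
    apply: ler_sum => w _; rewrite -subr_ge0.
    have -> : t * bweight tau w ^+ 2 + 1 / (4 * t) - bweight tau w =
      (2 * t * bweight tau w - 1) ^+ 2 / (4 * t) by field; rewrite gt_eqF.
    by rewrite divr_ge0 ?sqr_ge0// mulr_ge0// ltW.
  rewrite big_split/= -mulr_sumr sumr_const -[_ *+ #|S|]mulr_natl mul1r.
  rewrite lerD2r ler_pM2l// [leRHS](bigID (mem S))/= lerDl.
  by apply: sumr_ge0 => w _; rewrite sqr_ge0.
have h2 := sum_bweight_sqr tau; rewrite -/e in h2.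
have {}key : 1 / 2 <= 1 / 4 + #|S|%:R * e / 2 ^+ #|J|.
  apply: (le_trans hS); apply: (le_trans key); apply: lerD.
    rewrite /t mulrAC ler_pdivrMr ?mulr_gt0// mulrC; lra.
  by rewrite /t le_eqVlt; apply/orP; left; apply/eqP; field; rewrite !gt_eqF.
have : 1 / 4 <= #|S|%:R * e / 2 ^+ #|J| by lra.
by rewrite ler_pdivlMr//; lra.
Qed.

End biased_signs.

(** A maximal disjoint family of sets [S c] has at most [L] members, since each fills a fraction 1 /
    L of [W]. By maximality every [S c] meets a member of the family, and the index of such a member
    is the label of [c]. *)
Lemma maximal_disjoint_classes (V : Type) (W : finType) (A : set V)
    (S : V -> {set W}) (L : nat) :
  (forall c, A c -> S c != finset.set0 /\ (#|W| <= L * #|S c|)%N) ->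
  exists h : V -> nat, (forall c, A c -> (h c < L)%N) /\
    forall c c', A c -> A c' -> h c = h c' ->
      exists2 c0, A c0 & S c :&: S c0 != finset.set0 /\
                         S c' :&: S c0 != finset.set0.
Proof.
move=> hS.
pose P (D : {set {set W}}) := finset.trivIset D && [forall X in D, `[< exists2 c, A c & S c = X >]].
have P0 : P finset.set0.
  rewrite /P; apply/andP; split; last by apply/forall_inP => X; rewrite inE.
  by apply/finset.trivIsetP => X Y; rewrite inE.
have [D maxD _] := maxset_exists P0.
have [PD maxDP] := maxsetP maxD.
have /andP[tD /forall_inP aD] := PD.
have hit c : A c -> exists2 X, X \in D & S c :&: X != finset.set0.
  move=> Ac; apply/exists_inP; rewrite -[X in is_true X]negbK negb_exists_in; apply/negP => /forall_inP noX.
  have dis X : X \in D -> S c :&: X = finset.set0 by move=> /noX /negPn/eqP.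
  have [Sc0 _] := hS _ Ac.
  have ScD : S c \notin D by apply/negP => /dis; rewrite finset.setIid => /eqP; apply/negP.
  have : P (S c |: D).
    apply/andP; split.
      apply/finset.trivIsetP => X Y /setU1P[->|XD] /setU1P[->|YD] XY; rewrite -finset.setI_eq0.
      + by rewrite eqxx in XY.
      + by rewrite dis.
      + by rewrite finset.setIC dis.
      + by rewrite finset.setI_eq0; move/finset.trivIsetP : tD; apply.
    by apply/forall_inP => X /setU1P[->|/aD//]; apply/asboolP; exists c.
  move=> /maxDP /(_ (finset.subsetUr _ _)) DE; move: ScD; rewrite -DE.
  by rewrite finset.setU11.
have cardD : (#|D| <= L)%N.
  have [W0|W0] := posnP #|W|.
    have [->|[X XD]] := set_0Vmem D; first by rewrite cards0.
    have [c Ac _] := asboolW (aD _ XD).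
    have [/finset.set0Pn[w _] _] := hS _ Ac.
    by have := max_card (pred1 w); rewrite card1 W0.
  rewrite -(leq_pmul2r W0).
  apply: (@leq_trans (\sum_(X in D) L * #|X|)%N).
    rewrite -sum_nat_const; apply: leq_sum => X XD.
    by have [c Ac <-] := asboolW (aD _ XD); have [] := hS _ Ac.
  rewrite -big_distrr/= leq_mul2l; apply/orP; right.
  by move: tD => /eqP ->; exact: max_card.
pose g c := [pick X in D | S c :&: X != finset.set0].
pose h c := if g c is Some X then index X (enum D) else 0%N.
have hg c : A c -> exists X, [/\ X \in D, S c :&: X != finset.set0 & g c = Some X].
  move=> /hit[X XD SX]; rewrite /g; case: pickP => [Y /andP[YD SY]|/(_ X)].
    by exists Y.
  by rewrite XD SX.
exists h; split=> [c Ac|c c' Ac Ac'].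
  have [X [XD _ gX]] := hg _ Ac; rewrite /h gX.
  by apply: leq_trans cardD; rewrite cardE index_mem mem_enum.
have [X [XD SX gX]] := hg _ Ac; have [X' [XD' SX' gX']] := hg _ Ac'.
rewrite /h gX gX' => XX'.
have {}XX' : X = X' by rewrite -(nth_index X (s := enum D) (x := X)) ?mem_enum// XX' nth_index ?mem_enum.
subst X'.
have [c0 Ac0 SX0] := asboolW (aD _ XD).
by exists c0 => //; rewrite SX0.
Qed.

(** * Entropy of balls of trigonometric polynomials *)

Section partitions.
Context {V : Type}.
Implicit Types (A : set V) (P Q : V -> V -> Prop).

(* [h] labels the classes of a partition of [A] into [2 ^ k] parts. *)
Definition part A (k : nat) P := exists h : V -> nat,
  (forall c, A c -> (h c < 2 ^ k)%N) /\
  forall c c', A c -> A c' -> h c = h c' -> P c c'.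

Lemma part_le A k k' P Q : (k <= k')%N ->
  (forall c c', A c -> A c' -> P c c' -> Q c c') -> part A k P -> part A k' Q.
Proof.
move=> kk' PQ [h [hk hP]]; exists h; split=> [c Ac|c c' Ac Ac' hcc'].
  by rewrite (leq_trans (hk _ Ac))// leq_exp2l.
by apply: PQ => //; exact: hP.
Qed.

Lemma part0 A k P : (forall c c', A c -> A c' -> P c c') -> part A k P.
Proof. by move=> AP; exists (fun=> 0%N); split=> [c _|c c' Ac Ac' _]; rewrite ?expn_gt0//; exact: AP. Qed.

(** The two labels are the low and the high digit of one number, separated again by division by
    [2 ^ k]. *)
Lemma partI A k k' P Q : part A k P -> part A k' Q ->
  part A (k + k') (fun c c' => P c c' /\ Q c c').
Proof.
move=> [h [hk hP]] [h' [hk' hQ]].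
exists (fun c => h c + 2 ^ k * h' c)%N; split=> [c Ac|c c' Ac Ac' E].
  have h1 := hk _ Ac; have h2 := hk' _ Ac.
  rewrite expnD (@leq_trans (2 ^ k + 2 ^ k * h' c))// ?ltn_add2r// -mulnS.
  by rewrite leq_mul2l h2 orbT.
have := congr1 (modn^~ (2 ^ k)%N) E; have := congr1 (divn^~ (2 ^ k)%N) E.
rewrite !(addnC (h _)) !(mulnC (2 ^ k)%N) !divnMDl ?expn_gt0// !modnMDl.
rewrite !divn_small ?modn_small ?hk// !addn0 => E' E''.
by split; [exact: hP|exact: hQ].
Qed.

Lemma part_bigI A (L : nat) (k : nat -> nat) (P : nat -> V -> V -> Prop) :
  (forall l, (l < L)%N -> part A (k l) (P l)) ->
  part A (\sum_(l < L) k l) (fun c c' => forall l, (l < L)%N -> P l c c').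
Proof.
elim: L => [|L IHL] hP; first exact: part0.
rewrite big_ord_recr/=; have := partI (IHL _) (hP L (ltnSn L)).
move=> /(_ (fun l lL => hP l (leqW lL))); apply: part_le => // c c' _ _ [h1 h2] l.
by rewrite ltnS leq_eqVlt => /predU1P[->//|]; exact: h1.
Qed.

End partitions.

(* Refine each class of a first partition by rescaling it onto [B]. *)
Lemma part_refine (V W : Type) (A : set V) (B : set W) k k' (P S : V -> V -> Prop)
    (Q : W -> W -> Prop) (f : V -> V -> W) : part A k P ->
  (forall c c', A c -> A c' -> P c c' -> B (f c c')) -> part B k' Q ->
  (forall c c' y, A c -> A c' -> A y -> Q (f c y) (f c' y) -> S c c') ->
  part A (k + k') S.
Proof.
move=> [h [hk hP]] fB [g [gk gQ]] QS.
have [V0|/eqP/set0P[v0 _]] := pselect (A = set0).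
  by exists (fun=> 0%N); split=> c; rewrite V0.
(* A representative of each class of the first partition; [v0] serves for the labels that do not
   occur. *)
have /choice[rep rep_class] : forall i, exists y, (exists2 c, A c & h c = i) -> A y /\ h y = i.
  move=> i; have [[c Ac hc]|nh] := pselect (exists2 c, A c & h c = i).
    by exists c.
  by exists v0 => /nh.
have repP c : A c -> A (rep (h c)) /\ h (rep (h c)) = h c.
  by move=> Ac; apply: rep_class; exists c.
(* Elements with equal first digit share their representative, so their second digits compare
   differences to the same point. *)
exists (fun c => h c + 2 ^ k * g (f c (rep (h c))))%N; split=> [c Ac|c c' Ac Ac' E].
  have [Ar hr] := repP _ Ac.
  have h1 := hk _ Ac; have h2 := gk _ (fB _ _ Ac Ar (hP _ _ Ac Ar (esym hr))).
  rewrite expnD (@leq_trans (2 ^ k + 2 ^ k * g (f c (rep (h c)))))// ?ltn_add2r// -mulnS.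
  by rewrite leq_mul2l h2 orbT.
have := congr1 (modn^~ (2 ^ k)%N) E; have := congr1 (divn^~ (2 ^ k)%N) E.
rewrite !(addnC (h _)) !(mulnC (2 ^ k)%N) !divnMDl ?expn_gt0// !modnMDl.
rewrite !divn_small ?modn_small ?hk// !addn0 => E' E''.
have [Ar hr] := repP _ Ac; have [Ar' hr'] := repP _ Ac'.
apply: (QS _ _ (rep (h c))) => //; apply: gQ.
- by apply: fB => //; exact: hP.
- by apply: fB => //; apply: hP => //; rewrite hr.
- by rewrite {2}E''.
Qed.

(** * Dual Sudakov minoration by random signs *)

Section sudakov.
Context {R : realType}.

Lemma normcB2 (a b : R[i]) :
  Normc.normc (a - b) ^+ 2 <= 2 * Normc.normc a ^+ 2 + 2 * Normc.normc b ^+ 2.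
Proof.
rewrite !sqr_normcE; case: a b => [a a'] [b b'] /=.
have := sqr_ge0 (a + b); have := sqr_ge0 (a' + b'); nra.
Qed.

Lemma exprD_le (a b : R) r : 0 <= a -> 0 <= b ->
  (a + b) ^+ r <= 2 ^+ r * (a ^+ r + b ^+ r).
Proof.
wlog ab : a b / a <= b => [H a0 b0|a0 b0].
  have [ab|/ltW ba] := leP a b; first exact: H.
  by rewrite addrC (addrC (a ^+ r)); exact: H.
apply: (@le_trans _ _ ((2 * b) ^+ r)).
  by apply: lerXn2r; rewrite ?nnegrE; lra.
by rewrite exprMn ler_pM2l ?exprn_gt0// lerDr exprn_ge0.
Qed.

Section sampling.
Context (d : nat) (I : finType) (kappa : I -> d.-tuple int) (m : nat).
Hypothesis m0 : (0 < m)%N.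
Implicit Types c : I -> R[i].
Local Notation J := (I * bool * 'I_m)%type.
Local Notation mu := (torus_measure R d).

(** For each frequency, [m] signs have the real part of its coefficient as expectation ([true]) and
    [m] the imaginary part ([false]), so that the expectation of [sample_mean] is [c]. *)
Definition sample_bias c (j : J) : R :=
  if j.1.2 then complex.Re (c j.1.1) else complex.Im (c j.1.1).

Definition sample_mean (w : {ffun J -> bool}) (i : I) : R[i] :=
  (((\sum_(j < m) bsgn (w (i, true, j))) / m%:R) +i*
   ((\sum_(j < m) bsgn (w (i, false, j))) / m%:R))%C.

Lemma normr_sample_bias c j : l2norm2 c <= 1 -> `|sample_bias c j| <= 1.
Proof.
move=> c1.
have h : Normc.normc (c j.1.1) ^+ 2 <= 1.
  apply: le_trans c1; rewrite /l2norm2 (bigD1 j.1.1)//= lerDl.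
  by apply: sumr_ge0 => i _; rewrite sqr_ge0.
rewrite sqr_normcE in h.
have hr := sqr_ge0 (complex.Re (c j.1.1)); have hi := sqr_ge0 (complex.Im (c j.1.1)).
rewrite -(@expr_le1 _ 2)// real_normK ?num_real//.
by rewrite /sample_bias; case: ifP => _; lra.
Qed.

Lemma big_sample (F : J -> R) :
  \sum_j F j = \sum_i (\sum_(j < m) F (i, true, j) + \sum_(j < m) F (i, false, j)).
Proof.
rewrite (eq_bigr (fun p => F (p.1, p.2))); last by case.
rewrite -(pair_bigA _ (fun x y => F (x, y)))/=.
rewrite (eq_bigr (fun p : I * bool => \sum_(j < m) F ((p.1, p.2), j))); last by case.
rewrite -(pair_bigA _ (fun i b => \sum_(j < m) F (i, b, j)))/=.
by apply: eq_bigr => i _; rewrite big_bool.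
Qed.

Lemma sum_sample_bias_sqr c : \sum_j sample_bias c j ^+ 2 = m%:R * l2norm2 c.
Proof.
rewrite big_sample /l2norm2 mulr_sumr; apply: eq_bigr => i _.
rewrite /sample_bias/= !sumr_const card_ord sqr_normcE.
by rewrite -mulrnDl mulr_natl.
Qed.

Lemma sample_linear c w (u v : I -> R) :
  \sum_i (u i * complex.Re (sample_mean w i - c i) +
          v i * complex.Im (sample_mean w i - c i)) =
  \sum_(j : J) ((if j.1.2 then u j.1.1 else v j.1.1) / m%:R) *
     (bsgn (w j) - sample_bias c j).
Proof.
have mR : m%:R != 0 :> R by rewrite pnatr_eq0 -lt0n.
have aux (e t : R) (s : 'I_m -> R) : \sum_(j < m) e / m%:R * (s j - t) =
    e * ((\sum_(j < m) s j) / m%:R - t).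
  rewrite -mulr_sumr sumrB sumr_const card_ord -mulr_natl; by field.
rewrite [RHS]big_sample; apply: eq_bigr => i _.
rewrite /sample_bias/=.
rewrite (aux (u i) _ (fun j => bsgn (w (i, true, j)))).
rewrite (aux (v i) _ (fun j => bsgn (w (i, false, j)))).
have ReB (a b : R[i]) : complex.Re (a - b) = complex.Re a - complex.Re b by case: a b => ? ? [].
have ImB (a b : R[i]) : complex.Im (a - b) = complex.Im a - complex.Im b by case: a b => ? ? [].
by rewrite ReB ImB /sample_mean.
Qed.

Lemma sample_moment c (N : R) (u v : I -> R) r : l2norm2 c <= 1 -> (0 < r)%N ->
  0 < N -> #|I|%:R <= N -> (forall i, u i ^+ 2 + v i ^+ 2 = 1) ->
  \sum_w bweight (sample_bias c) w *
    (\sum_i (u i * complex.Re (sample_mean w i - c i) +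
             v i * complex.Im (sample_mean w i - c i))) ^+ (2 * r) <=
  (8 * expR 8 * r%:R * (N / m%:R)) ^+ r.
Proof.
move=> c1 r0 N0 IN uv; have mR : (0 : R) < m%:R by rewrite ltr0n.
under eq_bigr do rewrite sample_linear.
apply: bweight_moment => //; first by move=> j; exact: normr_sample_bias.
  by rewrite divr_gt0.
rewrite big_sample/=.
have aux (e : R) : \sum_(j < m) (e / m%:R) ^+ 2 = e ^+ 2 / m%:R.
  by rewrite sumr_const card_ord -[LHS]mulr_natl; field; rewrite gt_eqF.
under eq_bigr do rewrite !aux -mulrDl uv mul1r.
by rewrite sumr_const -[leLHS]mulr_natl ler_pM2r// invr_gt0.
Qed.

(** Exchanging the mean over the signs with the integral reduces the estimate to a fixed point [x],
    where the real and imaginary parts are linear forms with coefficients (cos, - sin) and (sin,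
    cos). No maximum over [x] occurs. The factor 4 covers the 2^r lost in separating the two parts
    and the 2 from adding them. *)
Lemma sample_Lp c (N : R) r : l2norm2 c <= 1 -> (0 < r)%N ->
  0 < N -> #|I|%:R <= N ->
  \sum_w bweight (sample_bias c) w *
    \int[mu]_x (Normc.normc (tpoly kappa (fun i => sample_mean w i - c i) x) ^+ (2 * r)) <=
  (4 * (8 * expR 8 * r%:R * (N / m%:R))) ^+ r.
Proof.
move=> c1 r0 N0 IN; set Q := 8 * expR 8 * r%:R * (N / m%:R).
have mR : (0 : R) < m%:R by rewrite ltr0n.
have Q0 : 0 < Q by rewrite !mulr_gt0 ?expR_gt0 ?invr_gt0 ?ltr0n.
have bt w : bmeas (fun x => Normc.normc (tpoly kappa (fun i => sample_mean w i - c i) x) ^+ (2 * r)).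
  exact/bmeas_exp/cbmeas_normc/cbmeas_tpoly.
under eq_bigr => w _ do rewrite -RintegralZl// ?bmeas_integrable//.
rewrite -Rintegral_bsum; last by move=> w; exact: bmeasZ.
rewrite -[leRHS](Rintegral_prob_cst mu); apply: le_Rintegral => //.
- by apply/bmeas_integrable/bmeas_sum => w; exact: bmeasZ.
- exact/bmeas_integrable/bmeas_cst.
move=> x _; pose z w i := sample_mean w i - c i; pose th i := dotp (kappa i) x.
pose X w := \sum_i (cos (th i) * complex.Re (z w i) + (- sin (th i)) * complex.Im (z w i)).
pose Y w := \sum_i (sin (th i) * complex.Re (z w i) + cos (th i) * complex.Im (z w i)).
have E w : Normc.normc (tpoly kappa (z w) x) ^+ (2 * r) <=
    2 ^+ r * (X w ^+ (2 * r) + Y w ^+ (2 * r)).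
  rewrite !(exprM _ 2) sqr_normcE /tpoly !raddf_sum/=.
  have -> : \sum_i complex.Re (z w i * expi (dotp (kappa i) x)) = X w.
    by apply: eq_bigr => i _; rewrite /th /expi; case: (z w i) => a b /=; ring.
  have -> : \sum_i complex.Im (z w i * expi (dotp (kappa i) x)) = Y w.
    by apply: eq_bigr => i _; rewrite /th /expi; case: (z w i) => a b /=; ring.
  by apply: exprD_le; exact: sqr_ge0.
apply: (@le_trans _ _ (\sum_w bweight (sample_bias c) w *
    (2 ^+ r * (X w ^+ (2 * r) + Y w ^+ (2 * r))))).
  apply: ler_sum => w _; rewrite ler_wpM2l ?E// bweight_ge0// => j.
  exact: normr_sample_bias.
under eq_bigr do rewrite mulrCA mulrDr.
rewrite -mulr_sumr big_split/=.
apply: (@le_trans _ _ (2 ^+ r * (Q ^+ r + Q ^+ r))).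
  rewrite ler_pM2l ?exprn_gt0// lerD//.
    by apply: sample_moment => // i; rewrite sqrrN cos2Dsin2.
  by apply: sample_moment => // i; rewrite addrC cos2Dsin2.
have -> : 2 ^+ r * (Q ^+ r + Q ^+ r) = (2 * 2 ^+ r) * Q ^+ r by ring.
rewrite [(4 * Q) ^+ r]exprMn ler_pM2r ?exprn_gt0//.
have -> : 4 = 2 * 2 :> R by ring.
have -> : (2 * 2) ^+ r = 2 ^+ r * 2 ^+ r :> R by rewrite exprMn.
by rewrite ler_pM2r ?exprn_gt0// -[leLHS]expr1 ler_eXn2l// ltr1n.
Qed.

End sampling.

Lemma l2norm2B (I : finType) (c c' : I -> R[i]) : l2norm2 c <= 1 -> l2norm2 c' <= 1 ->
  l2norm2 (fun i => c i - c' i) <= 2 ^+ 2.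
Proof.
move=> c1 c1'; apply: (@le_trans _ _ (2 * l2norm2 c + 2 * l2norm2 c')); last by lra.
rewrite /l2norm2 !mulr_sumr -big_split/=; apply: ler_sum => i _; exact: normcB2.
Qed.

(* Dual Sudakov minoration for the trigonometric system. An element of the
   coefficient ball is the mean of independent random signs; the law of these
   signs has a bounded chi-square distance to the uniform one, so the set of sign
   patterns whose average is close to the given element is not too small, and
   only few such sets can be disjoint. *)
Lemma sudakov : exists2 C : R, 0 < C & forall (d : nat) (I : finType)
    (kappa : I -> d.-tuple int) (N : R) (r k : nat), injective kappa ->
  (0 < r)%N -> 0 < N -> #|I|%:R <= N ->
  part [set c : I -> R[i] | l2norm2 c <= 1] k
    (fun c c' => bnd (2 * r)%:R (C * Num.sqrt (r%:R * N / k.+1%:R))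
      (tpoly kappa (fun i => c i - c' i))).
Proof.
pose K : R := 8 * expR 8; have K0 : 0 < K by rewrite mulr_gt0 ?expR_gt0.
(* Two uses of [bnd_sub] give 16 = 4 * 4; the bound on the sampling error is the square root of 8 K
   r N / m, and 1 / m <= 6 / (k + 1) turns 8 into 48. *)
pose C := 16 * Num.sqrt (48 * K); exists C.
  by rewrite mulr_gt0// sqrtr_gt0 mulr_gt0.
move=> d I kappa N r k kI r0 N0 IN.
have r1 : 1 <= r%:R :> R by rewrite ler1n.
have C0 : 0 <= C by rewrite mulr_ge0 ?sqrtr_ge0.
have pE (B : R) : 0 <= B -> B `^ (2 * r)%:R = (B ^+ 2) ^+ r.
  by move=> B0; rewrite powR_mulrn// exprM.
(* Too few bits for a single sample: one class suffices, by the trivial supremum bound. *)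
have [k4|k4] := ltnP k 4.
  apply: part0 => c c' c1 c1'.
  have cb := l2norm2B c1 c1'.
  apply: bnd_pointwise => [//||//|x].
  - exact: cbmeas_tpoly.
  - by rewrite mulr_ge0 ?sqrtr_ge0.
  apply: (le_trans (tpoly_sup kappa x _ IN cb)) => //.
  rewrite mulrC; apply: (@le_trans _ _ (4 * Num.sqrt (r%:R * N / k.+1%:R))).
    have -> : 4 = 2 * Num.sqrt 4 :> R.
      have -> : 4 = 2 ^+ 2 :> R by ring.
      by rewrite sqrtr_sqr ger0_norm.
    rewrite -mulrA ler_pM2l// -sqrtrM//; apply: ler_wsqrtr.
    rewrite mulrA ler_pdivlMr ?ltr0n//.
    have : k.+1%:R <= 4 :> R by rewrite ler_nat.
    by move=> k4R; rewrite (@le_trans _ _ (N * 4))// ?ler_pM2l//; nra.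
  rewrite ler_wpM2r ?sqrtr_ge0//.
  have : 1 <= Num.sqrt (48 * K).
    rewrite -[leLHS]sqrtr1; apply: ler_wsqrtr; rewrite /K.
    by have := expR_ge1Dx (8 : R); lra.
  by rewrite /C; lra.
(* The sample size: the disjointness argument uses [2 * m.+1] bits. *)
have [m [m0 m2k km6]] : exists m, [/\ 0 < m, 2 * m.+1 <= k & k.+1 <= 6 * m]%N.
  by clear -k4; exists (k./2).-1; split; lia.
have mR : (0 : R) < m%:R by rewrite ltr0n.
pose Q := 4 * (K * r%:R * (N / m%:R)).
have Q0 : 0 < Q by rewrite /Q !mulr_gt0 ?invr_gt0//; lra.
(* The sign patterns whose mean is close to [c]. The threshold is twice the bound [Q ^+ r] on the
   expected error, so by Markov's inequality the biased law gives [S c] mass at least 1/2. *)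
pose S (c : I -> R[i]) : {set {ffun I * bool * 'I_m -> bool}} := finset (fun w : {ffun I * bool * 'I_m -> bool} =>
  \int[torus_measure R d]_x (Normc.normc (tpoly kappa (fun i => sample_mean w i - c i) x) ^+ (2 * r))
   <= 2 * Q ^+ r).
have Shalf c : l2norm2 c <= 1 -> 1 / 2 <= \sum_(w in S c) bweight (sample_bias (m := m) c) w.
  move=> c1.
  have wt w : 0 <= bweight (sample_bias (m := m) c) w.
    by apply: bweight_ge0 => j; exact: normr_sample_bias.
  have := sum_bweight (sample_bias (m := m) c).
  rewrite (bigID (mem (S c)))/=.
  suff : \sum_(w | w \notin S c) bweight (sample_bias (m := m) c) w <= 1 / 2 by lra.
  have Qr : 0 < Q ^+ r by rewrite exprn_gt0.
  rewrite -(@ler_pM2r _ (2 * Q ^+ r)) ?mulr_gt0// mulr_suml.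
  have -> : 1 / 2 * (2 * Q ^+ r) = Q ^+ r by field.
  apply: le_trans (sample_Lp kappa m0 c1 r0 N0 IN).
  rewrite [leRHS](bigID (mem (S c)))/= -[leLHS]add0r lerD//.
    apply: sumr_ge0 => w _; rewrite mulr_ge0//.
    by apply: Rintegral_ge0 => x _; rewrite exprn_ge0// normc_ge0.
  apply: ler_sum => w; rewrite inE -ltNge => /ltW h.
  by rewrite ler_wpM2l.
have Scard c : l2norm2 c <= 1 ->
    S c != finset.set0 /\ (#|{ffun I * bool * 'I_m -> bool}| <= 2 ^ (2 * m.+1) * #|S c|)%N.
  move=> c1; have := bweight_half (Shalf _ c1); rewrite sum_sample_bias_sqr => h.
  (* The squared biases add up to at most [m], so [S c] contains at least a fraction 2^(- 2 (m + 1))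
     of all patterns. *)
  have h2 : 2 ^+ #|{: I * bool * 'I_m}| <= 4 * 4 ^+ m * #|S c|%:R :> R.
    apply: (le_trans h); rewrite ler_wpM2r// ler_pM2l//.
    apply: (@le_trans _ _ (expR (m%:R * 1))).
      by rewrite ler_expR ler_pM2l.
    rewrite expRM_natl; apply: lerXn2r; rewrite ?nnegrE ?expR_ge0//.
    exact: expR1_le4.
  have h3 : (#|{ffun I * bool * 'I_m -> bool}| <= 2 ^ (2 * m.+1) * #|S c|)%N.
    rewrite card_ffun card_bool expnM -(ler_nat R) natrM !natrX exprS.
    by apply: (le_trans h2); rewrite (_ : 4 = 2 ^+ 2 :> R)//; ring.
  split=> //; rewrite -card_gt0 lt0n; apply/eqP => S0.
  by move: h3; rewrite S0 muln0 card_ffun card_bool leqn0 expn_eq0.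
have [h [hL hS]] := @maximal_disjoint_classes _ _ [set c : I -> R[i] | l2norm2 c <= 1] S _ Scard.
pose B := Num.sqrt (2 * Q).
have B0 : 0 <= B by exact: sqrtr_ge0.
have Q20 : 0 <= 2 * Q by apply: mulr_ge0 => //; exact: ltW.
have Sbnd c w : w \in S c -> bnd (2 * r)%:R B (tpoly kappa (fun i => sample_mean w i - c i)).
  rewrite inE /bnd pE// (sqr_sqrtr Q20) => h'.
  under eq_Rintegral do rewrite powR_mulrn ?normc_ge0//.
  apply: (le_trans h'); rewrite [leRHS](@exprMn _ r 2 Q).
  rewrite ler_wpM2r ?(exprn_ge0 r (ltW Q0))//.
  by rewrite -[leLHS]expr1 ler_eXn2l// ltr1n.
have p1 : 1 <= (2 * r)%:R :> R by rewrite ler1n muln_gt0.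
have p0 : 0 <= (2 * r)%:R :> R by [].
have near c c' : S c :&: S c' != finset.set0 ->
    bnd (2 * r)%:R (4 * B) (tpoly kappa (fun i => c i - c' i)).
  move=> /finset.set0Pn[w /setIP[wc wc']].
  rewrite (_ : (fun i => c i - c' i) =
      fun i => (sample_mean w i - c' i) - (sample_mean w i - c i)); last first.
    by apply/funext => i; rewrite opprB [RHS]addrC addrA subrK.
  rewrite tpolyB; apply: bnd_sub => //; try exact: cbmeas_tpoly; exact: Sbnd.
exists h; split=> [c Ac|c c' Ac Ac' /hS[]// c0 Ac0 [cc0 cc0']].
  by apply: (leq_trans (hL _ Ac)); rewrite leq_exp2l.
apply: (@bnd_le _ _ _ (4 * (4 * B))) => //.
  rewrite mulrA !mulr_ge0//= (_ : 4 * 4 = 16); last by ring.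
  suff BK : B <= Num.sqrt (48 * K) * Num.sqrt (r%:R * N / k.+1%:R).
    by rewrite /C -[leRHS]mulrA; exact: ler_wpM2l.
  rewrite -sqrtrM; last by apply: mulr_ge0 => //; exact: ltW.
  apply: ler_wsqrtr; rewrite /Q.
  have mk : k.+1%:R <= 6 * m%:R :> R by rewrite -natrM ler_nat.
  have -> : 2 * (4 * (K * r%:R * (N / m%:R))) = (8 * (K * r%:R * N)) / m%:R.
    by field; rewrite gt_eqF.
  have -> : 48 * K * (r%:R * N / k.+1%:R) = 48 * (K * r%:R * N) / k.+1%:R by ring.
  have KrN : 0 < K * r%:R * N by rewrite !mulr_gt0// ltr0n.
  rewrite ler_pdivrMr// [leRHS]mulrAC ler_pdivlMr ?ltr0n//.
  have := ler_wpM2l (ltW KrN) mk; clear; lra.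
rewrite (_ : (fun i => c i - c' i) = fun i => (c i - c0 i) - (c' i - c0 i)); last first.
  by apply/funext => i; rewrite opprB addrA subrK.
rewrite tpolyB; apply: bnd_sub => //; try exact: cbmeas_tpoly; try exact: near.
by rewrite mulr_ge0.
Qed.

End sudakov.

Section powR_extra.
Context {R : realType}.

Lemma sqrt_powR (x : R) : 0 <= x -> Num.sqrt x = x `^ (1 / 2).
Proof. by move=> x0; rewrite div1r powR12_sqrt. Qed.

Lemma powR_half_split (N b : R) (k k1 : nat) : 0 <= N -> 0 <= b ->
  (k <= 2 * k1 + 1)%N -> (N / k1.+1%:R) `^ b <= 2 `^ b * (N / k.+1%:R) `^ b.
Proof.
move=> N0 b0 kk1; rewrite -powRM ?divr_ge0//.
rewrite ge0_ler_powR// ?nnegrE ?mulr_ge0 ?divr_ge0//.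
rewrite mulrCA ler_wpM2l// ler_pdivlMr ?ltr0n// mulrC ler_pdivrMr ?ltr0n//.
by rewrite -natrM ler_nat; lia.
Qed.

End powR_extra.

(** * Entropy numbers of L_q balls in L_p *)

Section entropy_of_balls.
Context {R : realType} (d : nat) (I : finType) (kappa : I -> d.-tuple int).
Implicit Types (p q s : R) (c : I -> R[i]).
Hypothesis kI : injective kappa.

Definition Lball q : set (I -> R[i]) := [set c | bnd q 1 (tpoly kappa c)].

(** An entropy number of the L_q ball in L_p, up to a factor: [e] bounds the diameter of the pieces
    instead of the radius of balls. *)
Definition Ent q p k (e : R) := part (Lball q) k
  (fun c c' => bnd p e (tpoly kappa (fun i => c i - c' i))).

Lemma Ent_le q p k (e e' : R) : 0 <= p -> 0 <= e <= e' -> Ent q p k e -> Ent q p k e'.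
Proof. by move=> p0 ee'; apply: part_le => // c c' _ _; exact: bnd_le. Qed.

(** Multiplicativity of entropy numbers: inside a piece of the first partition the differences,
    divided by [e], lie in the L_s ball, which the second partition cuts. *)
Lemma Ent_comp q s p k k' (e e' : R) : 0 < s -> 0 < p -> 0 < e -> 0 <= e' ->
  Ent q s k e -> Ent s p k' e' -> Ent q p (k + k') (e * e').
Proof.
move=> s0 p0 e0 e'0 E E'.
pose f c y (i : I) : R[i] := ((e^-1)%:C)%C * (c i - y i).
apply: (part_refine (f := f) E _ E') => [c c' _ _ cc'|c c' y _ _ _].
  rewrite /Lball/= /f tpolyZ -[1](mulVf (lt0r_neq0 e0)).
  by apply: bnd_scale => //; rewrite ?(ltW s0) ?invr_ge0 ?(ltW e0)//; exact: cbmeas_tpoly.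
move=> h; have := bnd_scale (ltW p0) (cbmeas_tpoly _ _) (ltW e0) e'0 h.
rewrite -tpolyZ; congr (bnd _ _ (tpoly _ _)); apply/funext => i.
rewrite /f -mulrBr mulrA -rmorphM/= divff ?lt0r_neq0// mul1r opprB.
by rewrite addrA subrK.
Qed.

Lemma Lball2 k p e : part [set c | l2norm2 c <= 1] k
    (fun c c' => bnd p e (tpoly kappa (fun i => c i - c' i))) -> Ent 2 p k e.
Proof.
move=> [h [hk hP]]; exists h.
have sub c : Lball 2 c -> l2norm2 c <= 1.
  by rewrite /Lball/= bnd2E// expr1n.
by split=> [c /sub/hk|c c' /sub ? /sub ? E]//; exact: hP.
Qed.

(** [bnd_interpolation] is affine in the exponents, whereas [t] is affine in their reciprocals; the
    parameters are related by u = 2 t / q. *)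
Lemma bnd_interpolation2 q p (t A B : R) c : 0 < q -> 0 < p -> 0 <= t <= 1 ->
  1 / 2 = t / q + (1 - t) / p -> 0 < A -> 0 < B ->
  bnd q A (tpoly kappa c) -> bnd p B (tpoly kappa c) ->
  bnd 2 (A `^ t * B `^ (1 - t)) (tpoly kappa c).
Proof.
move=> q0 p0 /andP[t0 t1] tE A0 B0 cA cB.
have uE : 1 - 2 * t / q = 2 * (1 - t) / p.
  have : 2 * (1 / 2) = 2 * (t / q + (1 - t) / p) by rewrite tE.
  by rewrite mulrDr !mulrA; lra.
have u01 : 0 <= 2 * t / q <= 1.
  rewrite divr_ge0 ?mulr_ge0 ?(ltW q0)//= -subr_ge0 uE.
  by rewrite divr_ge0 ?(ltW p0)// mulr_ge0// subr_ge0.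
have sE : 2 = 2 * t / q * q + (1 - 2 * t / q) * p.
  by rewrite uE !divfK ?gt_eqF//; ring.
have E : (A `^ q) `^ (2 * t / q) * (B `^ p) `^ (1 - 2 * t / q) = (A `^ t * B `^ (1 - t)) `^ 2.
  rewrite (powRM 2 (powR_ge0 A t) (powR_ge0 B (1 - t))) -!powRrM uE.
  have -> : q * (2 * t / q) = t * 2 by field; rewrite gt_eqF.
  by have -> : p * (2 * (1 - t) / p) = (1 - t) * 2 by field; rewrite gt_eqF.
rewrite /bnd -E.
exact: (bnd_interpolation q0 p0 u01 sE (cbmeas_tpoly _ _) A0 B0 cA cB).
Qed.

Lemma Ent_interpolation q p (t : R) k e : 1 <= q -> 0 < p -> 0 <= t <= 1 ->
  1 / 2 = t / q + (1 - t) / p -> 0 < e ->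
  Ent q p k e -> Ent q 2 k (4 * e `^ (1 - t)).
Proof.
move=> q1 p0 t01 tE e0; apply: part_le => // c c' cA c'A cc'.
have q0 : 0 < q by lra.
have cc4 : bnd q (4 * 1) (tpoly kappa (fun i => c i - c' i)).
  rewrite tpolyB.
  exact: (bnd_sub q1 (cbmeas_tpoly _ _) (cbmeas_tpoly _ _) ler01 cA c'A).
have e4 : 0 <= (4 * 1) `^ t * e `^ (1 - t) <= 4 * e `^ (1 - t).
  rewrite mulr1 mulr_ge0 ?powR_ge0//= ler_wpM2r ?powR_ge0//.
  by have /andP[_ ?] := t01; rewrite ler1_powR// ler1n.
have p41 : 0 < 4 * 1 :> R by rewrite mulr1.
exact: (bnd_le (ler0n _ 2) e4 (bnd_interpolation2 q0 p0 t01 tE p41 e0 cc4 cc')).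
Qed.

(** If B is the L_p norm, interpolation bounds the L_2 norm by B^(1 - t), and [tpoly_sup] then gives
    B <= sqrt(N) B^(1 - t). Dividing by B^(1 - t) yields the bound. *)
Lemma nikolskii q p (t N : R) c : 0 < q -> 0 < p -> 0 < t <= 1 ->
  1 / 2 = t / q + (1 - t) / p -> 0 < N -> #|I|%:R <= N ->
  bnd q 1 (tpoly kappa c) -> bnd p (N `^ (1 / (2 * t))) (tpoly kappa c).
Proof.
move=> q0 p0 /andP[t0 t1] tE N0 IN cq.
set X := \int[torus_measure R d]_x (Normc.normc (tpoly kappa c x) `^ p).
have X0 : 0 <= X by exact: integral_normc_powR_ge0.
pose B := X `^ p^-1.
have BE : B `^ p = X by rewrite /B -powRrM mulVf ?gt_eqF// powRr1.
have [Xz|Xn0] := eqVneq X 0.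
  by rewrite /bnd -/X Xz powR_ge0.
have B0 : 0 < B by rewrite powR_gt0// lt0r Xn0.
have cB : bnd p B (tpoly kappa c) by rewrite /bnd BE.
have t01 : 0 <= t <= 1 by rewrite (ltW t0).
have c2 : l2norm2 c <= (B `^ (1 - t)) ^+ 2.
  apply/(bnd2E c kI (powR_ge0 _ _)).
  have E : 1 `^ t * B `^ (1 - t) = B `^ (1 - t) by rewrite powR1 mul1r.
  rewrite -E; exact: (bnd_interpolation2 q0 p0 t01 tE ltr01 B0 cq cB).
have cs : bnd p (Num.sqrt N * B `^ (1 - t)) (tpoly kappa c).
  apply: bnd_pointwise; [exact: ltW|exact: cbmeas_tpoly| |].
    by rewrite mulr_ge0 ?sqrtr_ge0 ?powR_ge0.
  by move=> x; apply: tpoly_sup => //; exact: powR_ge0.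
have sN0 : 0 <= Num.sqrt N * B `^ (1 - t) by rewrite mulr_ge0 ?sqrtr_ge0 ?powR_ge0.
have Ble : B <= Num.sqrt N * B `^ (1 - t).
  rewrite leNgt; apply/negP => /(gt0_ltr_powR p0).
  rewrite !nnegrE (ltW B0) BE => /(_ sN0 isT).
  by rewrite ltNge; apply/negP/negPn; exact: cs.
have {Ble} : B `^ t <= Num.sqrt N.
  have -> : B `^ t = B / B `^ (1 - t).
    rewrite (_ : B `^ t = B `^ (1 - (1 - t))); last by congr (_ `^ _); ring.
    by rewrite powRB ?(gt_eqF B0) ?implybT// powRr1// ltW.
  by rewrite (ler_pdivrMr _ _ (powR_gt0 _ B0)).
move=> Bt; apply: (@bnd_le _ _ _ B) => //; first exact: ltW.
have BB : B = (B `^ t) `^ t^-1.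
  by rewrite -powRrM (divff (lt0r_neq0 t0)) powRr1// ltW.
rewrite (ltW B0)/= BB.
rewrite (sqrt_powR (ltW N0)) in Bt.
have -> : 1 / (2 * t) = 1 / 2 * t^-1 by field; rewrite gt_eqF.
by rewrite powRrM ge0_ler_powR ?nnegrE ?powR_ge0// invr_ge0 ltW.
Qed.

End entropy_of_balls.

Lemma half_split k : exists k1 k2, [/\ (k = k1 + k2)%N, (k <= 2 * k1 + 1)%N,
  (k <= 2 * k2 + 1)%N & ((0 < k)%N -> (k1 < k)%N)].
Proof. by exists (k./2), (k - k./2)%N; split; lia. Qed.

Section bootstrap.
Context {R : realType}.

(* Half of the bits give an error [e] in L_p, hence [4 * e `^ (1 - t)] in L_2 by
   interpolation with L_q; the other half serve to pass from L_2 to L_p. *)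
Lemma Ent_bootstrap (q t : R) (r0 : nat) : 1 <= q -> (0 < r0)%N -> 0 < t <= 1 ->
  1 / 2 = t / q + (1 - t) / (2 * r0)%:R ->
  exists2 C : R, 0 < C & forall (d : nat) (I : finType) (kappa : I -> d.-tuple int)
    (N : R) (k : nat), injective kappa -> 0 < N -> #|I|%:R <= N ->
    Ent kappa q (2 * r0)%:R k (C * (N / k.+1%:R) `^ (1 / (2 * t))).
Proof.
move=> q1 r00 /andP[t0 t1] tE.
have [C0 C00 hC0] := @sudakov R.
set b := 1 / (2 * t); have b0 : 0 < b by rewrite divr_gt0// mulr_gt0.
(* Interpolation multiplies the exponent by 1 - t and the passage from L_2 adds 1/2: [b] is the
   fixed point. *)
have bE : b * (1 - t) + 1 / 2 = b by rewrite /b; field; rewrite gt_eqF.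
pose D := 4 * C0 * r0%:R `^ (1 / 2) * 2 `^ b.
have D0 : 0 < D by rewrite !mulr_gt0 ?powR_gt0 ?ltr0n.
(* The constant must reproduce itself, D C^(1 - t) <= C, that is D <= C^t; [D] collects the
   constants of one step. The summand 4 serves for [k = 0], where the bound comes from [nikolskii]
   and [bnd_sub]. *)
pose C := 4 + D `^ t^-1.
have C4 : 4 <= C by rewrite lerDl powR_ge0.
have Cp : 0 < C by lra.
have DC : D * C `^ (1 - t) <= C.
  have Dt : D <= C `^ t.
    rewrite -[D](powRr1 (ltW D0)) -(mulVf (lt0r_neq0 t0)) powRrM.
    by rewrite ge0_ler_powR ?nnegrE ?powR_ge0 ?(ltW t0) ?(ltW Cp)// lerDr.
  apply: (le_trans (ler_wpM2r (powR_ge0 _ _) Dt)).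
  rewrite -powRD ?(gt_eqF Cp) ?implybT// (_ : t + (1 - t) = 1) ?powRr1 ?(ltW Cp)//.
  by ring.
exists C => // d I kappa N k kI N0 IN.
have t01 : 0 <= t <= 1 by rewrite (ltW t0).
have p0 : 0 < (2 * r0)%:R :> R by rewrite ltr0n muln_gt0.
have p1 : 1 <= (2 * r0)%:R :> R by rewrite ler1n muln_gt0.
have q0 : 0 < q by lra.
have Nk0 n : 0 < N / n.+1%:R by rewrite divr_gt0.
elim/ltn_ind: k => k IHk.
have [->|k0] := posnP k.
  rewrite divr1; apply: part0 => c c' cA c'A.
  have nik c1 : Lball kappa q c1 -> bnd (2 * r0)%:R (N `^ b) (tpoly kappa c1).
    by apply: nikolskii => //; rewrite t0.
  apply: (@bnd_le _ _ _ (4 * N `^ b)); first exact: ltW.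
    by rewrite mulr_ge0 ?powR_ge0//= ler_wpM2r ?powR_ge0.
  rewrite tpolyB; apply: bnd_sub => //; try exact: cbmeas_tpoly.
  - exact: powR_ge0.
  - exact: nik.
  - exact: nik.
have [k1 [k2 [kE k1h k2h /(_ k0) k1k]]] := half_split k.
have e0 : 0 < C * (N / k1.+1%:R) `^ b by rewrite mulr_gt0 ?powR_gt0.
have E1 := Ent_interpolation q1 p0 t01 tE e0 (IHk _ k1k).
have E2 := Lball2 kI (hC0 _ _ _ _ _ k2 kI r00 N0 IN).
have e2 : 0 <= C0 * Num.sqrt (r0%:R * N / k2.+1%:R).
  by rewrite mulr_ge0 ?sqrtr_ge0 ?(ltW C00).
have e1 : 0 < 4 * (C * (N / k1.+1%:R) `^ b) `^ (1 - t) by rewrite mulr_gt0 ?powR_gt0.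
have E3 := Ent_comp (ltr0n _ 2) p0 e1 e2 E1 E2.
rewrite {1}kE; apply: Ent_le E3; first exact: ltW.
rewrite mulr_ge0 ?(ltW e1)//=.
have -> : C0 * Num.sqrt (r0%:R * N / k2.+1%:R) =
    C0 * r0%:R `^ (1 / 2) * (N / k2.+1%:R) `^ (1 / 2).
  by rewrite -[r0%:R * N / _]mulrA sqrtrM// !sqrt_powR ?(ltW (Nk0 _))// mulrA.
have -> : (C * (N / k1.+1%:R) `^ b) `^ (1 - t) =
    C `^ (1 - t) * (N / k1.+1%:R) `^ (b * (1 - t)).
  by rewrite powRM ?powR_ge0 ?(ltW Cp)// -powRrM.
have bt0 : 0 <= b * (1 - t) by rewrite mulr_ge0 ?(ltW b0)// subr_ge0.
have h1 := powR_half_split (ltW N0) bt0 k1h.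
have h2 : (N / k2.+1%:R) `^ (1 / 2) <= 2 `^ (1 / 2) * (N / k.+1%:R) `^ (1 / 2).
  by apply: powR_half_split => //; exact: ltW.
have h3 : (N / k1.+1%:R) `^ (b * (1 - t)) * (N / k2.+1%:R) `^ (1 / 2) <=
    2 `^ b * (N / k.+1%:R) `^ b.
  apply: (le_trans (ler_pM (powR_ge0 _ _) (powR_ge0 _ _) h1 h2)).
  rewrite mulrACA -!powRD ?(gt_eqF (Nk0 _)) ?implybT ?bE//.
  by rewrite pnatr_eq0 implybT.
have -> : 4 * (C `^ (1 - t) * (N / k1.+1%:R) `^ (b * (1 - t))) *
    (C0 * r0%:R `^ (1 / 2) * (N / k2.+1%:R) `^ (1 / 2)) =
    4 * C0 * r0%:R `^ (1 / 2) * C `^ (1 - t) *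
    ((N / k1.+1%:R) `^ (b * (1 - t)) * (N / k2.+1%:R) `^ (1 / 2)) by ring.
have c0 : 0 <= 4 * C0 * r0%:R `^ (1 / 2) * C `^ (1 - t).
  by rewrite !mulr_ge0 ?powR_ge0 ?(ltW C00).
apply: (le_trans (ler_wpM2l c0 h3)).
rewrite [leLHS](_ : _ = D * C `^ (1 - t) * (N / k.+1%:R) `^ b); last by rewrite /D; ring.
exact: (ler_wpM2r (powR_ge0 _ _) DC).
Qed.

(* [j] extra halvings of the L_q ball raise the exponent from [b] to
   [b * j.+1], which is what is needed when [k] exceeds the dimension. *)
Lemma entropy_block (q a : R) : 1 < q -> q <= 2 -> 1 / q < a ->
  exists2 b : R, 0 < b < a & forall j : nat, exists2 C : R, 0 < C &
    forall (d : nat) (I : finType) (kappa : I -> d.-tuple int) (N : R) (r k : nat),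
    injective kappa -> 0 < N -> #|I|%:R <= N -> (0 < r)%N ->
    Ent kappa q (2 * r)%:R k (C * Num.sqrt r%:R * (N / k.+1%:R) `^ (b * j.+1%:R)).
Proof.
move=> q1 q2 qa.
have q0 : 0 < q by lra.
have q10 : 0 < 1 / q by rewrite divr_gt0.
have a0 : 0 < a by exact: lt_trans qa.
have aq0 : 0 < a - 1 / q by rewrite subr_gt0.
(* With v = 1 / p one has b = (1/q - v) / (1 - 2v), and b < a as soon as 2 a v = a / r0 is less than
   a - 1/q. *)
pose r0 := (Num.truncn (a / (a - 1 / q))).+1.
have r0a : a / (a - 1 / q) < r0%:R by exact: truncnS_gt.
have r00 : (0 < r0)%N by [].
have r01 : 1 < r0%:R :> R.
  by apply: lt_trans r0a; rewrite ltr_pdivlMr// mul1r; lra.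
set p : R := (2 * r0)%:R.
have pE : p = 2 * r0%:R by rewrite /p natrM.
have p2 : 2 < p by rewrite pE; lra.
have p0 : 0 < p by lra.
have qp : q < p by exact: le_lt_trans p2.
pose v := 1 / p; have v0 : 0 < v by rewrite divr_gt0.
have v12 : v < 1 / 2 by rewrite ltr_pdivrMr//; lra.
have q12 : 1 / 2 <= 1 / q by rewrite ler_pdivlMr//; lra.
pose t := (1 / 2 - v) / (1 / q - v).
have qv : 0 < 1 / q - v by lra.
have t0 : 0 < t by rewrite divr_gt0//; lra.
have t1 : t <= 1 by rewrite ler_pdivrMr//; lra.
have tE : 1 / 2 = t / q + (1 - t) / p.
  have -> : t / q + (1 - t) / p = t * (1 / q - v) + v by rewrite /v; ring.
  by rewrite /t divfK ?gt_eqF//; ring.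
have [C1 C10 hC1] := Ent_bootstrap (ltW q1) r00 (introT andP (conj t0 t1)) tE.
set b := 1 / (2 * t) in hC1.
have b0 : 0 < b by rewrite divr_gt0// mulr_gt0.
have ba : b < a.
  have vr : a * (2 * v) < a - 1 / q.
    rewrite /v pE; have -> : a * (2 * (1 / (2 * r0%:R))) = a / r0%:R.
      by field; rewrite gt_eqF//; lra.
    by rewrite ltr_pdivrMr ?(lt_trans ltr01)// mulrC -ltr_pdivrMr.
  have tq : t * (1 / q - v) = 1 / 2 - v by rewrite /t divfK// gt_eqF.
  have t20 : 0 < 2 * t by rewrite pmulr_rgt0.
  rewrite (ltr_pdivrMr _ _ t20) -(ltr_pM2r qv).
  have -> : a * (2 * t) * (1 / q - v) = a * (2 * (t * (1 / q - v))) by ring.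
  by rewrite tq; lra.
exists b; first by rewrite b0.
have [C0 C00 hC0] := @sudakov R.
have t01 : 0 <= t <= 1 by rewrite (ltW t0).
have bE : b * (1 - t) + 1 / 2 = b by rewrite /b; field; rewrite gt_eqF.
have bt0 : 0 <= b * (1 - t) by rewrite mulr_ge0 ?(ltW b0)// subr_ge0.
(* For [j = 0] the fixed exponent [p] serves for the interpolation to L_2, and only the last
   passage, from L_2 to L_2r, involves [r]; this is why [r] enters through its square root alone. *)
elim=> [|j [C C0' hC]].
  pose C := 4 * C1 `^ (1 - t) * C0 * 2 `^ b.
  exists C; first by rewrite !mulr_gt0 ?powR_gt0.
  move=> d I kappa N r k kI N0 IN rp; rewrite mulr1.
  have Nk0 n : 0 < N / n.+1%:R by rewrite divr_gt0.
  have [k1 [k2 [kE k1h k2h _]]] := half_split k.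
  have e0 : 0 < C1 * (N / k1.+1%:R) `^ b by rewrite mulr_gt0 ?powR_gt0.
  have E1 := Ent_interpolation (ltW q1) p0 t01 tE e0 (hC1 _ _ _ _ k1 kI N0 IN).
  have E2 := Lball2 kI (hC0 _ _ _ _ _ k2 kI rp N0 IN).
  have e2 : 0 <= C0 * Num.sqrt (r%:R * N / k2.+1%:R).
    by rewrite mulr_ge0 ?sqrtr_ge0 ?(ltW C00).
  have e1 : 0 < 4 * (C1 * (N / k1.+1%:R) `^ b) `^ (1 - t) by rewrite mulr_gt0 ?powR_gt0.
  have pr0 : 0 < (2 * r)%:R :> R by rewrite ltr0n muln_gt0.
  have E3 := Ent_comp (ltr0n _ 2) pr0 e1 e2 E1 E2.
  rewrite {1}kE; apply: Ent_le E3; first exact: ltW.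
  rewrite mulr_ge0 ?(ltW e1)//=.
  have -> : C0 * Num.sqrt (r%:R * N / k2.+1%:R) =
      C0 * Num.sqrt r%:R * (N / k2.+1%:R) `^ (1 / 2).
    by rewrite -[r%:R * N / _]mulrA sqrtrM// [Num.sqrt (N / _)]sqrt_powR ?(ltW (Nk0 _))// mulrA.
  have -> : (C1 * (N / k1.+1%:R) `^ b) `^ (1 - t) =
      C1 `^ (1 - t) * (N / k1.+1%:R) `^ (b * (1 - t)).
    by rewrite powRM ?powR_ge0 ?(ltW C10)// -powRrM.
  have h1 := powR_half_split (ltW N0) bt0 k1h.
  have h2 : (N / k2.+1%:R) `^ (1 / 2) <= 2 `^ (1 / 2) * (N / k.+1%:R) `^ (1 / 2).
    by apply: powR_half_split => //; exact: ltW.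
  have h3 : (N / k1.+1%:R) `^ (b * (1 - t)) * (N / k2.+1%:R) `^ (1 / 2) <=
      2 `^ b * (N / k.+1%:R) `^ b.
    apply: (le_trans (ler_pM (powR_ge0 _ _) (powR_ge0 _ _) h1 h2)).
    rewrite mulrACA -!powRD ?(gt_eqF (Nk0 _)) ?implybT ?bE//.
    by rewrite pnatr_eq0 implybT.
  have -> : 4 * (C1 `^ (1 - t) * (N / k1.+1%:R) `^ (b * (1 - t))) *
      (C0 * Num.sqrt r%:R * (N / k2.+1%:R) `^ (1 / 2)) =
      4 * C1 `^ (1 - t) * C0 * Num.sqrt r%:R *
      ((N / k1.+1%:R) `^ (b * (1 - t)) * (N / k2.+1%:R) `^ (1 / 2)) by ring.
  have c0 : 0 <= 4 * C1 `^ (1 - t) * C0 * Num.sqrt r%:R.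
    by rewrite !mulr_ge0 ?powR_ge0 ?(ltW C00) ?sqrtr_ge0.
  apply: (le_trans (ler_wpM2l c0 h3)).
  rewrite le_eqVlt; apply/orP; left; apply/eqP.
  by rewrite /C; ring.
have bj0 : 0 <= b * j.+1%:R by rewrite mulr_ge0 ?(ltW b0).
exists (C1 * C * 2 `^ (b * j.+2%:R)); first by rewrite !mulr_gt0 ?powR_gt0.
move=> d I kappa N r k kI N0 IN rp.
have Nk0 n : 0 < N / n.+1%:R by rewrite divr_gt0.
have [k1 [k2 [kE k1h k2h _]]] := half_split k.
have e1 : 0 < C1 * (N / k1.+1%:R) `^ b by rewrite mulr_gt0 ?powR_gt0.
(* Half of the bits shrink the L_q ball within L_q itself, the L_q norm being at most the L_p norm;
   the induction hypothesis applies to the shrunken ball. *)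
have E1 : Ent kappa q q k1 (C1 * (N / k1.+1%:R) `^ b).
  apply: part_le (hC1 _ _ _ _ k1 kI N0 IN) => // c c' _ _.
  by apply: bnd_mono => //; [exact: ltW|exact: cbmeas_tpoly].
have E2 := hC _ _ _ _ _ k2 kI N0 IN rp.
have pr0 : 0 < (2 * r)%:R :> R by rewrite ltr0n muln_gt0.
have e2 : 0 <= C * Num.sqrt r%:R * (N / k2.+1%:R) `^ (b * j.+1%:R).
  by rewrite !mulr_ge0 ?powR_ge0 ?sqrtr_ge0 ?(ltW C0').
have E3 := Ent_comp q0 pr0 e1 e2 E1 E2.
rewrite {1}kE; apply: Ent_le E3; first exact: ltW.
rewrite mulr_ge0 ?(ltW e1)//=.
have h1 := powR_half_split (ltW N0) (ltW b0) k1h.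
have h2 := powR_half_split (ltW N0) bj0 k2h.
have bjE : b + b * j.+1%:R = b * j.+2%:R by rewrite -[j.+2]addn1 natrD; ring.
have h3 : (N / k1.+1%:R) `^ b * (N / k2.+1%:R) `^ (b * j.+1%:R) <=
    2 `^ (b * j.+2%:R) * (N / k.+1%:R) `^ (b * j.+2%:R).
  apply: (le_trans (ler_pM (powR_ge0 _ _) (powR_ge0 _ _) h1 h2)).
  rewrite mulrACA -!powRD ?(gt_eqF (Nk0 _)) ?implybT ?bjE//.
  by rewrite pnatr_eq0 implybT.
have -> : C1 * (N / k1.+1%:R) `^ b * (C * Num.sqrt r%:R * (N / k2.+1%:R) `^ (b * j.+1%:R)) =
  C1 * C * Num.sqrt r%:R * ((N / k1.+1%:R) `^ b * (N / k2.+1%:R) `^ (b * j.+1%:R)) by ring.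
have c0 : 0 <= C1 * C * Num.sqrt r%:R.
  by rewrite !mulr_ge0 ?(ltW C10) ?(ltW C0') ?sqrtr_ge0.
apply: (le_trans (ler_wpM2l c0 h3)).
by rewrite le_eqVlt; apply/orP; left; apply/eqP; ring.
Qed.

End bootstrap.

(** * Supremum bounds and uniqueness of Fourier coefficients *)

Section cube_spectrum.
Context {R : realType} (d : nat).
Implicit Types (f g : Rn R d -> R[i]) (n : nat).

Definition cubek n (u : {ffun 'I_d -> 'I_(2 * n).+1}) : d.-tuple int :=
  [tuple (u j)%:Z - n%:Z | j < d].

Lemma cubek_inj n : injective (@cubek n).
Proof.
move=> u v uv; apply/ffunP => j; apply: val_inj => /=.
have := congr1 (fun k => tnth k j) uv; rewrite !tnth_mktuple => /(addIr _).
by case.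
Qed.

Lemma cubek_le n u j : (`|tnth (@cubek n u) j| <= n)%N.
Proof. by rewrite tnth_mktuple; case: (u j) => a an /=; lia. Qed.

Definition trig n f := exists c, f = tpoly (@cubek n) c.

Lemma trig0 n : trig n (fun=> 0).
Proof.
by exists (fun=> 0); apply/funext => x; rewrite /tpoly big1// => i _; rewrite mul0r.
Qed.

Lemma trigD n f g : trig n f -> trig n g -> trig n (fun x => f x + g x).
Proof.
move=> [c ->] [c' ->]; exists (fun i => c i + c' i); apply/funext => x.
by rewrite /tpoly -big_split/=; apply: eq_bigr => i _; rewrite mulrDl.
Qed.

Lemma trigZ n (a : R[i]) f : trig n f -> trig n (fun x => a * f x).
Proof. by move=> [c ->]; exists (fun i => a * c i); rewrite tpolyZ. Qed.

Lemma trig_sum n (I : Type) (s : seq I) (f : I -> Rn R d -> R[i]) :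
  (forall i, trig n (f i)) -> trig n (fun x => \sum_(i <- s) f i x).
Proof.
move=> tf; elim: s => [|i s IHs].
  by under eq_fun do rewrite big_nil; exact: trig0.
by under eq_fun do rewrite big_cons; exact: trigD.
Qed.

Lemma cubek_surj n (k : d.-tuple int) : (forall j, `|tnth k j| <= n)%N ->
  exists u, @cubek n u = k.
Proof.
move=> kn.
have lt_u j : (`|(tnth k j + n%:Z)%R| < (2 * n).+1)%N by have := kn j; lia.
exists [ffun j => Ordinal (lt_u j)].
apply: eq_from_tnth => j; rewrite tnth_mktuple ffunE/=.
by have := kn j; lia.
Qed.

Lemma trig_expi n (k : d.-tuple int) : (forall j, `|tnth k j| <= n)%N ->
  trig n (fun x => expi (dotp k x)).
Proof.
move=> /cubek_surj[u uk]; exists (fun v => (v == u)%:R); apply/funext => x.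
rewrite /tpoly (bigD1 u)//= eqxx mul1r uk big1 ?addr0// => v /negbTE ->.
by rewrite mul0r.
Qed.

Lemma trig_tpoly n (I : finType) (kappa : I -> d.-tuple int) c :
  (forall i j, `|tnth (kappa i) j| <= n)%N -> trig n (tpoly kappa c).
Proof. by move=> kn; apply: trig_sum => i; apply: trigZ; exact: trig_expi. Qed.

Lemma trig_le m n f : (m <= n)%N -> trig m f -> trig n f.
Proof.
by move=> mn [c ->]; apply: trig_tpoly => u j; exact: leq_trans (cubek_le _ _) mn.
Qed.

Lemma trigM m n f g : trig m f -> trig n g -> trig (m + n) (fun x => f x * g x).
Proof.
move=> [c ->] [c' ->].
rewrite (_ : (fun _ => _) = fun x => \sum_i \sum_j
    (c i * c' j) * expi (dotp (tadd (cubek i) (cubek j)) x)); last first.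
  apply/funext => x; rewrite /tpoly mulr_suml; apply: eq_bigr => i _.
  rewrite mulr_sumr; apply: eq_bigr => j _.
  by rewrite dotp_tadd expiD mulrACA.
apply: trig_sum => i; apply: trig_sum => j; apply: trigZ; apply: trig_expi => l.
by rewrite tnth_mktuple; have := cubek_le i l; have := cubek_le j l; lia.
Qed.

Lemma trig1 n : trig n (fun=> 1).
Proof.
have := @trig_expi n [tuple 0 | j < d].
rewrite (_ : (fun _ => _) = fun=> 1); first by apply => j; rewrite tnth_mktuple.
apply/funext => x; rewrite /dotp big1 ?expi0// => j _.
by rewrite tnth_mktuple mul0r.
Qed.

Lemma trigX n r f : trig n f -> trig (r * n) (fun x => f x ^+ r).
Proof.
move=> tf; elim: r => [|r IHr].
  by under eq_fun do rewrite expr0; exact: trig1.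
by under eq_fun do rewrite exprS; rewrite mulSn; exact: trigM.
Qed.

Lemma normcX (z : R[i]) r : Normc.normc (z ^+ r) = Normc.normc z ^+ r.
Proof.
elim: r => [|r IHr]; first by rewrite !expr0 Normc.normc1.
by rewrite !exprS Normc.normcM IHr.
Qed.

(* The power [f ^+ r] has its spectrum in a cube of side [2 * r * n + 1], and
   its L_2 norm is a power of the L_2r norm of [f]. *)
Lemma trig_sup_pow n r (B : R) f x : trig n f -> 0 <= B ->
  bnd (2 * r)%:R B f ->
  Normc.normc (f x) ^+ r <= Num.sqrt ((2 * (r * n)).+1 ^ d)%:R * B ^+ r.
Proof.
move=> tf B0 fB; have [c fr] := trigX r tf.
rewrite -normcX (congr1 (@^~ x) fr : f x ^+ r = _).
apply: tpoly_sup; first exact: exprn_ge0.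
  by rewrite card_ffun !card_ord.
rewrite -(parseval c (@cubek_inj _)) -fr.
move: fB; rewrite /bnd powR_mulrn// mulnC exprM.
apply: le_trans; rewrite le_eqVlt; apply/orP; left; apply/eqP.
by apply: eq_Rintegral => y _; rewrite normcX powR_mulrn ?normc_ge0// exprM.
Qed.

Lemma leq_exp2r_weak a b e : (a <= b -> a ^ e <= b ^ e)%N.
Proof. by case: e => // e ab; rewrite leq_exp2r. Qed.

(** In [trig_sup_pow] with r = l + 1, the cube has at most 16^((l + 1) d) frequencies; the square
    root and then the root of order l + 1 leave 4^d, independent of [l]. *)
Lemma trig_sup l (B : R) f x : trig (2 ^ l) f -> 0 <= B ->
  bnd (2 * l.+1)%:R B f -> Normc.normc (f x) <= 4 ^+ d * B.
Proof.
move=> tf B0 /(trig_sup_pow x tf B0) h.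
have C0 : 0 <= 4 ^+ d * B by rewrite mulr_ge0 ?exprn_ge0.
rewrite -(@ler_pXn2r _ l.+1) ?nnegrE ?normc_ge0//.
apply: (le_trans h); rewrite exprMn ler_wpM2r ?exprn_ge0//.
rewrite -[leRHS]ger0_norm ?exprn_ge0// -sqrtr_sqr; apply: ler_wsqrtr.
have le16 : ((2 * (l.+1 * 2 ^ l)).+1 <= 16 ^ l.+1)%N.
  have l2 : (l.+1 * 2 ^ l <= 4 ^ l)%N.
    by rewrite (expnMn 2 2) leq_mul2r ltn_expl// orbT.
  have l4 : (4 ^ l <= 16 ^ l)%N by rewrite leq_exp2r_weak.
  have : (0 < 16 ^ l)%N by rewrite expn_gt0.
  by rewrite (expnS 16); lia.
apply: (@le_trans _ _ ((16 ^ l.+1) ^ d)%:R); first by rewrite ler_nat leq_exp2r_weak.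
rewrite !natrX -!exprM (_ : 16 = 4 ^+ 2 :> R); last by ring.
by rewrite -exprM (_ : (2 * (l.+1 * d) = d * (l.+1 * 2))%N)//; lia.
Qed.

End cube_spectrum.

Section complex_integral.
Context {R : realType} (d : nat).
Implicit Types (f g h : Rn R d -> R[i]).
Local Notation mu := (torus_measure R d).

Definition cint f := mu.-integrable setT (EFin \o (fun x => complex.Re (f x))) /\
  mu.-integrable setT (EFin \o (fun x => complex.Im (f x))).

Lemma bmeas_bounded (b : Rn R d -> R) : bmeas b -> [bounded b x | x in setT].
Proof.
move=> [_ [M bM]]; exists (M : R); split; first exact: num_real.
by move=> y My x _; exact: (le_trans (bM x) (ltW My)).
Qed.

Lemma integrable_mul_bmeas (a b : Rn R d -> R) : mu.-integrable setT (EFin \o a) ->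
  bmeas b -> mu.-integrable setT (EFin \o (fun x => a x * b x)).
Proof.
move=> ia bb; have [mb _] := bb.
have := integrableMl measurableT ia mb (bmeas_bounded bb).
by apply: eq_integrable => // x _ /=; rewrite EFinM.
Qed.

Lemma integrable_add (a b : Rn R d -> R) : mu.-integrable setT (EFin \o a) ->
  mu.-integrable setT (EFin \o b) -> mu.-integrable setT (EFin \o (fun x => a x + b x)).
Proof.
move=> ia ib; have := integrableD measurableT ia ib.
by apply: eq_integrable => // x _ /=; rewrite EFinD.
Qed.

Lemma integrable_sub (a b : Rn R d -> R) : mu.-integrable setT (EFin \o a) ->
  mu.-integrable setT (EFin \o b) -> mu.-integrable setT (EFin \o (fun x => a x - b x)).
Proof.
move=> ia ib; have := integrableB measurableT ia ib.
by apply: eq_integrable => // x _ /=; rewrite EFinB.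
Qed.

Lemma cbmeas_cint f : cbmeas f -> cint f.
Proof. by move=> [fr fi]; split; exact: bmeas_integrable. Qed.

Lemma Re_mulc (z w : R[i]) : complex.Re (z * w) =
  complex.Re z * complex.Re w - complex.Im z * complex.Im w.
Proof. by case: z w => [? ?] [? ?]. Qed.

Lemma Im_mulc (z w : R[i]) : complex.Im (z * w) =
  complex.Re z * complex.Im w + complex.Im z * complex.Re w.
Proof. by case: z w => [? ?] [? ?]. Qed.

Lemma cint_mul_cbmeas f g : cint f -> cbmeas g -> cint (fun x => f x * g x).
Proof.
move=> [fr fi] [gr gi]; split.
  under [X in EFin \o X]eq_fun do rewrite Re_mulc.
  by apply: integrable_sub; exact: integrable_mul_bmeas.
under [X in EFin \o X]eq_fun do rewrite Im_mulc.
by apply: integrable_add; exact: integrable_mul_bmeas.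
Qed.

Lemma cintD f g : cint f -> cint g -> cint (fun x => f x + g x).
Proof.
move=> [fr fi] [gr gi]; split.
  by under [X in EFin \o X]eq_fun do rewrite raddfD/=; exact: integrable_add.
by under [X in EFin \o X]eq_fun do rewrite raddfD/=; exact: integrable_add.
Qed.

Lemma cintB f g : cint f -> cint g -> cint (fun x => f x - g x).
Proof.
move=> [fr fi] [gr gi]; split.
  by under [X in EFin \o X]eq_fun do rewrite raddfB/=; exact: integrable_sub.
by under [X in EFin \o X]eq_fun do rewrite raddfB/=; exact: integrable_sub.
Qed.

Lemma torus_integralD f g : cint f -> cint g ->
  torus_integral (fun x => f x + g x) = torus_integral f + torus_integral g.
Proof.
move=> [fr fi] [gr gi]; rewrite /torus_integral.
under eq_Rintegral do rewrite raddfD/=.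
under [X in (_ +i* X)%C = _]eq_Rintegral do rewrite raddfD/=.
by rewrite !RintegralD.
Qed.

Lemma torus_integralB f g : cint f -> cint g ->
  torus_integral (fun x => f x - g x) = torus_integral f - torus_integral g.
Proof.
move=> [fr fi] [gr gi]; rewrite /torus_integral.
under eq_Rintegral do rewrite raddfB/=.
under [X in (_ +i* X)%C = _]eq_Rintegral do rewrite raddfB/=.
by rewrite !RintegralB.
Qed.

Lemma integrable_mulr (a : Rn R d -> R) (c : R) : mu.-integrable setT (EFin \o a) ->
  mu.-integrable setT (EFin \o (fun x => c * a x)).
Proof.
move=> ia; have := integrable_mul_bmeas ia (bmeas_cst _ c).
by apply: eq_integrable => // x _ /=; rewrite mulrC.
Qed.

Lemma torus_integralZ c f : cint f ->
  torus_integral (fun x => c * f x) = c * torus_integral f.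
Proof.
move=> [fr fi]; rewrite /torus_integral.
under eq_Rintegral do rewrite Re_mulc.
under [X in (_ +i* X)%C = _]eq_Rintegral do rewrite Im_mulc.
rewrite RintegralB ?RintegralD ?RintegralZl//; try exact: integrable_mulr.
by apply/eqP; rewrite eq_complex/= Re_mulc Im_mulc/= !eqxx.
Qed.

Lemma torus_integral0 : torus_integral (fun _ : Rn R d => 0) = 0.
Proof. by rewrite /torus_integral !(Rintegral_prob_cst mu). Qed.

Lemma torus_integral_sum (I : Type) (s : seq I) (f : I -> Rn R d -> R[i]) :
  (forall i, cint (f i)) ->
  cint (fun x => \sum_(i <- s) f i x) /\
  torus_integral (fun x => \sum_(i <- s) f i x) = \sum_(i <- s) torus_integral (f i).
Proof.
move=> cf; elim: s => [|i s [IH1 IH2]].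
  rewrite big_nil; under eq_fun do rewrite big_nil.
  by split; [exact/cbmeas_cint/cbmeas_cst|exact: torus_integral0].
rewrite big_cons -IH2 -torus_integralD//.
by under eq_fun do rewrite big_cons; split => //; exact: cintD.
Qed.

Definition tneg (k : d.-tuple int) : d.-tuple int := [tuple - tnth k j | j < d].

Lemma dotp_tneg k (x : Rn R d) : dotp (tneg k) x = - dotp k x.
Proof.
rewrite /dotp -sumrN; apply: eq_bigr => j _.
by rewrite tnth_mktuple mulrNz mulNr.
Qed.

Lemma trig_orthogonal h n g : cint h -> (forall k, fourier_coef h k = 0) ->
  trig n g -> torus_integral (fun x => h x * g x) = 0.
Proof.
move=> ih h0 [c ->].
have ie k : cint (fun x => h x * expi (dotp k x)).
  by apply: cint_mul_cbmeas => //; exact: cbmeas_expi.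
rewrite (_ : (fun _ => _) = fun x => \sum_i c i * (h x * expi (dotp (cubek i) x))); last first.
  apply/funext => x; rewrite /tpoly mulr_sumr; apply: eq_bigr => i _.
  by rewrite mulrCA.
have ic i : cint (fun x => c i * (h x * expi (dotp (cubek i) x))).
  under eq_fun do rewrite mulrC.
  by apply: cint_mul_cbmeas => //; exact: cbmeas_cst.
rewrite (torus_integral_sum _ ic).2 big1// => i _; rewrite torus_integralZ//.
rewrite [X in _ * X](_ : _ = fourier_coef h (tneg (cubek i))); first by rewrite h0 mulr0.
by congr torus_integral; apply/funext => x; rewrite dotp_tneg opprK.
Qed.

Lemma trig_cbmeas n g : trig n g -> cbmeas g.
Proof. by move=> [c ->]; exact: cbmeas_tpoly. Qed.

End complex_integral.

(** * Uniqueness: from trigonometric polynomials to Borel sets *)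

Section real_trig.
Context {R : realType} (d : nat).
Implicit Types phi : Rn R d -> R.

Definition rtrig phi := exists n, trig n (fun x => ((phi x)%:C)%C).

Lemma rtrig_cst (a : R) : rtrig (fun=> a).
Proof.
exists 0%N; have := trigZ (a%:C)%C (@trig1 R d 0).
by under eq_fun do rewrite mulr1.
Qed.

Lemma rtrigD phi psi : rtrig phi -> rtrig psi -> rtrig (fun x => phi x + psi x).
Proof.
move=> [m tm] [n tn]; exists (m + n)%N; under eq_fun do rewrite rmorphD/=.
apply: trigD; [exact: (trig_le (leq_addr _ _) tm)|exact: (trig_le (leq_addl _ _) tn)].
Qed.

Lemma rtrigM phi psi : rtrig phi -> rtrig psi -> rtrig (fun x => phi x * psi x).
Proof.
by move=> [m tm] [n tn]; exists (m + n)%N; under eq_fun do rewrite rmorphM/=; exact: trigM.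
Qed.

Lemma rtrigB phi psi : rtrig phi -> rtrig psi -> rtrig (fun x => phi x - psi x).
Proof.
move=> tp ts; under eq_fun do rewrite -[- _]mulN1r.
by apply: rtrigD => //; apply: rtrigM => //; exact: rtrig_cst.
Qed.

Lemma rtrigX phi n : rtrig phi -> rtrig (fun x => phi x ^+ n).
Proof.
move=> tp; elim: n => [|n IHn].
  by under eq_fun do rewrite expr0; exact: rtrig_cst.
by under eq_fun do rewrite exprS; exact: rtrigM.
Qed.

Lemma rtrig_bmeas phi : rtrig phi -> bmeas phi.
Proof. by move=> [n /trig_cbmeas[]]. Qed.

Definition tunit (j : 'I_d) : d.-tuple int := [tuple (i == j)%:R | i < d].

Lemma dotp_tunit j (x : Rn R d) : dotp (tunit j) x = tnth x j.
Proof.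
rewrite /dotp (bigD1 j)//= tnth_mktuple eqxx mul1r big1 ?addr0// => i /negbTE ij.
by rewrite tnth_mktuple ij mul0r.
Qed.

Lemma trig_tunit j (e : bool) : trig 1 (fun x : Rn R d => expi ((-1) ^+ e * tnth x j)).
Proof.
case: e; rewrite ?expr1 ?expr0; under eq_fun do rewrite ?mulN1r ?mul1r -dotp_tunit.
  under eq_fun do rewrite -dotp_tneg.
  by apply: trig_expi => i; rewrite !tnth_mktuple; case: (i == j).
by apply: trig_expi => i; rewrite tnth_mktuple; case: (i == j).
Qed.

Lemma rtrig_cos j : rtrig (fun x => cos (tnth x j)).
Proof.
exists 1%N; have := trigZ ((1 / 2)%:C)%C (trigD (trig_tunit j false) (trig_tunit j true)).
congr trig; apply/funext => x; rewrite expr1 expr0 mulN1r !mul1r /expi cosN sinN.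
by apply/eqP; rewrite eq_complex/=; apply/andP; split; apply/eqP; field.
Qed.

Lemma rtrig_sin j : rtrig (fun x => sin (tnth x j)).
Proof.
exists 1%N; have := trigZ (0 -i* (1 / 2))%C (trigD (trig_tunit j false)
  (trigZ (-1) (trig_tunit j true))).
congr trig; apply/funext => x; rewrite expr1 expr0 !mulN1r !mul1r /expi cosN sinN.
by apply/eqP; rewrite eq_complex/=; apply/andP; split; apply/eqP; field.
Qed.

End real_trig.

Section step_polynomials.
Context {R : realType}.
Implicit Types u : R.

(* Polynomials with values in [0, 1] on [0, 1] that converge to the indicator
   of u < 1/2 on that interval (a device of Brosowski and Deutsch). *)
Definition stepp n u : R := (1 - u ^+ n.+1) ^+ (n.+1 * 2 ^ n.+1).

Lemma stepp_ge0_le1 n u : 0 <= u <= 1 -> 0 <= stepp n u <= 1.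
Proof.
move=> /andP[u0 u1]; have v0 : 0 <= u ^+ n.+1 by exact: exprn_ge0.
have v1 : u ^+ n.+1 <= 1 by rewrite exprn_ile1.
by rewrite exprn_ge0 ?exprn_ile1//; lra.
Qed.

Lemma bernoulli_le m (v : R) : 0 <= v <= 1 -> 1 - m%:R * v <= (1 - v) ^+ m.
Proof.
move=> /andP[v0 v1]; elim: m => [|m IHm]; first by rewrite mul0r subr0.
rewrite exprS -natr1; have h : 0 <= 1 - v by lra.
apply: (@le_trans _ _ ((1 - v) * (1 - m%:R * v))); last by rewrite ler_wpM2l.
have : 0 <= m%:R * v ^+ 2 by rewrite mulr_ge0// sqr_ge0.
by lra.
Qed.

(** Bernoulli's inequality leaves the error (n + 1) (2u)^(n + 1), and y^2 <= 2 exp y bounds it by a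
    multiple of 1 / (n + 1). *)
Lemma cvg_stepp_lt u : 0 <= u < 1 / 2 -> stepp n u @[n --> \oo] --> (1 : R).
Proof.
move=> /andP[u0 u12].
have [c c0 hc] : exists2 c : R, 0 < c & forall n, n.+1%:R * (2 * u) ^+ n.+1 <= c * harmonic n.
  have [->|un0] := eqVneq u 0.
    exists 1 => // n; rewrite mulr0 expr0n/= mulr0 mul1r /harmonic invr_ge0 ler0n//.
  have u0' : 0 < 2 * u by rewrite mulr_gt0// lt0r un0.
  pose b := - ln (2 * u).
  have b0 : 0 < b by rewrite oppr_gt0 ln_lt0// u0'/=; lra.
  exists (2 / b ^+ 2) => [|n]; first by rewrite divr_gt0 ?exprn_gt0.
  have nb0 : 0 <= n.+1%:R * b by rewrite mulr_ge0// ltW.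
  have := exprn_le_fact_expR 2 nb0.
  have -> : expR (n.+1%:R * b) = ((2 * u) ^+ n.+1)^-1.
    by rewrite /b mulrN expRN expRM_natl lnK.
  rewrite ler_pdivlMr ?exprn_gt0// => h.
  rewrite /harmonic -ler_pdivrMl ?divr_gt0 ?exprn_gt0//.
  rewrite -(@ler_pM2r _ n.+1%:R) ?ltr0n// mulVf ?pnatr_eq0//.
  rewrite (_ : 2`! = 2)%N// in h.
  have -> : (2 / b ^+ 2)^-1 * (n.+1%:R * (2 * u) ^+ n.+1) * n.+1%:R =
    (n.+1%:R * b) ^+ 2 * (2 * u) ^+ n.+1 / 2 by field; rewrite gt_eqF.
  lra.
apply: (@squeeze_cvgr _ _ _ _ (fun n => 1 - c * harmonic n) (fun=> 1)); last 2 first.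
- rewrite -[X in _ --> X]subr0; apply: cvgB; first exact: cvg_cst.
  rewrite -[X in _ --> X](mulr0 c); apply: cvgM; first exact: cvg_cst.
  exact: cvg_harmonic.
- exact: cvg_cst.
apply: nearW => n; have u01 : 0 <= u <= 1 by rewrite u0/=; lra.
have /andP[_ ->] := stepp_ge0_le1 n u01; rewrite andbT.
have v01 : 0 <= u ^+ n.+1 <= 1 by have /andP[? ?] := u01; rewrite exprn_ge0 ?exprn_ile1.
apply: le_trans (bernoulli_le _ v01); rewrite lerD2l lerN2.
by apply: le_trans (hc n); rewrite natrM natrX -mulrA -exprMn.
Qed.

(** The factor n + 1 in the exponent of [stepp] handles u = 1/2 as well: 1 - v <= exp(- v) gives the
    bound exp(- (n + 1)). *)
Lemma cvg_stepp_ge u : 1 / 2 <= u <= 1 -> stepp n u @[n --> \oo] --> (0 : R).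
Proof.
move=> /andP[u12 u1]; have u01 : 0 <= u <= 1 by rewrite u1 andbT; lra.
apply: (@squeeze_cvgr _ _ _ _ (fun=> 0) harmonic); last 2 first.
- exact: cvg_cst.
- exact: cvg_harmonic.
apply: nearW => n; have /andP[-> _] /= := stepp_ge0_le1 n u01.
set v := (1 / 2) ^+ n.+1 : R.
have v0 : 0 < v by rewrite exprn_gt0.
have v1 : v <= 1 by rewrite exprn_ile1//; lra.
have vu : v <= u ^+ n.+1 by rewrite lerXn2r ?nnegrE//; lra.
have un1 : u ^+ n.+1 <= 1 by rewrite exprn_ile1//; lra.
apply: (@le_trans _ _ (expR (- v) ^+ (n.+1 * 2 ^ n.+1))).
  apply: lerXn2r; rewrite ?nnegrE ?expR_ge0//; first by lra.
  by apply: (@le_trans _ _ (1 - v)); [lra|exact: expR_ge1Dx].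
rewrite -expRM_natl mulrN natrM natrX -mulrA /v -exprMn.
have -> : 2 * (1 / 2) = 1 :> R by field.
rewrite expr1n mulr1 expRN /harmonic lef_pV2 ?posrE ?expR_gt0 ?ltr0n//.
by have := expR_ge1Dx (n.+1%:R : R); lra.
Qed.

End step_polynomials.

Section marginals.
Context {R : realType}.

Lemma circle_measure_itvC : circle_measure R (~` `[0, 2 * pi[%classic) = 0%E.
Proof.
rewrite /circle_measure/= /uniform_prob integral_uniform_pdf.
rewrite (_ : _ `&` _ = [set 2 * pi]) ?integral_set1//.
apply/seteqP; split=> x /=; rewrite !in_itv/=.
  by move=> [/negP h /andP[x0 x1]]; move: h; rewrite x0/= -leNgt => ?; apply/eqP; rewrite eq_le x1.
move=> ->; rewrite ltxx andbF lexx andbT (ltW (two_pi_gt0 R)).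
by split=> //; exact/negP.
Qed.

Lemma torus_marginal d (j : 'I_d) (B : set R) : measurable B ->
  torus_measure R d [set x | B (tnth x j)] = circle_measure R B.
Proof.
move=> mB; elim: d j => [[]//|d IHd] j.
rewrite /= /distribution /pushforward.
have [->|j0] := eqVneq j ord0.
  rewrite (_ : _ @^-1` _ = B `*` setT).
    by rewrite product_measure1E//= probability_setT mule1.
  by apply/seteqP; split=> [[u x]|[u x]] /=; rewrite (tnth_nth 0)//= => -[].
have jd : (j.-1 < d)%N by case: j j0 => [[|j] jd].
rewrite (_ : _ @^-1` _ = setT `*` [set x | B (tnth x (Ordinal jd))]).
  rewrite product_measure1E//.
    transitivity (1 * circle_measure R B)%E; last by rewrite mul1e.
    by congr (_ * _)%E; [exact: probability_setT|exact: IHd].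
  rewrite -[X in measurable X]setTI; exact: measurable_tnth.
have E u x : tnth (cons_pair (u, x)) j = tnth x (Ordinal jd).
  by rewrite !(tnth_nth 0)/=; case: j j0 jd => [[|j] jd'].
by apply/seteqP; split=> [[u x]|[u x]] /=; rewrite E// => -[].
Qed.

End marginals.

Section uniqueness.
Context {R : realType} (d : nat).
Local Notation mu := (torus_measure R d).
Local Notation T := (Rn R d).

(* A pi-system generating the Borel sets of [0, 2 pi[^d: an integrable function
   orthogonal to all trigonometric polynomials has integral 0 over its members,
   by dominated convergence. *)
Definition trig_limit : set (set T) := [set A | exists phi : nat -> T -> R,
  [/\ forall n, rtrig (phi n), forall n x, 0 <= phi n x <= 1 &
      forall x, phi n x @[n --> \oo] --> (\1_A x : R)]].

Lemma trig_limitI : setI_closed trig_limit.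
Proof.
move=> A B [phi [tphi phi01 cphi]] [psi [tpsi psi01 cpsi]].
exists (fun n x => phi n x * psi n x); split.
- by move=> n; exact: rtrigM.
- move=> n x; have /andP[p0 p1] := phi01 n x; have /andP[s0 s1] := psi01 n x.
  by rewrite mulr_ge0//= mulr_ile1.
- by move=> x; rewrite indicI; apply: cvgM; [exact: cphi|exact: cpsi].
Qed.

Lemma trig_limit_half (phi : T -> R) : rtrig phi -> (forall x, 0 <= phi x <= 1) ->
  trig_limit [set x | phi x < 1 / 2].
Proof.
move=> tphi phi01; exists (fun n x => stepp n (phi x)); split.
- move=> n; apply: rtrigX; apply: rtrigB; [exact: rtrig_cst|exact: rtrigX].
- by move=> n x; exact: stepp_ge0_le1.
- move=> x; rewrite indicE; have /andP[p0 p1] := phi01 x.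
  have [xh|xh] := ltP (phi x) (1 / 2).
    by rewrite mem_set//; apply: cvg_stepp_lt; rewrite p0.
  rewrite memNset; first by apply: cvg_stepp_ge; rewrite xh.
  by apply/negP; rewrite -leNgt.
Qed.

Local Notation S := (@measurable _ (g_sigma_algebraType trig_limit)).

Let sC (A : set T) : S A -> S (~` A).
Proof. exact: (@measurableC _ (g_sigma_algebraType trig_limit)). Qed.

Let sI (A B : set T) : S A -> S B -> S (A `&` B).
Proof. exact: (@measurableI _ (g_sigma_algebraType trig_limit)). Qed.

Let s_cos_gt j (s : R) : -1 <= s <= 1 -> S [set x | s < cos (tnth x j)].
Proof.
move=> /andP[s1 s2]; apply: sub_sigma_algebra.
(* An affine change puts the values in [0, 1] and the threshold at 1/2. *)
rewrite (_ : [set x | _] = [set x : T | 1 / 2 + (s - cos (tnth x j)) / 4 < 1 / 2]).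
  apply: trig_limit_half.
    apply: rtrigD; first exact: rtrig_cst.
    apply: rtrigM; last exact: rtrig_cst.
    by apply: rtrigB; [exact: rtrig_cst|exact: rtrig_cos].
  by move=> x; have := cos_le1 (tnth x j); have := cos_geN1 (tnth x j); lra.
by apply/seteqP; split=> x /=; lra.
Qed.

Let s_cos_ge j (s : R) : -1 <= s <= 1 -> S [set x | s <= cos (tnth x j)].
Proof.
move=> /andP[s1 s2].
rewrite (_ : [set x | _] = ~` [set x : T | 1 / 2 + (cos (tnth x j) - s) / 4 < 1 / 2]).
  apply: sC; apply: sub_sigma_algebra; apply: trig_limit_half.
    apply: rtrigD; first exact: rtrig_cst.
    apply: rtrigM; last exact: rtrig_cst.
    by apply: rtrigB; [exact: rtrig_cos|exact: rtrig_cst].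
  by move=> x; have := cos_le1 (tnth x j); have := cos_geN1 (tnth x j); lra.
by apply/seteqP; split=> x /=; rewrite -?leNgt => ?; try (apply/negP; rewrite -leNgt); lra.
Qed.

Let s_sin_lt0 j : S [set x | sin (tnth x j) < 0].
Proof.
apply: sub_sigma_algebra.
rewrite (_ : [set x | _] = [set x : T | 1 / 2 + sin (tnth x j) / 4 < 1 / 2]).
  apply: trig_limit_half.
    apply: rtrigD; first exact: rtrig_cst.
    by apply: rtrigM; [exact: rtrig_sin|exact: rtrig_cst].
  by move=> x; have := sin_le1 (tnth x j); have := sin_geN1 (tnth x j); lra.
by apply/seteqP; split=> x /=; lra.
Qed.

(** The members of [trig_limit] are periodic, so they cannot generate the Borel sets of the whole
    space. Reduction modulo 2 pi is measurable for the sigma-algebra they do generate, and it is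
    almost everywhere the identity, since the measure is carried by the cube. *)
Definition wrap2pi (t : R) : R := t - (Num.floor (t / (2 * pi)))%:~R * (2 * pi).

Lemma wrap_itv t : 0 <= wrap2pi t < 2 * pi.
Proof.
have p0 := two_pi_gt0 R; rewrite /wrap2pi.
have := floor_itv (t / (2 * pi)) => /andP[h1 h2].
rewrite ler_pdivlMr// in h1; rewrite ltr_pdivrMr// intrD mulrDl mul1r in h2.
by apply/andP; split; lra.
Qed.

Lemma wrap_id t : 0 <= t < 2 * pi -> wrap2pi t = t.
Proof.
move=> /andP[t0 t1]; rewrite /wrap2pi (_ : Num.floor _ = 0) ?mul0r ?subr0//.
apply: floor_def; rewrite add0r divr_ge0 ?(ltW (two_pi_gt0 R))//=.
by rewrite ltr_pdivrMr ?two_pi_gt0// mul1r.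
Qed.

Lemma cos_wrap_sin_wrap t : cos (wrap2pi t) = cos t /\ sin (wrap2pi t) = sin t.
Proof.
rewrite /wrap2pi; set k := Num.floor _.
have [kE|kE] : k = `|k|%:Z \/ k = - `|k|%:Z by case: (k); lia.
  rewrite kE -pmulrn cosB sinB cos_nat_2pi sin_nat_2pi; lra.
rewrite kE mulrNz -pmulrn mulNr opprK cosD sinD cos_nat_2pi sin_nat_2pi; lra.
Qed.

Lemma wrap_ltE (s y : R) : 0 <= y < 2 * pi -> 0 < s -> s < 2 * pi ->
  (y < s) = if s <= pi then (0 <= sin y) && (cos s < cos y)
            else ~~ ((sin y < 0) && (cos s <= cos y)).
Proof.
move=> /andP[y0 y2] s0' s2; have p0 := pi_gt0 R.
have sin_gtpi (z : R) : pi < z < 2 * pi -> sin z < 0.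
  move=> /andP[z1 z2]; rewrite -(subrK pi z) sinDpi oppr_lt0.
  by apply: sin_gt0_pi; lra.
have cos_refl (z : R) : cos z = cos (2 * pi - z).
  rewrite cosB -[2 * pi]mul1r (cos_nat_2pi 1) (sin_nat_2pi 1); lra.
have [sp|sp] := leP s pi.
  apply/idP/idP => [ys|/andP[sy cy]].
    rewrite sin_ge0_pi ?y0/=; last by lra.
    by rewrite ltr_cos ?in_itv//=; lra.
  have yp : y <= pi.
    by rewrite leNgt; apply/negP => yp; have := sin_gtpi y; rewrite yp y2 => /(_ isT); lra.
  by rewrite ltr_cos ?in_itv//= in cy; lra.
rewrite ltNge; congr (~~ _); apply/idP/idP => [sy|/andP[sy cy]].
  rewrite sin_gtpi ?y2 ?andbT/=; last by lra.
  by rewrite (cos_refl s) (cos_refl y) leNgt ltr_cos ?in_itv//=; lra.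
have yp : pi < y.
  rewrite ltNge; apply/negP => yp; have := @sin_ge0_pi R y; rewrite yp y0 => /(_ isT); lra.
by rewrite (cos_refl s) (cos_refl y) leNgt ltr_cos ?in_itv//= in cy; lra.
Qed.

Let s_wrap_lt j (s : R) : S [set x | wrap2pi (tnth x j) < s].
Proof.
have [s0'|s0'] := leP s 0.
  rewrite (_ : [set x | _] = set0); first exact: (@measurable0 _ (g_sigma_algebraType trig_limit)).
  by apply/seteqP; split=> x //=; have := wrap_itv (tnth x j); lra.
have [s2|s2] := leP (2 * pi) s.
  rewrite (_ : [set x | _] = setT).
    exact: (@measurableT _ (g_sigma_algebraType trig_limit)).
  by apply/seteqP; split=> x //= _; have := wrap_itv (tnth x j); lra.
have cs : -1 <= cos s <= 1 by rewrite cos_geN1 cos_le1.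
have E x : (wrap2pi (tnth x j) < s) = if s <= pi
    then (0 <= sin (tnth x j)) && (cos s < cos (tnth x j))
    else ~~ ((sin (tnth x j) < 0) && (cos s <= cos (tnth x j))).
  by rewrite (wrap_ltE (wrap_itv _))//; have [-> ->] := cos_wrap_sin_wrap (tnth x j).
have [sp|sp] := leP s pi.
  rewrite (_ : [set x | _] = ~` [set x | sin (tnth x j) < 0] `&`
      [set x | cos s < cos (tnth x j)]).
    by apply: sI; [exact: sC|exact: s_cos_gt].
  apply/seteqP; split=> x /=; rewrite E sp.
    by move=> /andP[h1 h2]; split=> //; apply/negP; rewrite -leNgt.
  by move=> [/negP]; rewrite -leNgt => -> ->.
rewrite (_ : [set x | _] = ~` ([set x | sin (tnth x j) < 0] `&`
    [set x | cos s <= cos (tnth x j)])).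
  by apply: sC; apply: sI; [exact: s_sin_lt0|exact: s_cos_ge].
have spF : (s <= pi) = false by rewrite leNgt sp.
apply/seteqP; split=> x /=; rewrite E spF.
  by move=> /negP h [h1 h2]; apply: h; rewrite h1.
by move=> h; apply/negP => /andP.
Qed.

Definition twrap (x : T) : T := [tuple wrap2pi (tnth x j) | j < d].

Lemma measurable_twrap : measurable_fun [set: g_sigma_algebraType trig_limit]
  (twrap : g_sigma_algebraType trig_limit -> T).
Proof.
apply/measurable_fun_tnthP => j.
apply: (measurability _ (RGenInftyO.measurableE R)) => /= _ [_ [s ->] <-].
rewrite setTI [X in measurable X](_ : _ = [set x | wrap2pi (tnth x j) < s]).
  exact: s_wrap_lt.
by apply/seteqP; split=> x /=; rewrite in_itv/= tnth_mktuple.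
Qed.

Lemma ae_twrap_id : \forall x \ae mu, twrap x = x.
Proof.
have h : \forall x \ae mu, forall j, 0 <= tnth x j < 2 * pi.
  apply: filter_forall => j; exists [set x | tnth x j \in ~` `[0, 2 * pi[%classic]; split.
  - rewrite (_ : [set x | _] = setT `&` (tnth (T := measurableTypeR R))^~ j @^-1` (~` `[0, 2 * pi[%classic)).
      by apply: measurable_tnth => //; apply: measurableC; exact: measurable_itv.
    by rewrite setTI; apply/seteqP; split=> x; rewrite /= inE.
  - have := @torus_marginal R d j (~` `[0, 2 * pi[%classic).
    rewrite circle_measure_itvC => <-.
      by congr (mu _); apply/seteqP; split=> x; rewrite /= inE.
    by apply: measurableC; exact: measurable_itv.
  - by move=> x /= h; rewrite inE /= in_itv/=.
case: h => N [mN N0 hN]; exists N; split=> // x /= xw; apply: hN => /= xj.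
by apply: xw; apply: eq_from_tnth => j; rewrite tnth_mktuple wrap_id.
Qed.

Section zero.
Context (H : T -> R).
Hypothesis iH : mu.-integrable setT (EFin \o H).
Hypothesis H0 : forall phi, rtrig phi -> \int[mu]_x (H x * phi x) = 0.

Let null : set (set T) := [set A | measurable A /\ (\int[mu]_(x in A) (H x)%:E = 0)%E].

Let H_integrable A : measurable A -> mu.-integrable A (EFin \o H).
Proof. by move=> mA; exact: integrableS iH. Qed.

Let trig_limit_null : trig_limit `<=` null.
Proof.
move=> A [phi [tphi phi01 cphi]].
have mphi n : measurable_fun setT (phi n) by have [] := rtrig_bmeas (tphi n).
have m1 : measurable_fun setT (\1_A : T -> R).
  by apply: (measurable_fun_cvg (h := phi)) => // x _; exact: cphi.
have mA : measurable A.
  rewrite (_ : A = setT `&` (\1_A : T -> R) @^-1` [set 1]).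
    by apply: m1 => //; exact: measurable_set1.
  rewrite setTI; apply/seteqP; split=> x /=; rewrite indicE.
    by move=> Ax; rewrite mem_set.
  by case: (boolP (x \in A)) => [/set_mem//|_] /eqP; rewrite eq_sym oner_eq0.
split=> //.
have mH := measurable_int mu iH.
have mH' : measurable_fun setT H by exact/measurable_EFinP.
have c : (\int[mu]_x (H x * phi n x)%:E @[n --> \oo] --> \int[mu]_x (H x * \1_A x)%:E)%E.
  apply: (@dominated_cvg _ _ _ _ setT measurableT _ _ (fun x => `|H x|%:E)).
  - by move=> n; apply/measurable_EFinP/measurable_funM.
  - move=> x _; apply: cvg_EFin; first exact: nearW.
    by apply: cvgM; [exact: cvg_cst|exact: cphi].
  - by [].
  - by have := integrable_abse iH.
  - move=> n x _; rewrite lee_fin normrM ler_piMr//.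
    by have /andP[p0 p1] := phi01 n x; rewrite ger0_norm.
have z n : (\int[mu]_x (H x * phi n x)%:E = 0)%E.
  have fin := integrable_fin_num measurableT (integrable_mul_bmeas iH (rtrig_bmeas (tphi n))).
  have := fineK fin; rewrite [X in X%:E](H0 (tphi n)) => <-.
  by [].
rewrite integral_mkcond epatch_indic.
move: c; rewrite (_ : (fun n => _) = cst 0%E); last by apply/funext.
move=> /(cvg_unique _ (cvg_cst _)) <-//; exact: ereal_hausdorff.
Qed.

Let null_dynkin : dynkin null.
Proof.
split.
- by apply: trig_limit_null; exists (fun _ _ => 1); split=> [n|n x|x];
    [exact: rtrig_cst|rewrite ler01 lexx|rewrite indicT; exact: cvg_cst].
- move=> A [mA A0]; split; first exact: measurableC.
  have [mT HT] : null setT.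
    by apply: trig_limit_null; exists (fun _ _ => 1); split=> [n|n x|x];
    [exact: rtrig_cst|rewrite ler01 lexx|rewrite indicT; exact: cvg_cst].
  have := @integral_setU_EFin _ _ _ mu A (~` A) H mA (measurableC mA).
  rewrite setUv HT A0 add0e => h; apply/esym; apply: h => //.
  + by apply/measurable_EFinP; exact: (measurable_int mu iH).
  + by rewrite disj_set2E setICr.
- move=> F tF nF; split; first by apply: bigcup_measurable => k _; have [] := nF k.
  rewrite integral_bigcup//; last 2 first.
  + by move=> k; have [] := nF k.
  + by apply: H_integrable; apply: bigcup_measurable => k _; have [] := nF k.
  by rewrite eseries0// => k _ _; have [] := nF k.
Qed.

Let sigma_null : <<s trig_limit >> `<=` null.
Proof.
rewrite -(setI_closed_g_dynkin_g_sigma_algebra trig_limitI).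
by apply: smallest_sub; [exact: null_dynkin|exact: trig_limit_null].
Qed.

(** A Borel set [U] and its preimage under [twrap] differ by a null set, and the preimage belongs to
    the sigma-algebra generated by [trig_limit]. *)
Lemma trig_orthogonal_ae0 : ae_eq mu setT (EFin \o H) (cst 0%E).
Proof.
apply: integral_ae_eq; [exact: measurableT|exact: iH|exact: measurable_cst|].
move=> U _ mU; rewrite [RHS]integral0.
have [mV V0] : null (twrap @^-1` U).
  apply: sigma_null; have := measurable_twrap measurableT mU.
  by rewrite setTI.
rewrite -[RHS]V0 integral_mkcond [RHS]integral_mkcond.
have mH := measurable_int mu iH.
apply: ae_eq_integral => //.
- by apply/(measurable_restrictT _ mU); exact: measurable_funTS.
- by apply/(measurable_restrictT _ mV); exact: measurable_funTS.
have [N [mN N0 hN]] := ae_twrap_id; exists N; split=> // x /= xne; apply: hN => /= xE.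
apply: xne => _.
have e : (x \in twrap @^-1` U) = (x \in U).
  by apply/idP/idP; rewrite !inE /= xE.
by rewrite !patchE e.
Qed.

End zero.

End uniqueness.

(** * Dyadic levels *)

Section dyadic_shells.
Context {d : nat}.
Implicit Types (k : d.-tuple int) (s : d.-tuple nat) (n l : nat).

(** The number of binary digits, that is, the index of the dyadic block of [n]. *)
Definition bits n : nat := if n == 0 then 0 else (trunc_log 2 n).+1.

Lemma bitsE n e : (2 ^ e %/ 2 <= n < 2 ^ e)%N <-> bits n = e.
Proof.
rewrite /bits; have [->|n0] := eqVneq n 0%N.
  case: e => [|e]; first by [].
  rewrite expnS mulKn// leqNgt expn_gt0/=; split => //.
case: e => [|e].
  by rewrite expn0 ltnS leqn0 (negbTE n0) andbF; split.
rewrite expnS mulKn// -expnS; split => [ne|[<-]].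
  by congr S; apply: trunc_log_eq.
by apply: trunc_log_bounds => //; rewrite lt0n.
Qed.

Definition shell k : d.-tuple nat := [tuple bits `|tnth k j|%N | j < d].

Lemma rhoE s k : rho s k <-> shell k = s.
Proof.
split=> [rk|<- j]; last by rewrite tnth_mktuple; exact/bitsE.
by apply: eq_from_tnth => j; rewrite tnth_mktuple; apply/bitsE/rk.
Qed.

(** The frequencies of level [l] as a finite type. The cube of half-side [2 ^ l] contains all of
    them, each s_j being at most [l]. *)
Definition level_index l :=
  {u : {ffun 'I_d -> 'I_(2 * 2 ^ l).+1} | norm1 (shell (cubek u)) == l}.

Definition level_freq l (i : level_index l) : d.-tuple int := cubek (val i).

Lemma level_freq_inj l : injective (@level_freq l).
Proof. by move=> i j /cubek_inj /val_inj. Qed.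

Lemma level_freq_le l (i : level_index l) j : (`|tnth (level_freq i) j| <= 2 ^ l)%N.
Proof. exact: cubek_le. Qed.

Lemma norm1_level_freq l (i : level_index l) : norm1 (shell (level_freq i)) = l.
Proof. exact/eqP/(valP i). Qed.

Lemma level_freq_surj k : exists i : level_index (norm1 (shell k)), level_freq i = k.
Proof.
have k_le j : (`|tnth k j| <= 2 ^ norm1 (shell k))%N.
  have /bitsE/andP[_ /ltnW kj] := erefl (bits `|tnth k j|).
  rewrite (leq_trans kj)// leq_exp2l// /norm1 (bigD1 j)//= tnth_mktuple leq_addr//.
have [u uk] := cubek_surj k_le.
by unshelve eexists (exist _ u _); rewrite //= uk.
Qed.

Lemma card_bits n e :
  (#|[pred v : 'I_(2 * n).+1 | bits `|v%:Z - n%:Z|%N == e]| <= 2 ^ e)%N.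
Proof.
(* In a block with e > 0, nonnegative numbers keep their value, at least 2^(e - 1), and negative
   ones are shifted below 2^(e - 1), so the codes do not collide. *)
pose code (v : 'I_(2 * n).+1) : nat := let z := (v%:Z - n%:Z)%R in
  if (0 <= z)%R then `|z|%N else (`|z| - 2 ^ e %/ 2)%N.
have lt_code (v : 'I_(2 * n).+1) : bits `|v%:Z - n%:Z|%N == e -> (code v < (2 ^ e).-1.+1)%N.
  move=> /eqP/bitsE; rewrite prednK ?expn_gt0// /code; case: ifP => _; lia.
rewrite -[X in (_ <= X)%N](@prednK (2 ^ e)) ?expn_gt0// -[X in (_ <= X)%N]card_ord.
apply: (@leq_card_in _ _ (fun v => inord (code v))).
move=> v w ve we /(congr1 val)/=; rewrite !inordK ?lt_code//; move: ve we.
rewrite !inE => /eqP/bitsE ve /eqP/bitsE we cvw; apply: val_inj => /=.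
move: ve we cvw; rewrite /code; case: (v) (w) => [a an] [b bn] /=.
have : (2 ^ e = 1 \/ 2 ^ e = 2 * (2 ^ e %/ 2))%N.
  by case: (e) => [|e']; [left|right; rewrite expnS mulKn].
case: ifP; case: ifP; lia.
Qed.

Lemma card_weak_compositions l (n : nat) :
  (#|[pred s : {ffun 'I_n.+1 -> 'I_l.+1} | (\sum_j s j)%N == l]| <= l.+1 ^ n)%N.
Proof.
rewrite -[X in (_ <= X ^ _)%N]card_ord -[X in (_ <= _ ^ X)%N]card_ord -card_ffun.
pose tail (s : {ffun 'I_n.+1 -> 'I_l.+1}) := [ffun j => s (lift ord0 j)].
apply: (@leq_card_in _ _ tail).
move=> s t; rewrite !inE !big_ord_recl => /eqP sl /eqP tl /ffunP st.
have st_lift j : s (lift ord0 j) = t (lift ord0 j) by have := st j; rewrite !ffunE.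
apply/ffunP => j; case: (unliftP ord0 j) => [i ->//|->].
apply: val_inj => /=; apply/eqP.
rewrite -(eqn_add2r (\sum_(i < n) s (lift ord0 i))%N) sl -{1}tl eqn_add2l; apply/eqP.
by apply: eq_bigr => i _; rewrite st_lift.
Qed.

End dyadic_shells.

(** Each s with s_1 + ... + s_d = l contributes at most 2^(s_1) ... 2^(s_d) = 2^l frequencies, and
    such an s is determined by its last d - 1 coordinates. *)
Lemma card_level_index n l : (#|{: @level_index n.+1 l}| <= 2 ^ l * l.+1 ^ n)%N.
Proof.
rewrite card_sig -sum1_card.
pose q (u : {ffun 'I_n.+1 -> 'I_(2 * 2 ^ l).+1}) := [ffun j => inord (tnth (shell (cubek u)) j)] :
  {ffun 'I_n.+1 -> 'I_l.+1}.
have qE u j : norm1 (shell (cubek u)) == l -> q u j = tnth (shell (cubek u)) j :> nat.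
  by move=> /eqP ul; rewrite ffunE inordK// ltnS -{2}ul /norm1 (bigD1 j)//= leq_addr.
rewrite (partition_big q [pred s : {ffun 'I_n.+1 -> 'I_l.+1} | (\sum_j s j)%N == l]) /=; last first.
  move=> u; rewrite inE => ul; apply/eqP; rewrite -[RHS](eqP ul).
  by apply: eq_bigr => j _; rewrite qE.
rewrite [X in (_ <= X)%N]mulnC; apply: (@leq_trans (\sum_(s : {ffun 'I_n.+1 -> 'I_l.+1} | (\sum_j s j)%N == l) 2 ^ l)%N).
  apply: leq_sum => s /eqP sl; rewrite sum1_card.
  pose F j := [pred v : 'I_(2 * 2 ^ l).+1 | bits `|v%:Z - (2 ^ l)%:Z|%N == s j].
  apply: (@leq_trans #|family F|).
    apply/subset_leq_card/fintype.subsetP => u; rewrite unfold_in => /andP[ul /eqP us].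
    by apply/familyP => j; rewrite inE -us qE// !tnth_mktuple.
  rewrite card_family foldrE big_map big_enum/= -[X in (2 ^ X)%N]sl expn_sum.
  by apply: leq_prod => j _; exact: card_bits.
by rewrite sum_nat_const leq_mul2r card_weak_compositions orbT.
Qed.

Section layers.
Context {R : realType} {d : nat}.
Implicit Types (f g h : Rn R d -> R[i]) (l : nat).
Local Notation mu := (torus_measure R d).

Lemma layerE l f :
  layer l f = tpoly (@level_freq d l) (fun i => fourier_coef f (level_freq i)).
Proof.
apply/funext => x; rewrite /layer /delta /tpoly.
pose F (k : d.-tuple int) : R[i] := fourier_coef f k * expi (dotp k x).
rewrite fsbig_finite; last exact: finite_norm1.
transitivity (\sum_(s <- finmap.enum_fset (fset_set [set s : d.-tuple nat | norm1 s = l]))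
    \sum_(i : level_index l | shell (level_freq i) == s) F (level_freq i)).
  apply: eq_big_seq => s; rewrite in_fset_set; last exact: finite_norm1.
  rewrite inE/= => sl; rewrite fsbig_finite; last exact: finite_rho.
  rewrite -[RHS]big_filter -[RHS](big_map (@level_freq d l) xpredT F).
  apply: perm_big; apply: uniq_perm; first exact: finmap.fset_uniq.
    rewrite map_inj_uniq; last exact: level_freq_inj.
    exact/filter_uniq/index_enum_uniq.
  move=> k; rewrite in_fset_set; last exact: finite_rho.
  apply/idP/mapP => [|[j]].
    rewrite inE => /rhoE ks; have [i ik] := level_freq_surj k.
    rewrite ks sl in i ik; exists i => //.
    by rewrite mem_filter ik ks eqxx mem_index_enum.
  by rewrite mem_filter => /andP[/eqP js _] ->; rewrite inE; exact/rhoE.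
rewrite (exchange_big_dep xpredT)//=; apply: eq_bigr => i _.
rewrite -big_filter (_ : [seq _ <- _ | _] = [:: shell (level_freq i)]) ?big_seq1//.
rewrite -(@eq_filter _ (pred1 (shell (level_freq i)))); last by move=> s; rewrite eq_sym.
rewrite filter_pred1_uniq ?finmap.fset_uniq// in_fset_set; last exact: finite_norm1.
by rewrite inE/= norm1_level_freq.
Qed.

Lemma cbmeas_layer l f : cbmeas (layer l f).
Proof. by rewrite layerE; exact: cbmeas_tpoly. Qed.

Lemma fourier_coefB f g k : cint f -> cint g ->
  fourier_coef (fun x => f x - g x) k = fourier_coef f k - fourier_coef g k.
Proof.
move=> cf cg; rewrite /fourier_coef -torus_integralB.
- by congr torus_integral; apply/funext => x; rewrite mulrBl.
- by apply: cint_mul_cbmeas => //; under eq_fun do rewrite -dotp_tneg; exact: cbmeas_expi.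
- by apply: cint_mul_cbmeas => //; under eq_fun do rewrite -dotp_tneg; exact: cbmeas_expi.
Qed.

Lemma layerB l f g x : cint f -> cint g ->
  layer l (fun x => f x - g x) x = layer l f x - layer l g x.
Proof.
move=> cf cg; rewrite !layerE /tpoly -sumrB; apply: eq_bigr => i _.
by rewrite fourier_coefB// mulrBl.
Qed.

Lemma torus_integral_expi (k l : d.-tuple int) :
  torus_integral (fun x : Rn R d => expi (dotp (tsub k l) x)) = (k == l)%:R.
Proof.
rewrite /torus_integral /= (proj2 (torus_integral_cos_sin _)) torus_integral_cos_tsub.
by case: eqP.
Qed.

Lemma fourier_coef_tpoly (I : finType) (kappa : I -> d.-tuple int) (c : I -> R[i]) k :
  fourier_coef (tpoly kappa c) k = \sum_i c i * (kappa i == k)%:R.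
Proof.
have ce (i : I) : cint (fun x : Rn R d => expi (dotp (tsub (kappa i) k) x)).
  exact/cbmeas_cint/cbmeas_expi.
rewrite /fourier_coef (_ : (fun _ => _) = fun x =>
  \sum_i c i * expi (dotp (tsub (kappa i) k) x)); last first.
  apply/funext => x; rewrite /tpoly mulr_suml; apply: eq_bigr => i _.
  by rewrite -mulrA -expiD dotp_tsub.
rewrite (proj2 (torus_integral_sum _ _)).
  by apply: eq_bigr => i _; rewrite torus_integralZ// torus_integral_expi.
move=> i; under eq_fun do rewrite mulrC.
by apply: cint_mul_cbmeas => //; exact: cbmeas_cst.
Qed.

Lemma fourier_coef_layer l f k :
  fourier_coef (layer l f) k = fourier_coef f k *+ (norm1 (shell k) == l).
Proof.
rewrite layerE fourier_coef_tpoly; have [<-{l}|kl] := eqVneq.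
  have [i ik] := level_freq_surj k.
  rewrite (bigD1 i)//= ik eqxx mulr1 big1 ?addr0// => j ji.
  have /negbTE := ji; rewrite -(inj_eq (@level_freq_inj _ _)) ik => ->.
  by rewrite mulr0.
rewrite big1// => i _; rewrite (_ : (_ == k) = false) ?mulr0//.
by apply: contra_neqF kl => /eqP <-; rewrite norm1_level_freq.
Qed.

Lemma eq0_of_fourier_coef0 h : cint h -> (forall k, fourier_coef h k = 0) ->
  \forall x \ae mu, h x = 0.
Proof.
move=> ch h0.
have rt phi : rtrig phi -> \int[mu]_x (complex.Re (h x) * phi x) = 0 /\
    \int[mu]_x (complex.Im (h x) * phi x) = 0.
  move=> [n tp]; have := trig_orthogonal ch h0 tp.
  rewrite /torus_integral; move/eqP; rewrite eq_complex/= => /andP[/eqP hr /eqP hi].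
  split; [rewrite -{}[RHS]hr|rewrite -{}[RHS]hi]; apply: eq_Rintegral => x _.
    by rewrite Re_mulc/= mulr0 subr0.
  by rewrite Im_mulc/= mulr0 add0r.
have [N [mN N0 hN]] := trig_orthogonal_ae0 ch.1 (fun phi tp => (rt phi tp).1).
have [M [mM M0 hM]] := trig_orthogonal_ae0 ch.2 (fun phi tp => (rt phi tp).2).
exists (N `|` M); split; [exact: measurableU|by rewrite measureU0|].
move=> x /= hx; apply: contrapT => /not_orP[Nx Mx]; apply: hx.
have /= [hr] : (EFin \o (fun x => complex.Re (h x))) x = cst 0%E x.
  by apply: contrapT => e; apply: Nx; apply: hN => /=; move/(_ I).
have /= [hi] : (EFin \o (fun x => complex.Im (h x))) x = cst 0%E x.
  by apply: contrapT => e; apply: Mx; apply: hM => /=; move/(_ I).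
by apply/eqP; rewrite eq_complex hr hi !eqxx.
Qed.

End layers.

(** * Recovering a function from its layers *)

Section reconstruction.
Context {R : realType} {d : nat}.
Implicit Types (f g h : Rn R d -> R[i]) (l : nat).
Local Notation mu := (torus_measure R d).

Lemma Re_le_normc (z : R[i]) : `|complex.Re z| <= Normc.normc z.
Proof.
by case: z => x y; rewrite /= -sqrtr_sqr ler_wsqrtr// lerDl sqr_ge0.
Qed.

Lemma Im_le_normc (z : R[i]) : `|complex.Im z| <= Normc.normc z.
Proof.
by case: z => x y; rewrite /= -sqrtr_sqr ler_wsqrtr// lerDr sqr_ge0.
Qed.

Lemma normc_le_Re_Im (z : R[i]) : Normc.normc z <= `|complex.Re z| + `|complex.Im z|.
Proof.
rewrite -(@ler_pXn2r _ 2) ?nnegrE ?normc_ge0 ?addr_ge0//.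
rewrite sqr_normcE sqrrD !real_normK ?num_real// -addrA lerD2l lerDr.
by rewrite mulrn_wge0// mulr_ge0.
Qed.

Lemma Lp1_cint f : Lp 1%:E f -> cint f.
Proof.
move=> [_ mr mi]; rewrite /Lp_norm Lnorm1 => fi.
have mn : measurable_fun setT (fun x => Normc.normc (f x)).
  rewrite (_ : (fun _ => _) = fun x =>
      (complex.Re (f x) ^+ 2 + complex.Im (f x) ^+ 2) `^ 2^-1).
    apply: (measurableT_comp (measurable_powR _)).
    by apply: measurable_funD; apply: measurable_funX.
  apply/funext => x; rewrite powR12_sqrt; first by case: (f x).
  by rewrite addr_ge0 ?sqr_ge0.
have ni : mu.-integrable setT (EFin \o (fun x => Normc.normc (f x))).
  by apply/integrableP; split => //; exact/measurable_EFinP.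
split; apply: (le_integrable measurableT _ _ ni); try exact/measurable_EFinP.
  by move=> x _ /=; rewrite lee_fin [leRHS]ger0_norm ?normc_ge0// Re_le_normc.
by move=> x _ /=; rewrite lee_fin [leRHS]ger0_norm ?normc_ge0// Im_le_normc.
Qed.

Lemma Lp_norm_le_bnd (p w : R) f : 0 < p -> cbmeas f ->
  (Lp_norm p%:E f <= w%:E)%E -> bnd p w f.
Proof.
move=> p0 cf; rewrite /Lp_norm unlock /=.
under eq_integral do rewrite ger0_norm ?normc_ge0//.
have fi : mu.-integrable setT (EFin \o (fun x => Normc.normc (f x) `^ p)).
  by apply: bmeas_integrable; apply: bmeas_normc_powR => //; exact: ltW.
rewrite -[X in (X `^ _)%E]fineK; last exact: integrable_fin_num fi.
rewrite poweR_EFin lee_fin => fw.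
have I0 := integral_normc_powR_ge0 f p.
rewrite /bnd -[leLHS](powRr1 I0) -(mulVf (lt0r_neq0 p0)) powRrM.
by rewrite ge0_ler_powR ?nnegrE ?powR_ge0 ?(ltW p0)// (le_trans _ fw)// powR_ge0.
Qed.

Lemma Lp_norm_infty_le f (B : R) : (\forall x \ae mu, Normc.normc (f x) <= B) ->
  (Lp_norm +oo%E f <= B%:E)%E.
Proof.
move=> [N [mN N0 fN]]; rewrite /Lp_norm unlock /= probability_setT lte01.
apply/ess_sup_inf.ess_supP; exists N; split => // x /= fx; apply: fN => /= fB; apply: fx.
by rewrite lee_fin ger0_norm ?normc_ge0.
Qed.

Lemma Rintegral_abs_le (u : Rn R d -> R) B : bmeas u -> (forall x, `|u x| <= B) ->
  `|\int[mu]_x u x| <= B.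
Proof.
move=> bu uB; rewrite ler_norml -[X in X <= _](Rintegral_prob_cst mu).
rewrite -[X in _ && (_ <= X)](Rintegral_prob_cst mu); apply/andP.
have uB' x : - B <= u x <= B by rewrite -ler_norml.
by split; apply: le_Rintegral => //; try (exact/bmeas_integrable/bmeas_cst);
  try (exact/bmeas_integrable); move=> x _; case/andP: (uB' x).
Qed.

Lemma torus_integral_abs_le f (B : R) : cbmeas f ->
  (forall x, Normc.normc (f x) <= B) -> Normc.normc (torus_integral f) <= 2 * B.
Proof.
move=> [fr fi] fB; rewrite (le_trans (normc_le_Re_Im _))// mulrDl mul1r lerD//=.
  by apply: Rintegral_abs_le => // x; exact: (le_trans (Re_le_normc _)).
by apply: Rintegral_abs_le => // x; exact: (le_trans (Im_le_normc _)).
Qed.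

Section sum_of_layers.
Context (h : Rn R d -> R[i]) (r : nat -> R) (D : R).
Hypothesis ch : cint h.
Hypothesis hr : forall l x, Normc.normc (layer l h x) <= r l.
Hypothesis rD : forall n, \sum_(l < n) r l <= D.

Let S n x := \sum_(l < n) layer l h x.
Let T n := \sum_(l < n) r l.

Let r_ge0 l : 0 <= r l.
Proof. exact: le_trans (normc_ge0 _) (hr l [tuple 0 | _ < d]). Qed.

Let cbmeas_S n : cbmeas (S n).
Proof. by apply: cbmeas_sum => l; exact: cbmeas_layer. Qed.

Let T_le m n : (m <= n)%N -> T m <= T n.
Proof.
move=> /subnKC <-; rewrite /T big_split_ord/= lerDl.
by apply: sumr_ge0 => l _.
Qed.

Let S_dist m n x : (m <= n)%N -> Normc.normc (S n x - S m x) <= T n - T m.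
Proof.
move=> /subnKC <-; rewrite /T /S !big_split_ord/= !(addrAC _ _ (- _)) !subrr !add0r.
by rewrite (le_trans (normc_sum_le _ _))//; apply: ler_sum => l _.
Qed.

Let cvgT : T n @[n --> \oo] --> sup (range T).
Proof.
apply: nondecreasing_cvgn; first by move=> m n; exact: T_le.
by exists D => _ [n _ <-]; exact: rD.
Qed.

Let T_le_sup n : T n <= sup (range T).
Proof. by apply: ub_le_sup; [exists D => _ [m _ <-]; exact: rD|exists n]. Qed.

(** Here [c] stands for the real or the imaginary part: the partial sums are Cauchy because those of
    [r] converge, and the tail bound survives in the limit. *)
Let cvg_part (c : R[i] -> R) x : (forall z w, c (z - w) = c z - c w) ->
  (forall z, `|c z| <= Normc.normc z) -> exists g : R,
  c (S n x) @[n --> \oo] --> g /\ forall m, `|g - c (S m x)| <= sup (range T) - T m.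
Proof.
move=> cB cn.
have dist m n : (m <= n)%N -> `|c (S n x) - c (S m x)| <= T n - T m.
  by move=> mn; rewrite -cB (le_trans (cn _))// S_dist.
have cS : cvgn (fun n => c (S n x)).
  apply/cauchy_cvgP/cauchy_exP => e e0; have e20 : 0 < e / 2 by rewrite divr_gt0.
  have /cvgrPdist_lt/(_ _ e20)[m _ Tm] := cvgT.
  exists (c (S m x)); exists m => // n /= mn.
  rewrite /ball/= distrC (le_lt_trans (dist _ _ mn))//.
  have := Tm m (leqnn m); rewrite /= ger0_norm ?subr_ge0//.
  have := T_le_sup n; lra.
exists (limn (fun n => c (S n x))); split => // m.
have : `|c (S n x) - c (S m x)| @[n --> \oo] --> `|limn (fun n => c (S n x)) - c (S m x)|.
  by apply: cvg_norm; apply: cvgB => //; exact: cvg_cst.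
move=> cv; rewrite -(cvg_lim _ cv)//; apply: limr_le; first exact: cvgP cv.
exists m => // n /= mn; rewrite (le_trans (dist _ _ mn))// lerD2r.
exact: T_le_sup.
Qed.

(* The layers add up uniformly to a bounded function with the Fourier
   coefficients of [h]. *)
Lemma normc_le_sum_layers : \forall x \ae mu, Normc.normc (h x) <= D.
Proof.
have /choice[gr gr_lim] x := cvg_part (c := @complex.Re R) x (raddfB _) Re_le_normc.
have /choice[gi gi_lim] x := cvg_part (c := @complex.Im R) x (raddfB _) Im_le_normc.
pose g x := (gr x +i* gi x)%C.
have gS m x : Normc.normc (g x - S m x) <= 2 * (sup (range T) - T m).
  rewrite (le_trans (normc_le_Re_Im _))// !raddfB/= mulrDl mul1r lerD//.
    exact: (gr_lim x).2.
  exact: (gi_lim x).2.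
have small (e : R) : 0 < e -> exists m, forall n, (m <= n)%N -> sup (range T) - T n < e.
  move=> e0; have /cvgrPdist_lt/(_ _ e0)[m _ Tm] := cvgT; exists m => n mn.
  by have := Tm n mn; rewrite /= ger0_norm ?subr_ge0.
have S_le n x : Normc.normc (S n x) <= T n.
  by rewrite (le_trans (normc_sum_le _ _))//; apply: ler_sum => l _.
have gD x : Normc.normc (g x) <= D.
  apply/ler_addgt0Pr => e e0; have [m /(_ m (leqnn m)) Tm] := small _ e0.
  have := le_normcD (g x - S m x) (S m x); rewrite subrK => /le_trans; apply.
  have sD : sup (range T) <= D.
    by apply: ge_sup; [by exists (T 0), 0|move=> _ [n _ <-]; exact: rD].
  have := gS m x; have := S_le m x; lra.
have cg : cbmeas g.
  split; split.
  - apply: (measurable_fun_cvg (h := fun n x => complex.Re (S n x))).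
      by move=> n; have [[]] := cbmeas_S n.
    by move=> x _; exact: (gr_lim x).1.
  - by exists D => x; exact: (le_trans (Re_le_normc (g x))).
  - apply: (measurable_fun_cvg (h := fun n x => complex.Im (S n x))).
      by move=> n; have [_ []] := cbmeas_S n.
    by move=> x _; exact: (gi_lim x).1.
  - by exists D => x; exact: (le_trans (Im_le_normc (g x))).
have fgh k : fourier_coef g k = fourier_coef h k.
  apply/eqP; rewrite -subr_eq0; apply/eqP/Normc.eq0_normc/eqP.
  rewrite eq_le normc_ge0 andbT; apply/ler_addgt0Pr => e e0; rewrite add0r.
  have e40 : 0 < e / 4 by rewrite divr_gt0.
  have [m Tm] := small _ e40.
  (* Far enough for the tail to be small and for [S n] to contain the level of [k], so that it has
     the same coefficient at [k] as [h]. *)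
  pose n := maxn m (norm1 (shell k)).+1.
  have -> : fourier_coef h k = fourier_coef (S n) k.
    have ck l : cint (fun x : Rn R d => layer l h x * expi (- dotp k x)).
      apply: cint_mul_cbmeas; first exact/cbmeas_cint/cbmeas_layer.
      by under eq_fun do rewrite -dotp_tneg; exact: cbmeas_expi.
    rewrite {2}/fourier_coef /S; under [X in torus_integral X]eq_fun do rewrite mulr_suml.
    rewrite (torus_integral_sum _ (fun l : 'I_n => ck l)).2.
    rewrite (eq_bigr _ (fun (l : 'I_n) _ => fourier_coef_layer l h k)).
    have kn : (norm1 (shell k) < n)%N by rewrite leq_maxr.
    rewrite (bigD1 (Ordinal kn))//= eqxx mulr1n big1 ?addr0// => l.
    by rewrite -val_eqE/= eq_sym => /negbTE ->.
  rewrite -fourier_coefB//; last 2 first.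
  - exact: cbmeas_cint.
  - exact: cbmeas_cint.
  apply: (@le_trans _ _ (2 * (2 * (sup (range T) - T n)))).
    apply: torus_integral_abs_le => [|x].
      apply: cbmeasM; first exact: cbmeasB.
      by under eq_fun do rewrite -dotp_tneg; exact: cbmeas_expi.
    by rewrite Normc.normcM normc_expi mulr1.
  have := Tm n (leq_maxl _ _); lra.
have [N [mN N0 hN]] : \forall x \ae mu, h x - g x = 0.
  apply: (@eq0_of_fourier_coef0 _ _ (fun x => h x - g x)).
    by apply: cintB => //; exact: cbmeas_cint.
  by move=> k; rewrite fourier_coefB ?fgh ?subrr//; exact: cbmeas_cint.
exists N; split => // x /= hx; apply: hN => /= /eqP; rewrite subr_eq0 => /eqP hg.
by apply: hx; rewrite hg.
Qed.

End sum_of_layers.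

End reconstruction.

(** * Entropy of the classes W *)

Section class_W.
Context {R : realType} {d : nat} (q a b : R).
Implicit Types (f g : Rn R d -> R[i]) (l k : nat).

Definition W_bound l : R := 2 `^ (- a * l%:R) * (maxn l 1)%:R `^ ((d%:R - 1) * b).

Lemma W_bound_gt0 l : 0 < W_bound l.
Proof. by rewrite mulr_gt0// powR_gt0// ltr0n leq_max orbT. Qed.

(** Only the coefficients of level [l] matter; divided by [W_bound l], they lie in the L_q ball. The
    exponent 2 (l + 1) is the one from which [trig_sup] recovers the supremum, at the price of
    4^d. *)
Lemma W_level_part l k (e : R) : 1 <= q -> 0 <= e ->
  Ent (@level_freq d l) q (2 * l.+1)%:R k e ->
  part (@W R d q a b) k (fun f g =>
    forall x, Normc.normc (layer l f x - layer l g x) <= 4 ^+ d * (W_bound l * e)).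
Proof.
move=> q1 e0 [h [hk hP]]; have w0 := W_bound_gt0 l; have q0 : 0 < q by exact: lt_le_trans q1.
pose w1 : R[i] := ((W_bound l)^-1%:C)%C.
pose c f (i : level_index l) := w1 * fourier_coef f (level_freq i).
have cE f : tpoly (@level_freq d l) (c f) = fun x => w1 * layer l f x.
  by rewrite tpolyZ layerE.
have cW f : W q a b f -> Lball (@level_freq d l) q (c f).
  move=> [_ /(_ l)] fl; rewrite /Lball/= cE -(mulVf (lt0r_neq0 w0)).
  apply: bnd_scale; rewrite ?invr_ge0 ?(ltW w0) ?(ltW q0)//; first exact: cbmeas_layer.
  apply: Lp_norm_le_bnd => //; exact: cbmeas_layer.
exists (fun f => h (c f)); split=> [f /cW/hk//|f g fW gW fg x].
have := hP _ _ (cW _ fW) (cW _ gW) fg.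
set u := tpoly _ _ => bu.
have uE : (fun x => ((W_bound l)%:C)%C * u x) = tpoly (@level_freq d l)
    (fun i => fourier_coef f (level_freq i) - fourier_coef g (level_freq i)).
  rewrite -tpolyZ; congr tpoly; apply/funext => i; rewrite /c -mulrBr mulrA.
  by rewrite /w1 -rmorphM/= mulfV ?gt_eqF// mul1r.
have -> : layer l f x - layer l g x = (fun x => ((W_bound l)%:C)%C * u x) x.
  by move: uE => /(congr1 (@^~ x)) /= ->; rewrite !layerE tpolyB.
apply: (trig_sup (l := l) (f := fun x => ((W_bound l)%:C)%C * u x)).
- by rewrite uE; apply: trig_tpoly => i j; exact: level_freq_le.
- by rewrite mulr_ge0// ltW.
- by apply: bnd_scale; rewrite ?ler0n ?(ltW w0)//; exact: cbmeas_tpoly.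
Qed.

Lemma W_zero : 0 < q -> W q a b (fun _ : Rn R d => 0).
Proof.
move=> q0; have N0 p : 0 < p -> Lp_norm p%:E (fun _ : Rn R d => 0) = 0%E.
  move=> p0; rewrite /Lp_norm -[RHS](@Lnorm0 _ _ _ (torus_measure R d) p%:E).
    by congr Lnorm; apply/funext => x; rewrite Normc.normc0.
  by rewrite eqe gt_eqF.
split=> [|l]; first by split => //; rewrite N0 ?ltr01// ltry.
have -> : layer l (fun _ : Rn R d => 0) = fun=> 0.
  rewrite layerE; apply/funext => x; rewrite /tpoly big1// => i _.
  rewrite /fourier_coef; under eq_fun do rewrite mul0r.
  by rewrite torus_integral0 mul0r.
by rewrite N0// lee_fin (ltW (W_bound_gt0 l)).
Qed.

End class_W.

(** * Summation over the levels *)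

Section geometric.
Context {R : realType}.
Implicit Types (x : R) (l n M : nat).

Definition ndist l n : nat := ((l - n) + (n - l))%N.

Lemma ndist_leq l n : (n <= l)%N -> (ndist l n)%:R = l%:R - n%:R :> R.
Proof. by move=> nl; rewrite /ndist -natrB//; congr (_%:R); lia. Qed.

Lemma ndist_geq l n : (l <= n)%N -> (ndist l n)%:R = n%:R - l%:R :> R.
Proof. by move=> ln; rewrite /ndist -natrB//; congr (_%:R); lia. Qed.

Lemma leq_ndist l n t : (n + t <= l)%N -> (t <= ndist l n)%N.
Proof. by rewrite /ndist; lia. Qed.

Lemma sum_exp_le x M : 0 <= x < 1 -> \sum_(l < M) x ^+ l <= (1 - x)^-1.
Proof.
move=> /andP[x0 x1]; rewrite -[leRHS]mul1r ler_pdivlMr ?subr_gt0//.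
have := subrX1 x M; have := exprn_ge0 M x0; nra.
Qed.

Lemma sum_exp_ndist_le x n M : 0 <= x < 1 ->
  \sum_(l < M) x ^+ ndist l n <= 2 / (1 - x).
Proof.
move=> x01; have /andP[x0 x1] := x01.
apply: (@le_trans _ _ (\sum_(l < n + M) x ^+ ndist l n)).
  rewrite addnC big_split_ord/= lerDl; apply: sumr_ge0 => l _; exact: exprn_ge0.
rewrite big_split_ord/= mulrDl mul1r lerD//; last first.
  apply: le_trans (sum_exp_le M x01); apply: ler_sum => l _.
  by rewrite /ndist (_ : _ - _ + _ = l)%N//; lia.
rewrite (reindex_inj rev_ord_inj)/=; apply: le_trans (sum_exp_le n x01).
apply: ler_sum => l _; rewrite (_ : ndist _ _ = l.+1); last first.
  by rewrite /ndist; have := ltn_ord l; lia.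
by rewrite exprS ler_piMl ?exprn_ge0// ltW.
Qed.

(** Powers of l + 1 and n + 1 differ by a power of |l - n| + 1 only, which any geometric decay in |l
    - n| absorbs. *)
Lemma ln_natS_dist l n : `|ln (l.+1%:R : R) - ln n.+1%:R| <= ln (ndist l n).+1%:R.
Proof.
have H (u v : nat) : ln (u.+1%:R : R) <= ln v.+1%:R + ln (ndist u v).+1%:R.
  rewrite -lnM ?posrE ?ltr0n// ler_ln ?posrE ?mulr_gt0 ?ltr0n//.
  by rewrite -natrM ler_nat /ndist; nia.
by have := H l n; have := H n l; rewrite (_ : ndist n l = ndist l n) 1?/ndist 1?addnC//;
  rewrite ler_norml; lra.
Qed.

Lemma ln_natS_le (e : R) n : 0 < e -> ln (n.+1%:R : R) <= e * n%:R + (e - ln e).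
Proof.
move=> e0; have := @le_ln1Dx R (e * n.+1%:R - 1).
rewrite subrKC lnM ?posrE ?ltr0n// -natr1 => /(_ _).
have : 0 < e * (n%:R + 1) by rewrite mulr_gt0// natr1 ltr0n.
move=> H /(_ _)/wrap[]; first by lra.
lra.
Qed.

End geometric.

Section level_estimates.
Context {R : realType}.
Implicit Types (a b c beta delta m : R) (l n k : nat).

Lemma powR_expR (x y : R) : 0 < x -> x `^ y = expR (y * ln x).
Proof. by move=> x0; rewrite /powR gt_eqF. Qed.

Lemma natpow_expR k l n : (2 ^ l * n.+1 ^ k)%N%:R = expR (l%:R * ln 2 + k%:R * ln n.+1%:R) :> R.
Proof.
rewrite natrM !natrX expRD !mulr_natl -!lnXn ?ltr0n// !lnK// posrE exprn_gt0 ?ltr0n//.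
Qed.

(** The logarithm of the error on level [l], composed of [W_bound l], sqrt(l + 1) and the power beta
    of the ratio of frequencies to bits. The hypothesis gives the geometric factors a decay of 2 eta
    per level: one eta pays for replacing powers of l + 1 by powers of n + 1, the other is kept. *)
Lemma level_exponent_le a b c beta delta m eta : 0 < eta ->
  exists C : R, forall l n, - (a - beta) * (l%:R - n%:R) + beta * delta * (ndist l n)%:R <=
      - (2 * eta) * (ndist l n)%:R ->
    - a * l%:R * ln 2 + m * b * ln (maxn l 1)%:R + 1 / 2 * ln l.+1%:R +
      beta * (l%:R * ln 2 + m * ln l.+1%:R -
        (ln c + n%:R * ln 2 + m * ln n.+1%:R - delta * (ndist l n)%:R * ln 2)) <=
    - a * n%:R * ln 2 + (m * b + 1 / 2) * ln n.+1%:R - eta * ln 2 * (ndist l n)%:R + C.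
Proof.
move=> eta0; have L0 : 0 < ln 2 :> R by rewrite ln_gt0// ltr1n.
pose E := `|m * b + 1 / 2 + m * beta| + 1.
have E0 : 0 < E by rewrite /E ltr_wpDl.
(* Chosen so that [E * e = eta * ln 2], the share of the decay reserved for the logarithms. *)
pose e := eta * ln 2 / E; have e0 : 0 < e by rewrite /e divr_gt0 ?mulr_gt0.
exists (E * (e - ln e) + `|m * b| * ln 2 - beta * ln c) => l n hln.
set t := ndist l n in hln *.
have ht : `|ln (l.+1%:R : R) - ln n.+1%:R| <= e * t%:R + (e - ln e).
  exact: le_trans (ln_natS_dist _ _) (ln_natS_le _ e0).
have h1 : (m * b + 1 / 2 + m * beta) * (ln (l.+1%:R : R) - ln n.+1%:R) <=
    eta * ln 2 * t%:R + E * (e - ln e).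
  rewrite (le_trans (ler_norm _))// normrM.
  apply: (@le_trans _ _ (E * (e * t%:R + (e - ln e)))).
    by rewrite ler_pM// lerDl.
  by rewrite mulrDr mulrA (_ : E * e = eta * ln 2)// mulrC divfK// gt_eqF.
have h2 : m * b * (ln (maxn l 1)%:R - ln l.+1%:R) <= `|m * b| * ln 2.
  rewrite (le_trans (ler_norm _))// normrM ler_wpM2l// distrC ger0_norm.
    rewrite lerBlDl -lnM ?posrE ?ltr0n ?leq_max ?orbT// ler_ln ?posrE ?mulr_gt0 ?ltr0n ?leq_max ?orbT//.
    by rewrite -natrM ler_nat; lia.
  by rewrite subr_ge0 ler_ln ?posrE ?ltr0n ?leq_max ?orbT// ler_nat; lia.
have h3 : (- (a - beta) * (l%:R - n%:R) + beta * delta * t%:R) * ln 2 <=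
    - (2 * eta) * t%:R * ln 2 by rewrite ler_pM2r.
lra.
Qed.

Lemma low_level_slope a beta delta eta (t : R) : 0 <= t -> 0 <= beta -> delta <= 1 / 2 ->
  2 * (a + 2 * eta) <= beta -> (a - beta) * t + beta * delta * t <= - (2 * eta) * t.
Proof.
move=> t0 b0 delta_half beta_ge; rewrite -mulrDl ler_wpM2r//.
have : beta * delta <= beta * (1 / 2) by rewrite ler_wpM2l.
lra.
Qed.

End level_estimates.

Section W_levels.
Context {R : realType} (d' : nat) (q a b : R).
Hypotheses (q1 : 1 < q) (q2 : q <= 2) (qa : 1 / q < a).
Local Notation d := d'.+1.

Let entropy_rate n : R := expR (- a * n%:R * ln 2 + (d'%:R * b + 1 / 2) * ln n.+1%:R).

(* [k n l] bits are spent on level [l]. The exponent [b0] of [entropy_block]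
   makes the errors decrease geometrically for [l >= n]; for [l < n] they
   decrease thanks to the exponent [b0 * j.+1] with [j] large. *)
Lemma W_levels : exists (k : nat -> nat -> nat) (r : nat -> nat -> R) (C : R),
  [/\ forall n l, part (@W R d q a b) (k n l) (fun f g =>
        forall x, Normc.normc (layer l f x - layer l g x) <= r n l),
      forall n M, (\sum_(l < M) k n l <= 2 ^ n * n.+1 ^ d')%N,
      forall n, exists L, forall l, (L <= l)%N -> k n l = 0%N,
      forall l, k 0%N l = 0%N &
      forall n M, \sum_(l < M) r n l <= C * entropy_rate n].
Proof.
have L0 : 0 < ln 2 :> R by rewrite ln_gt0// ltr1n.
have [b0 /andP[b00 b0a] Ent_b0] := entropy_block q1 q2 qa.
(* Above [n] the slope is - (a - b0) + b0 delta; [delta] takes away at most half of a - b0, and the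
   other half is 2 eta. *)
pose eta := (a - b0) / 4; have eta0 : 0 < eta by rewrite divr_gt0// subr_gt0.
pose delta := Num.min (1 / 2) ((a - b0) / (2 * b0)).
have delta0 : 0 < delta by rewrite lt_min !divr_gt0 ?subr_gt0 ?mulr_gt0.
have delta_half : delta <= 1 / 2 by rewrite ge_min lexx.
have delta_b0 : b0 * delta <= (a - b0) / 2.
  have : delta <= (a - b0) / (2 * b0) by rewrite ge_min lexx orbT.
  by rewrite ler_pdivlMr ?mulr_gt0//; lra.
(* Below [n] the errors must outweigh the growth of 2^(- a l): with delta <= 1/2, an exponent of at
   least 2 (a + 2 eta) leaves the slope - 2 eta. *)
pose j := Num.truncn (2 * (a + 2 * eta) / b0).
pose beta1 := b0 * j.+1%:R.
have beta1_ge : 2 * (a + 2 * eta) <= beta1.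
  by rewrite /beta1 [leRHS]mulrC -ler_pdivrMr// ltW// truncnS_gt.
have [A0 A00 Ent0] := Ent_b0 0%N; have [A1 A10 Ent1] := Ent_b0 j.
pose rho := expR (- (delta * ln 2)) : R.
have rho01 : 0 <= rho < 1.
  by rewrite expR_ge0 -[X in _ < X]expR0 ltr_expR oppr_lt0 mulr_gt0.
(* The two-sided geometric series is at most 2 / (1 - rho), so this [c] keeps the total number of
   bits within [K n]. As c < 1 and [K 0 = 1], truncation leaves no bits at all for [n = 0]. *)
pose c := (1 - rho) / 2; have c0 : 0 < c by rewrite divr_gt0// subr_gt0; case/andP: rho01.
have c1 : c < 1 by rewrite /c; case/andP: rho01; lra.
pose K n := (2 ^ n * n.+1 ^ d')%N.
pose y n l : R := c * (K n)%:R * rho ^+ ndist l n.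
pose k n l := Num.truncn (y n l).
have y0 n l : 0 <= y n l.
  apply: mulr_ge0; first by rewrite mulr_ge0// ltW.
  exact/exprn_ge0/expR_ge0.
have yE n l : y n l = expR (ln c + n%:R * ln 2 + d'%:R * ln n.+1%:R -
    delta * (ndist l n)%:R * ln 2).
  rewrite /y /K natpow_expR -{1}(lnK (c0 : c \is Num.pos)) -expRD /rho -expRM_natl.
  by rewrite -expRD; congr expR; rewrite -mulr_natl; ring.
have [C0 hC0] := level_exponent_le a b c b0 delta d'%:R eta0.
have [C1 hC1] := level_exponent_le a b c beta1 delta d'%:R eta0.
pose rho' := expR (- (eta * ln 2)) : R.
have rho'01 : 0 <= rho' < 1.
  by rewrite expR_ge0 -[X in _ < X]expR0 ltr_expR oppr_lt0 mulr_gt0.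
pose B := 4 ^+ d * (A0 * expR C0 + A1 * expR C1).
(* Both cases, above and below [n], compare exponents in the same way. The truncated [k n l] enters
   through [(k n l).+1], which exceeds [y n l] even where no bits are left. *)
have est n l beta A C' : 0 < beta -> 0 < A ->
    (forall l n : nat, - (a - beta) * (l%:R - n%:R) + beta * delta * (ndist l n)%:R <=
      - (2 * eta) * (ndist l n)%:R ->
    - a * l%:R * ln 2 + d'%:R * b * ln (maxn l 1)%:R + 1 / 2 * ln l.+1%:R +
      beta * (l%:R * ln 2 + d'%:R * ln l.+1%:R -
        (ln c + n%:R * ln 2 + d'%:R * ln n.+1%:R - delta * (ndist l n)%:R * ln 2)) <=
    - a * n%:R * ln 2 + (d'%:R * b + 1 / 2) * ln n.+1%:R - eta * ln 2 * (ndist l n)%:R + C') ->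
    - (a - beta) * (l%:R - n%:R) + beta * delta * (ndist l n)%:R <=
      - (2 * eta) * (ndist l n)%:R ->
    W_bound (d := d) a b l * (A * Num.sqrt l.+1%:R *
      ((2 ^ l * l.+1 ^ d')%N%:R / (k n l).+1%:R) `^ beta) <=
    A * expR C' * (entropy_rate n * rho' ^+ ndist l n).
  move=> beta0 A_0 hC' /hC' {}hC'.
  have -> : A * expR C' * (entropy_rate n * rho' ^+ ndist l n) =
    A * expR (- a * n%:R * ln 2 + (d'%:R * b + 1 / 2) * ln n.+1%:R -
      eta * ln 2 * (ndist l n)%:R + C').
    rewrite -mulrA; congr (_ * _); rewrite /entropy_rate /rho' -expRM_natl -!expRD.
    by congr expR; rewrite -mulr_natl; ring.
  have -> : W_bound (d := d) a b l * (A * Num.sqrt l.+1%:R *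
      ((2 ^ l * l.+1 ^ d')%N%:R / (k n l).+1%:R) `^ beta) =
    A * (W_bound (d := d) a b l * Num.sqrt l.+1%:R *
      ((2 ^ l * l.+1 ^ d')%N%:R / (k n l).+1%:R) `^ beta) by ring.
  rewrite ler_pM2l//; apply: le_trans (_ : expR _ <= _); last by rewrite ler_expR; exact: hC'.
  have W0 := W_bound_gt0 (d := d) a b l.
  rewrite [X in _ <= X]expRD; apply: ler_pM.
  - by rewrite mulr_ge0 ?(ltW W0).
  - exact: powR_ge0.
  - rewrite /W_bound !powR_expR ?ltr0n ?leq_max ?orbT// -powR12_sqrt// powR_expR ?ltr0n//.
    rewrite -!expRD ler_expR -natr1; lra.
  - have -> : forall z : R, expR (beta * z) = expR z `^ beta.
      by move=> z; rewrite powR_expR ?expR_gt0// expRK.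
    rewrite ge0_ler_powR ?nnegrE ?(ltW beta0) ?expR_ge0 ?divr_ge0//.
    rewrite natpow_expR expRB -yE ler_pM2l ?expR_gt0// lef_pV2 ?posrE//.
      exact: ltW (truncnS_gt _).
    by rewrite yE expR_gt0.
exists k, (fun n l => B * (entropy_rate n * rho' ^+ ndist l n)), (B * (2 / (1 - rho'))).
have d1 : (d%:R - 1 : R) = d'%:R by rewrite -natr1 addrK.
have card_l l : #|{: @level_index d l}|%:R <= (2 ^ l * l.+1 ^ d')%N%:R :> R.
  by rewrite ler_nat card_level_index.
have N0 l : 0 < (2 ^ l * l.+1 ^ d')%N%:R :> R by rewrite ltr0n muln_gt0 !expn_gt0.
have e0 n : 0 <= entropy_rate n by exact: expR_ge0.
split.
- move=> n l; have [nl|ln_] := leqP n l.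
    have tE : (ndist l n)%:R = l%:R - n%:R :> R by exact: ndist_leq.
    have := W_level_part a b (ltW q1) _ (Ent0 _ _ _ _ l.+1 (k n l) (@level_freq_inj _ l) (N0 l) (card_l l) isT).
    move=> /(_ _)/wrap[]; first by rewrite !mulr_ge0 ?powR_ge0 ?sqrtr_ge0// ltW.
    apply: part_le => // f g _ _ fg x; apply: le_trans (fg x) _.
    rewrite /B -[leRHS]mulrA ler_pM2l ?exprn_gt0//.
    apply: (@le_trans _ _ (A0 * expR C0 * (entropy_rate n * rho' ^+ ndist l n))).
      rewrite mulr1; apply: est => //; rewrite tE.
      have tn : 0 <= l%:R - n%:R :> R by rewrite subr_ge0 ler_nat.
      move: (l%:R - n%:R) tn => t t0; rewrite /eta; nra.
    rewrite ler_wpM2r// ?mulr_ge0 ?exprn_ge0 ?expR_ge0// lerDl mulr_ge0 ?expR_ge0//.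
    exact: ltW.
  have tE : (ndist l n)%:R = n%:R - l%:R :> R by exact/ndist_geq/ltnW.
  have := W_level_part a b (ltW q1) _ (Ent1 _ _ _ _ l.+1 (k n l) (@level_freq_inj _ l) (N0 l) (card_l l) isT).
  move=> /(_ _)/wrap[]; first by rewrite !mulr_ge0 ?powR_ge0 ?sqrtr_ge0// ltW.
  apply: part_le => // f g _ _ fg x; apply: le_trans (fg x) _.
  rewrite /B -[leRHS]mulrA ler_pM2l ?exprn_gt0//.
  apply: (@le_trans _ _ (A1 * expR C1 * (entropy_rate n * rho' ^+ ndist l n))).
    apply: est => //; first by rewrite mulr_gt0.
    rewrite tE; have tn : 0 <= n%:R - l%:R :> R by rewrite subr_ge0 ler_nat ltnW.
    rewrite -[l%:R - n%:R]opprB mulrNN; move: (n%:R - l%:R) tn => t t0.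
    apply: low_level_slope => //.
    by apply: mulr_ge0 => //; exact: ltW.
  rewrite ler_wpM2r// ?mulr_ge0 ?exprn_ge0 ?expR_ge0// lerDr mulr_ge0 ?expR_ge0//.
  exact: ltW.
- move=> n M; rewrite -(ler_nat R) natr_sum.
  apply: (@le_trans _ _ (\sum_(l < M) y n l)).
    by apply: ler_sum => l _; rewrite truncn_le.
  rewrite -mulr_sumr -[leRHS]mulr1 [X in _ <= X]mulrC mulrAC -/(K n) ler_wpM2r//.
  have := sum_exp_ndist_le n M rho01; have /andP[_ r1] := rho01.
  rewrite ler_pdivlMr ?subr_gt0// /c; lra.
- move=> n; exists (n + (Num.truncn (c * (K n)%:R / (delta * ln 2))).+1)%N => l Ll.
  apply/truncn0Pn; rewrite -ltNge /y.
  have dL : 0 < delta * ln 2 by rewrite mulr_gt0.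
  have : c * (K n)%:R / (delta * ln 2) < (ndist l n)%:R.
    by rewrite (lt_le_trans (truncnS_gt _))// ler_nat leq_ndist.
  rewrite ltr_pdivrMr// => ltt; rewrite /rho -expRM_natl mulrN expRN.
  rewrite ltr_pdivrMr ?expR_gt0// mul1r; apply: lt_le_trans (expR_ge1Dx _).
  by move: ltt; rewrite mulr_natl; lra.
- move=> l; apply/truncn0Pn; rewrite -ltNge /y /K mul1n exp1n mulr1.
  apply: le_lt_trans c1; rewrite ler_piMr ?(ltW c0)//.
  by rewrite exprn_ile1//; case/andP: rho01 => // _ /ltW.
- move=> n M; rewrite -mulr_sumr -mulrA ler_pM2l; last first.
    by rewrite /B mulr_gt0 ?exprn_gt0// addr_gt0 ?mulr_gt0 ?expR_gt0.
  rewrite -mulr_sumr mulrC ler_wpM2r//.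
  exact: sum_exp_ndist_le.
Qed.

End W_levels.

(** * Covering the class in the uniform norm *)

Section entropy_of_W.
Context {R : realType} (d' : nat) (q a b : R).
Hypotheses (q1 : 1 < q) (q2 : q <= 2) (qa : 1 / q < a).
Local Notation d := d'.+1.
Local Notation A := (@W R d q a b).

Lemma entropy_W_le : exists C : R, forall n k, (2 ^ n * n.+1 ^ d' <= k)%N ->
  (entropy_Linfty A k <=
    (C * expR (- a * n%:R * ln 2 + (d'%:R * b + 1 / 2) * ln n.+1%:R))%:E)%E.
Proof.
have [k [r [C [hp hk hz h0 hr]]]] := W_levels d' b q1 q2 qa.
exists C => n K nK; set e := C * _.
have dist m f g : A f -> A g ->
    (forall l x, Normc.normc (layer l f x - layer l g x) <= r m l) ->
    (Lp_norm +oo%E (f - g)%R <=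
      (C * expR (- a * m%:R * ln 2 + (d'%:R * b + 1 / 2) * ln m.+1%:R))%:E)%E.
  move=> [/Lp1_cint cf _] [/Lp1_cint cg _] fg; apply: Lp_norm_infty_le.
  apply: (@normc_le_sum_layers _ _ (fun x => f x - g x) (r m)) => //.
  - exact: cintB.
  - by move=> l x; rewrite layerB.
(* Without bits there is a single label, so any two functions of the class are close on that
   level. *)
have part0_close m l f g x : k m l = 0%N -> A f -> A g ->
    Normc.normc (layer l f x - layer l g x) <= r m l.
  move=> kml Af Ag; have [h [hk0 hP]] := hp m l; apply: hP => //.
  by move: (hk0 _ Af) (hk0 _ Ag); rewrite kml !ltnS !leqn0 => /eqP-> /eqP->.
have A0 : A (fun=> 0) by apply: W_zero; exact: lt_trans q1.
(* Comparison with the zero function for [n = 0], where no level receives bits, shows that the class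
   consists of essentially bounded functions. *)
have Loo f : A f -> Lp +oo%E f.
  move=> Af; have [[pf mr mi _] _] := Af; split=> //.
  have := dist 0%N f (fun=> 0) Af A0 (fun l x => part0_close 0%N l _ _ x (h0 l) Af A0).
  rewrite (_ : f - (fun=> 0) = f); last by apply/funext => x; exact: subr0.
  by move=> /le_lt_trans; apply; rewrite ltry.
(* Only the levels below [L] need a partition. *)
have [L hL] := hz n.
have [h [hK hP]] : part A K (fun f g =>
    forall l x, Normc.normc (layer l f x - layer l g x) <= r n l).
  apply: part_le (part_bigI (fun l (_ : (l < L)%N) => hp n l)).
    exact: leq_trans (hk n L) nK.
  move=> f g Af Ag fg l x; have [Ll|lL] := leqP L l; last exact: fg.
  exact: part0_close (hL _ Ll) Af Ag.
(* The centres are members of the pieces; labels that do not occur get the zero function. *)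
pose y (j : 'I_(2 ^ K)) : Rn R d -> R[i] :=
  if pselect (exists g, A g /\ h g = j) is left E then projT1 (cid E) else fun=> 0.
apply: ereal_inf_lbound; exists e => //; split.
  by have := hr n 0%N; rewrite big_ord0.
exists y; split=> [j|f Af].
  by apply: Loo; rewrite /y; case: pselect => // E; have [] := projT2 (cid E).
exists (Ordinal (hK _ Af)) => //; split; first exact: Loo.
rewrite /y; case: pselect => [E|[]]; last by exists f.
by have [Ag gf] := projT2 (cid E); apply: dist => //; exact: hP.
Qed.

End entropy_of_W.

(** Up to constant factors k is 2^n (n + 1)^d', so ln k is comparable to n + 1, and 2^(- a n) to
    k^(- a) (ln k)^(a d'). This is how the exponent d' b becomes d' (a + b). *)
Lemma entropy_rate_le {R : realType} (d' : nat) (a b : R) : 0 < a ->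
  exists C : R, forall n k, (2 <= k)%N ->
  (2 ^ n * n.+1 ^ d' <= k)%N -> (k < 2 ^ n.+1 * n.+2 ^ d')%N ->
  expR (- a * n%:R * ln 2 + (d'%:R * b + 1 / 2) * ln n.+1%:R) <=
    C * (k%:R `^ (- a) * ln k%:R `^ (d'%:R * (a + b) + 1 / 2)).
Proof.
move=> a0.
set m : R := d'%:R; have m0 : 0 <= m by exact: ler0n.
set L : R := ln 2; have L0 : 0 < L by rewrite ln_gt0// ltr1n.
pose M := L + m * (L + 1); have M0 : 0 < M by rewrite ltr_wpDr// mulr_ge0// addr_ge0// ltW.
pose c := `|ln (L / 2)| + `|ln M|.
(* Here (1 + m) L bounds the excess of ln k over the logarithm of 2^n (n + 1)^d', and [c] bounds the
   distance from ln (n + 1) to ln (ln k). *)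
exists (expR (a * (1 + m) * L + `|m * (a + b) + 1 / 2| * c)) => n k k2 nk kn.
have k0 : 0 < k%:R :> R by rewrite ltr0n; lia.
set x := ln k%:R; set y := ln n.+1%:R.
have xL : L <= x by rewrite ler_ln ?posrE// ler_nat.
have x0 : 0 < x by exact: lt_le_trans xL.
have y0 : 0 <= y by rewrite ln_ge0// ler1n.
have yn : y <= n%:R by have := @le_ln1Dx R n%:R; rewrite nat1r; apply; rewrite (lt_le_trans _ (ler0n _ _))// ltrN10.
have xn : n%:R * L <= x.
  have : expR (n%:R * L + m * y) <= k%:R by rewrite -natpow_expR ler_nat.
  rewrite -[X in _ <= X](lnK (k0 : k%:R \is Num.pos)) ler_expR.
  by have := mulr_ge0 m0 y0; rewrite -/x; lra.
have nx : x <= (n%:R + 1) * L + m * (L + y).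
  have : k%:R < expR (n.+1%:R * L + m * ln n.+2%:R) :> R by rewrite -natpow_expR ltr_nat.
  rewrite -[X in X < _](lnK (k0 : k%:R \is Num.pos)) ltr_expR natr1 => /ltW /le_trans; apply.
  rewrite lerD2l ler_wpM2l// -lnM ?posrE// ler_ln ?posrE ?mulr_gt0//.
  by rewrite -natrM ler_nat mul2n -addnn addnS ltnS leq_addr.
have lnx : `|y - ln x| <= c.
  have h1 : y + ln (L / 2) <= ln x.
    rewrite -lnM ?posrE ?ltr0n ?divr_gt0// ler_ln ?posrE ?mulr_gt0 ?divr_gt0//.
    by rewrite -natr1; lra.
  have h2 : ln x <= y + ln M.
    rewrite -lnM ?posrE ?ltr0n// ler_ln ?posrE ?mulr_gt0//.
    have h3 : m * y <= m * n%:R by rewrite ler_wpM2l.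
    have h4 : 0 <= m * L * n%:R by rewrite mulr_ge0// mulr_ge0// ltW.
    by rewrite -natr1 /M; lra.
  have := ler_norm (ln (L / 2)); have := ler_norm (- ln (L / 2)); rewrite normrN.
  have := ler_norm (ln M); have := normr_ge0 (ln M).
  by rewrite /c ler_norml; lra.
rewrite !powR_expR// -!expRD ler_expR -/x.
have h3 : (m * (a + b) + 1 / 2) * (y - ln x) <= `|m * (a + b) + 1 / 2| * c.
  by rewrite (le_trans (ler_norm _))// normrM ler_wpM2l.
have h4 : a * x <= a * ((n%:R + 1) * L + m * (L + y)) by rewrite ler_wpM2l// ltW.
lra.
Qed.

Theorem theorem1p8 (R : realType) (d : nat) (q a b : R)
  (hd : (1 <= d)%N) (hq1 : 1 < q) (hq2 : q <= 2) (ha : 1 / q < a) :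
  exists C : R, forall k : nat, (2 <= k)%N ->
    (entropy_Linfty (@W R d q a b) k <=
      (C * (k%:R `^ (- a) *
        ln k%:R `^ ((d%:R - 1) * (a + b) + 1 / 2)))%:E)%E.
Proof.
case: d hd => [//|d'] _; rewrite -natr1 addrK.
have [C1 hC1] := entropy_W_le d' b hq1 hq2 ha.
have a0 : 0 < a by apply: lt_trans ha; rewrite divr_gt0// (lt_trans _ hq1).
have [C2 hC2] := entropy_rate_le d' b a0.
exists (`|C1| * C2) => k k2.
have exP : exists n, (2 ^ n * n.+1 ^ d' <= k)%N.
  by exists 0%N; rewrite mul1n exp1n; lia.
have leP n : (2 ^ n * n.+1 ^ d' <= k -> n <= k)%N.
  move=> nk; rewrite (leq_trans (ltnW (ltn_expl n (leqnn 2))))//.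
  by rewrite (leq_trans _ nk)// leq_pmulr// expn_gt0.
(* The largest [n] whose budget fits into [k] bits; by maximality [k] is within a constant factor of
   that budget. *)
have [n nk max_n] := ex_maxnP exP leP.
have kn : (k < 2 ^ n.+1 * n.+2 ^ d')%N.
  by rewrite ltnNge; apply/negP => /max_n; rewrite ltnn.
rewrite (le_trans (hC1 n k nk))// lee_fin -[leRHS]mulrA.
apply: (@le_trans _ _ (`|C1| * expR (- a * n%:R * ln 2 + (d'%:R * b + 1 / 2) * ln n.+1%:R))).
  by rewrite ler_wpM2r ?expR_ge0// ler_norm.
by rewrite ler_wpM2l//; exact: hC2.
Qed.
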